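(* Let $\{X_k\}_{k\in\mathbb{Z}}$ be a $q$-variate stationary process which has a spectral density $w$ with $\log\det w\in L_1(\mathbb{T})$, and suppose that $M_{(-\infty,-1]}^X\cap M_{[-n,\infty)}^X=M_{[-n,-1]}^X$ for all $n=1,2,\dots$. Then, for every $n\in\mathbb{N}$, $$v_n=c_0\Bigl(\sum_{k=0}^\infty b_{n,0}^{2k}\Bigr)c_0^*,\qquad \tilde v_n=\tilde c_0\Bigl(\sum_{k=0}^\infty\tilde b_{n,0}^{2k}\Bigr)\tilde c_0^*,$$ $$\langle P_{[-n,-1]}^\perp X_0,\ P_{[-n,-1]}^\perp X_{-(n+1)}\rangle=c_0\Bigl(\sum_{k=0}^\infty b_{n,0}^{2k+1}\Bigr)\tilde c_0^*.$$
   Context: Stationary processes. Let $q\in\mathbb{N}$. A $q$-variate stationary process $\{X_k\}_{k\in\mathbb{Z}}$ is a $\mathbb{C}^q$-valued, centered, weakly stationary process on a probability space, $X_k=(X_k^1,\dots,X_k^q)^{\mathrm T}$. $M$ is the closed complex linear span in $L^2(\Omega,\mathcal F,P)$ of all entries $X_k^j$, with inner product $(x,y)_M=E[x\overline{y}]$. For $K\subset\mathbb{Z}$ (e.g. $(-\infty,n]$, $[n,\infty)$, $[m,n]$, all understood as sets of integers), $M_K^X$ is the closed linear span of $\{X_k^j:1\le j\le q,\ k\in K\}$, and $P_K$, $P_K^\perp$ are the orthogonal projections of $M$ onto $M_K^X$ and $(M_K^X)^\perp$; they act entrywise on $M^q$, the space of $\mathbb{C}^q$-valued random vectors with entries in $M$.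 For $x,y\in M^q$, $\langle x,y\rangle:=E[xy^*]\in\mathbb{C}^{q\times q}$. $\mathbb{T}$ is the unit circle, $\mathbb{D}$ the open unit disk. A spectral density of $\{X_k\}$ is a positive-semidefinite-Hermitian-matrix-valued $w\in L_1^{q\times q}(\mathbb{T})$ with $\langle X_m,X_n\rangle=\int_{-\pi}^{\pi}e^{-i(m-n)\theta}w(e^{i\theta})\frac{d\theta}{2\pi}$. Outer factors. Assume $\log\det w\in L_1(\mathbb{T})$. Put $\tilde w(e^{i\theta})=w(e^{-i\theta})$, the spectral density of the time-reversed process $\tilde X_k:=X_{-k}$. Fix outer functions $h,\tilde h\in H_2^{q\times q}(\mathbb{T})$ with $w=hh^*$, $\tilde w=\tilde h\tilde h^*$ a.e. (they exist and are unique up to right constant unitary factors); here $H_2^{q\times q}$ is the matrix-valued Hardy class (functions identified with their holomorphic extensions to $\mathbb{D}$) and $f\in H_2^{q\times q}$ is outer if $\log|\det f(0)|=\int_{-\pi}^{\pi}\log|\det f(e^{i\theta})|\frac{d\theta}{2\pi}$. Put $h_\sharp(z):=\{\tilde h(\overline z)\}^*$, so that $w=h_\sharp^*h_\sharp$ a.e. Set $c_0:=h(0)$, $\tilde c_0:=\tilde h(0)$, and $$\beta_k:=-\int_{-\pi}^{\pi}e^{-ik\theta}h(e^{i\theta})^*h_\sharp(e^{i\theta})^{-1}\frac{d\theta}{2\pi},\qquad k\in\mathbb{Z}.$$ Sequences $b,\tilde b$. For $n\in\mathbb{N}$, the square-summable $\mathbb{C}^{q\times q}$-valued sequences $\{b_{n,j}^k\}_{j\ge0}$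 and $\{\tilde b_{n,j}^k\}_{j\ge0}$, $k=0,1,2,\dots$, are defined recursively by $$b_{n,j}^0=\delta_{0j}I_q,\quad b_{n,j}^{2k+1}=\sum_{l=0}^\infty b_{n,l}^{2k}\beta_{n+j+l+1},\quad b_{n,j}^{2k+2}=\sum_{l=0}^\infty b_{n,l}^{2k+1}\beta_{n+j+l+1}^*,$$ $$\tilde b_{n,j}^0=\delta_{0j}I_q,\quad \tilde b_{n,j}^{2k+1}=\sum_{l=0}^\infty\tilde b_{n,l}^{2k}\beta_{n+j+l+1}^*,\quad \tilde b_{n,j}^{2k+2}=\sum_{l=0}^\infty\tilde b_{n,l}^{2k+1}\beta_{n+j+l+1}.$$ Finite prediction error covariances. For $n\ge1$, $$v_n:=\langle P_{[-n,-1]}^\perp X_0,P_{[-n,-1]}^\perp X_0\rangle,\qquad \tilde v_n:=\langle P_{[-n,-1]}^\perp X_{-(n+1)},P_{[-n,-1]}^\perp X_{-(n+1)}\rangle.$$ *)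

(* Defs.v *)
From HB Require Import structures.
From mathcomp Require Import all_boot all_order all_algebra.
From mathcomp Require Import complex.
From mathcomp Require Import all_classical all_reals all_analysis.

Set Implicit Arguments.
Unset Strict Implicit.
Unset Printing Implicit Defensive.

Import Order.TTheory GRing.Theory Num.Theory.
Import numFieldNormedType.Exports.

Local Open Scope classical_set_scope.
Local Open Scope ring_scope.
Local Open Scope sesquilinear_scope.

(* A^t* is the conjugate transpose of A, and z^* the conjugate of z.  The norm
   `|z| of z : R[i] lies in R[i], whence the occurrences of Re `|z|.          *)

Section complex_integral.
Context d (T : measurableType d) (R : realType) (mu : {measure set T -> \bar R}).

Definition cintegral (D : set T) (f : T -> R[i]) : R[i] :=
  Complex (Rintegral mu D (fun x => complex.Re (f x)))
          (Rintegral mu D (fun x => complex.Im (f x))).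

Definition cLfun (D : set T) (p : nat) (f : T -> R[i]) : Prop :=
  [/\ measurable_fun D (fun x => complex.Re (f x)),
      measurable_fun D (fun x => complex.Im (f x)) &
      mu.-integrable D (fun x => ((complex.Re `|f x|) ^+ p)%:E)].

Definition mxintegral m n (D : set T) (F : T -> 'M[R[i]]_(m, n)) :
    'M[R[i]]_(m, n) :=
  \matrix_(i, j) cintegral D (fun x => F x i j).

End complex_integral.

Section series.
Context (R : realType) (m n : nat).

(* R[i]^o is R[i] with the topology given by its norm *)
Definition mxsummable (u : nat -> 'M[R[i]]_(m, n)) : Prop :=
  forall i j, cvgn (series (fun l => u l i j : (R[i])^o)).

Definition mxseries (u : nat -> 'M[R[i]]_(m, n)) : 'M[R[i]]_(m, n) :=
  \matrix_(i, j) (limn (series (fun l => u l i j : (R[i])^o)) : R[i]).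

End series.

Definition psdmx (R : realType) q (A : 'M[R[i]]_q) : Prop :=
  A^t* = A /\ forall v : 'rV[R[i]]_q, 0 <= (v *m A *m v^t*) 0 0.

(* Elements of L^2(Omega) are represented by functions; all the subspaces below
   are closed under almost sure equality.                                     *)
Section second_order.
Context d (Omega : measurableType d) (R : realType) (P : probability Omega R).
Implicit Types (x y : Omega -> R[i]) (A S : set (Omega -> R[i])).

Definition inner x y : R[i] := cintegral P setT (fun t => x t * (y t)^*).

Definition L2norm x : R := Num.sqrt (complex.Re (inner x x)).

Definition lin_span A : set (Omega -> R[i]) :=
  [set x | exists (m : nat) (c : 'I_m -> R[i]) (g : 'I_m -> Omega -> R[i]),
     (forall i, A (g i)) /\ x = (fun t => \sum_(i < m) c i * g i t)].

Definition closed_span A : set (Omega -> R[i]) :=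
  [set x | cLfun P setT 2 x /\
     forall e : R, 0 < e ->
       exists2 y, lin_span A y & L2norm (fun t => x t - y t) < e].

Definition oproj S x : Omega -> R[i] :=
  xget (fun=> 0)
    [set p | S p /\ forall s, S s -> inner (fun t => x t - p t) s = 0].

Context (q : nat).
Implicit Types (X : int -> Omega -> 'cV[R[i]]_q) (K : set int).
Implicit Types (U V : Omega -> 'cV[R[i]]_q).

Definition gram U V : 'M[R[i]]_q :=
  mxintegral P setT (fun t => U t *m (V t)^t*).

Definition stationary_process X : Prop :=
  [/\ forall k j, cLfun P setT 2 (fun t => X k t j 0),
      forall k, mxintegral P setT (X k) = 0 &
      forall m n k, gram (X (m + k)) (X (n + k)) = gram (X m) (X n)].

Definition MX X K : set (Omega -> R[i]) :=
  closed_span [set x | exists k j, K k /\ x = (fun t => X k t j 0)].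

(* orthogonal complement of MX X K inside MX X setT *)
Definition MXperp X K : set (Omega -> R[i]) :=
  [set x | MX X setT x /\ forall y, MX X K y -> inner x y = 0].

Definition Pperp X K U : Omega -> 'cV[R[i]]_q :=
  fun t => \col_j oproj (MXperp X K) (fun s => U s j 0) t.

End second_order.

(* A function on the unit circle is given by a function on R[i], of which only
   the values on the circle matter.                                           *)
Section circle.
Context (R : realType).
Local Notation leb := (@lebesgue_measure R).
Local Notation period := (`[- pi, pi]%classic : set R).

Definition expi (theta : R) : R[i] := Complex (cos theta) (sin theta).

Definition circle_ae (Q : R[i] -> Prop) : Prop :=
  {ae leb, forall theta, period theta -> Q (expi theta)}.

Context (q : nat).
Implicit Types (f w h : R[i] -> 'M[R[i]]_q).

(* integral of f(e^{i theta}) d theta / (2 pi) over [-pi, pi]; the factor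
   e^{- i k theta} is written z ^ (- k), with z = e^{i theta}                 *)
Definition circle_mean f : 'M[R[i]]_q :=
  (((2 * pi)^-1)%:C)%C *: mxintegral leb period (fun theta => f (expi theta)).

Definition circle_Lfun (p : nat) f : Prop :=
  forall i j, cLfun leb period p (fun theta => f (expi theta) i j).

Definition spectral_density d (Omega : measurableType d)
    (P : probability Omega R) (X : int -> Omega -> 'cV[R[i]]_q) w : Prop :=
  [/\ circle_Lfun 1 w,
      circle_ae (fun z => psdmx (w z)) &
      forall m n : int,
        gram P (X m) (X n) = circle_mean (fun z => z ^ (- (m - n)) *: w z)].

(* lne 0 = -oo, so that integrability implies det w > 0 a.e.                  *)
Definition logdet_integrable w : Prop :=
  leb.-integrable period
    (fun theta => lne (complex.Re (\det (w (expi theta))))%:E).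

Definition hardy2 f : Prop :=
  circle_Lfun 2 f /\
  forall m : nat, (0 < m)%N -> circle_mean (fun z => z ^+ m *: f z) = 0.

(* holomorphic extension of f to the unit disk, by Cauchy's integral formula  *)
Definition hardy_ext f (z : R[i]) : 'M[R[i]]_q :=
  circle_mean (fun u => (1 - z / u)^-1 *: f u).

Definition outer f : Prop :=
  hardy2 f /\
  (lne (complex.Re `|\det (hardy_ext f 0)|)%:E =
   ((2 * pi)^-1)%:E *
     \int[leb]_(theta in period) lne (complex.Re `|\det (f (expi theta))|)%:E)%E.

Definition time_reversal w (z : R[i]) : 'M[R[i]]_q := w z^*.

Definition sharp h (z : R[i]) : 'M[R[i]]_q := (h z^*)^t*.

Definition beta h ht (k : int) : 'M[R[i]]_q :=
  - circle_mean (fun z => z ^ (- k) *: ((h z)^t* *m invmx (sharp ht z))).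

End circle.

(* altseq a a' n k j: the sequences of the alternating recursion in which a is
   used to pass from an even k to k + 1, and a' from an odd k to k + 1        *)
Fixpoint altseq (R : realType) (q : nat) (a a' : int -> 'M[R[i]]_q)
    (n k j : nat) {struct k} : 'M[R[i]]_q :=
  if k is k'.+1 then
    mxseries (fun l => altseq a a' n k' l *m
                       (if odd k' then a' else a) (n + j + l + 1)%N%:Z)
  else (j == 0%N)%:R%:M.

Section b_sequences.
Context (R : realType) (q : nat) (h ht : R[i] -> 'M[R[i]]_q).

Definition b_seq : nat -> nat -> nat -> 'M[R[i]]_q :=
  altseq (beta h ht) (fun k => (beta h ht k)^t*).

Definition bt_seq : nat -> nat -> nat -> 'M[R[i]]_q :=
  altseq (fun k => (beta h ht k)^t*) (beta h ht).

End b_sequences.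

(* Main.v *)
(* In the Kolmogorov picture X_k corresponds to the rows of z^{-k} h in L^2 of
   the circle.  Because h is outer, the rows of z^{-k} I are the innovations xi_k
   of X: this is Szego's theorem, obtained here from Jensen's inequality applied
   to the determinant of h E^*, where E is the one-step prediction error of h.
   The time-reversed process and ht give backward innovations eta_k, and
   <xi_j, eta_k> = - beta_{j+k}.
   Since the past and the future meet in the span of X_{-n}, ..., X_{-1}, the
   orthogonal complement of that span is the closed span of the xi_j (j >= 0)
   and the eta_k (k > n).  Up to the factors c0 and ct0, the residuals of X_0
   and X_{-(n+1)} are dual to xi_0 and eta_{n+1} in it, hence are the sums of the
   series obtained by projecting xi_0, resp. eta_{n+1}, alternately onto the spans
   of the eta_k and of the xi_j, with signs; the b^k_{n,j} are the coordinates of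
   the k-th term.                                                            *)
From HB Require Import structures.
Require Import Defs.
From mathcomp Require Import all_boot all_order all_algebra.
From mathcomp Require Import complex perm.
From mathcomp Require Import all_classical all_reals all_analysis.
From mathcomp Require Import measurable_realfun.
From mathcomp Require Import ring lra zify.

Set Implicit Arguments.
Unset Strict Implicit.
Unset Printing Implicit Defensive.

Import Order.TTheory GRing.Theory Num.Theory.
Import numFieldNormedType.Exports.
Local Open Scope classical_set_scope.
Local Open Scope sesquilinear_scope.
Local Open Scope ring_scope.

(** Nothing keeps the angle between the two spans of innovations away from zero, so the alternating
    series need not converge geometrically. Its convergence is drawn from the residual itself, whose
    existence costs only an orthogonal projection. If [s_k] are the terms and [S_N] is the sum of
    [|s_k|^2] for k < N, the sum of the first 2N terms has squared norm at most [S_N], while its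
    inner product with the normalized residual is exactly [S_N]; Cauchy-Schwarz then bounds [S_N] by
    the squared norm of the residual, and the same identities make the partial sums Cauchy. The
    other obstacle is the form of the hypothesis on [h]: outerness is equality in Jensen's formula
    for a determinant, whereas prediction is about closed spans. Two tools bridge the gap: an
    integrable function with vanishing Fourier coefficients is null, which shows that certain matrix
    products are constant, and Jensen's inequality for square integrable analytic matrix functions,
    reached from polynomials by factoring the determinant and applying Fatou's lemma. *)

Section modulus.
Context (R : realType).
Implicit Types z u : R[i].

(** Squared modulus as a real number: [|z|] itself lies in [R[i]] and brings square roots, so
    estimates and limits are stated through [cn]. *)
Definition cn z : R := complex.Re z ^+ 2 + complex.Im z ^+ 2.

Lemma conjE z : z^* = conjc z. Proof. by []. Qed.

Lemma conj_real (r : R) : (r%:C%C : R[i])^* = r%:C%C.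
Proof. exact: conjc_real. Qed.

Lemma cnE z : z * z^* = (cn z)%:C%C.
Proof.
case: z => a b; rewrite conjE /cn /= ; apply/eqP.
by rewrite eq_complex /=; apply/andP; split; apply/eqP; ring.
Qed.

Lemma cn_ge0 z : 0 <= cn z. Proof. by rewrite addr_ge0 ?sqr_ge0. Qed.

Lemma cn0 : cn 0 = 0. Proof. by rewrite /cn /= expr0n addr0. Qed.

Lemma cn_eq0 z : cn z = 0 -> z = 0.
Proof.
case: z => a b; rewrite /cn /= => /eqP; rewrite paddr_eq0 ?sqr_ge0// !sqrf_eq0.
by move=> /andP[/eqP -> /eqP ->].
Qed.

Lemma cnM z u : cn (z * u) = cn z * cn u.
Proof. by case: z u => a b [c e]; rewrite /cn /=; ring. Qed.

Lemma cnN z : cn (- z) = cn z.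
Proof. by case: z => a b; rewrite /cn /=; ring. Qed.

Lemma cnJ z : cn z^* = cn z.
Proof. by case: z => a b; rewrite conjE /cn /=; ring. Qed.

Lemma cn_real (r : R) : cn r%:C%C = r ^+ 2.
Proof. by rewrite /cn /= expr0n addr0. Qed.

Lemma cnD_le z u : cn (z + u) <= 2 * cn z + 2 * cn u.
Proof.
case: z u => a b [c e]; rewrite /cn /=.
have := sqr_ge0 (a - c); have := sqr_ge0 (b - e); nra.
Qed.

Lemma normr_cn z : `|z| ^+ 2 = (cn z)%:C%C.
Proof. by rewrite -add_Re2_Im2. Qed.

Lemma Re_normr_cn z : complex.Re `|z| ^+ 2 = cn z.
Proof. by rewrite normc_def /= sqr_sqrtr ?cn_ge0. Qed.

(** Convergence in [R[i]] phrased through a real null sequence, in the same shape as [hconv];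
    [cvg_clim] returns to the topology used by [mxseries]. *)
Definition clim (c : nat -> R[i]) l := (fun n => cn (c n - l)) @ \oo --> (0 : R).

Lemma nonneg_cvg0P (u : nat -> R) : (forall n, 0 <= u n) ->
  (u @ \oo --> (0 : R)) <->
  (forall e, 0 < e -> exists N, forall n, (N <= n)%N -> u n < e).
Proof.
move=> u0; split=> [/cvgrPdist_lt H e e0|H].
  have [N _ HN] := H e e0; exists N => n Nn.
  by have := HN n Nn; rewrite sub0r normrN ger0_norm.
apply/cvgrPdist_lt => e e0; have [N HN] := H e e0.
by exists N => // n /= Nn; rewrite sub0r normrN ger0_norm //; exact: HN.
Qed.

Lemma squeeze0 (u v : nat -> R) : (forall n, 0 <= u n) -> (forall n, u n <= v n) ->
  v @ \oo --> (0 : R) -> u @ \oo --> (0 : R).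
Proof.
move=> u0 uv v0; apply: (@squeeze_cvgr _ _ _ _ (fun=> 0) v) => //; last exact: cvg_cst.
by apply: nearW => n; rewrite u0 uv.
Qed.

Lemma cvg0Z (v : nat -> R) k : v @ \oo --> (0 : R) -> (fun n => k * v n) @ \oo --> (0 : R).
Proof. by move=> v0; rewrite -(mulr0 k); apply: cvgM => //; exact: cvg_cst. Qed.

Lemma cvg0D (u v : nat -> R) : u @ \oo --> (0 : R) -> v @ \oo --> (0 : R) ->
  (fun n => u n + v n) @ \oo --> (0 : R).
Proof. by move=> u0 v0; rewrite -(addr0 0); exact: cvgD. Qed.

Lemma clim_cst l : clim (fun=> l) l.
Proof. rewrite /clim subrr cn0; exact: cvg_cst. Qed.

Lemma climD c1 c2 l1 l2 : clim c1 l1 -> clim c2 l2 ->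
  clim (fun n => c1 n + c2 n) (l1 + l2).
Proof.
move=> h1 h2; apply: (squeeze0 (v := fun n => 2 * cn (c1 n - l1) + 2 * cn (c2 n - l2))).
- by move=> n; exact: cn_ge0.
- by move=> n; rewrite opprD addrACA; exact: cnD_le.
- by apply: cvg0D; exact: cvg0Z.
Qed.

Lemma clim_eq c1 c2 l : c1 =1 c2 -> clim c1 l -> clim c2 l.
Proof. by move=> /funext ->. Qed.

Lemma climZ a c l : clim c l -> clim (fun n => a * c n) (a * l).
Proof.
move=> h; apply: (squeeze0 (v := fun n => cn a * cn (c n - l))).
- by move=> n; exact: cn_ge0.
- by move=> n; rewrite -mulrBr cnM.
- exact: cvg0Z.
Qed.

Lemma clim_unique c l1 l2 : clim c l1 -> clim c l2 -> l1 = l2.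
Proof.
move=> h1 h2; apply/eqP; rewrite -subr_eq0; apply/eqP/cn_eq0.
have h : (fun=> cn (l1 - l2)) @ \oo --> (0 : R).
  apply: (squeeze0 (v := fun n => 2 * cn (c n - l1) + 2 * cn (c n - l2))).
  - by move=> n; exact: cn_ge0.
  - move=> n; have -> : l1 - l2 = - (c n - l1) + (c n - l2) by ring.
    by apply: (le_trans (cnD_le _ _)); rewrite cnN.
  - by apply: cvg0D; exact: cvg0Z.
by apply: (cvg_unique _ _ h) => //; exact: cvg_cst.
Qed.

Lemma clim_shift c l : clim c l -> clim (fun n => c n.+1) l.
Proof.
move=> /nonneg_cvg0P h; apply/nonneg_cvg0P => [n|e e0]; first exact: cn_ge0.
have [N HN] := h (fun n => cn_ge0 _) e e0; exists N => n Nn; apply: HN; exact: leqW.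
Qed.

Lemma clim_Re c l : clim c l -> (fun n => complex.Re (c n)) @ \oo --> complex.Re l.
Proof.
move=> h; apply/cvgrPdist_lt => e e0.
have e20 : 0 < e ^+ 2 by rewrite exprn_gt0.
have /nonneg_cvg0P := h => /(_ (fun n => cn_ge0 _)) /(_ _ e20) [N HN].
exists N => // n /= Nn; have HNn := HN n Nn.
rewrite distrC -(ltr_pXn2r (n := 2)) ?nnegrE // ?ltW //.
apply: le_lt_trans HNn; rewrite real_normK ?num_real // /cn.
by rewrite !(raddfB (@complex.Re R : Rcomplex R -> R)) /= lerDl sqr_ge0.
Qed.

Lemma clim_Im c l : clim c l -> (fun n => complex.Im (c n)) @ \oo --> complex.Im l.
Proof.
move=> h; apply/cvgrPdist_lt => e e0.
have e20 : 0 < e ^+ 2 by rewrite exprn_gt0.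
have /nonneg_cvg0P := h => /(_ (fun n => cn_ge0 _)) /(_ _ e20) [N HN].
exists N => // n /= Nn; have HNn := HN n Nn.
rewrite distrC -(ltr_pXn2r (n := 2)) ?nnegrE // ?ltW //.
apply: le_lt_trans HNn; rewrite real_normK ?num_real // /cn.
by rewrite !(raddfB (@complex.Im R : Rcomplex R -> R)) /= lerDr sqr_ge0.
Qed.

Lemma cvg_clim (c : nat -> R[i]) l : clim c l -> (c : nat -> (R[i])^o) @ \oo --> (l : (R[i])^o).
Proof.
move=> h; apply/cvgrPdist_lt => e e0.
have eE : e = (complex.Re e)%:C%C by rewrite RRe_real // gtr0_real.
have re0 : 0 < complex.Re e by move: e0; rewrite eE ltcR.
have e20 : 0 < complex.Re e ^+ 2 by rewrite exprn_gt0.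
have /nonneg_cvg0P := h => /(_ (fun n => cn_ge0 _)) /(_ _ e20) [N HN].
exists N => // n /= Nn; have HNn := HN n Nn.
rewrite distrC eE; change (`|c n - l : R[i]| < (complex.Re e)%:C%C).
rewrite -(ltr_pXn2r (n := 2)) ?nnegrE // ?ler0c ?ltW //.
by rewrite normr_cn -rmorphXn /= ltcR.
Qed.

Lemma clim_series (u : nat -> R[i]) l : clim (fun N => \sum_(k < N) u k) l ->
  cvgn (series (u : nat -> (R[i])^o)) /\ limn (series (u : nat -> (R[i])^o)) = l :> R[i].
Proof.
move=> h; have h' : series (u : nat -> (R[i])^o) @ \oo --> (l : (R[i])^o).
  by rewrite /series /=; under eq_fun do rewrite big_mkord; exact: cvg_clim h.
by split; [apply/cvg_ex; exists l|exact: (cvg_lim (@norm_hausdorff _ _) h')].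
Qed.

End modulus.

(** * Hilbert spaces *)

Section hilbert_form.
Context (R : realType) (V : lmodType R[i]).
Implicit Types (ip : V -> V -> R[i]).

Definition sqnorm ip (v : V) : R := complex.Re (ip v v).

Definition hconv ip (u : nat -> V) (l : V) :=
  (fun n => sqnorm ip (u n - l)) @ \oo --> (0 : R).

Lemma hconvE ip u l :
  hconv ip u l = ((fun n => sqnorm ip (u n - l)) @ \oo --> (0 : R)).
Proof. by []. Qed.

(* The form is only semidefinite: elements of L^2 are functions, and a closed
   subspace is automatically stable under null perturbations (csub_congr). *)
Record hilbert_form ip : Prop := HilbertForm {
  hf_addl : forall u v w, ip (u + v) w = ip u w + ip v w;
  hf_scalel : forall a u w, ip (a *: u) w = a * ip u w;
  hf_conj : forall u v, ip v u = (ip u v)^*;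
  hf_ge0 : forall u, 0 <= ip u u;
  hf_complete : forall u : nat -> V,
    (forall e : R, 0 < e -> exists N, forall m n, (N <= m)%N -> (N <= n)%N ->
      sqnorm ip (u m - u n) < e) ->
    exists l, hconv ip u l }.

Record closed_subspace ip (S : set V) : Prop := ClosedSubspace {
  csub0 : S 0;
  csubD : forall u v, S u -> S v -> S (u + v);
  csubZ : forall a u, S u -> S (a *: u);
  csub_closed : forall v,
    (forall e : R, 0 < e -> exists2 y, S y & sqnorm ip (v - y) < e) -> S v }.

Variables (ip : V -> V -> R[i]) (ipP : hilbert_form ip).
Local Notation nsq := (sqnorm ip).
Local Notation hlim := (hconv ip).
Local Notation csub := (closed_subspace ip).

Lemma ipDl u v w : ip (u + v) w = ip u w + ip v w. Proof. exact: hf_addl. Qed.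
Lemma ipZl a u w : ip (a *: u) w = a * ip u w. Proof. exact: hf_scalel. Qed.
Lemma ipC u v : ip v u = (ip u v)^*. Proof. exact: hf_conj. Qed.
Lemma ipDr u v w : ip w (u + v) = ip w u + ip w v.
Proof. by rewrite ipC ipDl rmorphD /= -!ipC. Qed.
Lemma ipZr a u w : ip w (a *: u) = a^* * ip w u.
Proof. by rewrite ipC ipZl rmorphM /= -ipC. Qed.
Lemma ip0l w : ip 0 w = 0. Proof. by rewrite -(scale0r (0 : V)) ipZl mul0r. Qed.
Lemma ip0r w : ip w 0 = 0. Proof. by rewrite ipC ip0l rmorph0. Qed.
Lemma ipNl u w : ip (- u) w = - ip u w.
Proof. by rewrite -scaleN1r ipZl mulN1r. Qed.
Lemma ipNr u w : ip w (- u) = - ip w u.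
Proof. by rewrite ipC ipNl rmorphN /= -ipC. Qed.
Lemma ipBl u v w : ip (u - v) w = ip u w - ip v w. Proof. by rewrite ipDl ipNl. Qed.
Lemma ipBr u v w : ip w (u - v) = ip w u - ip w v. Proof. by rewrite ipDr ipNr. Qed.
Lemma ip_suml (I : Type) (r : seq I) (Q : pred I) (F : I -> V) w :
  ip (\sum_(i <- r | Q i) F i) w = \sum_(i <- r | Q i) ip (F i) w.
Proof. exact: (big_morph (ip^~ w) (fun u v => ipDl u v w) (ip0l w)). Qed.
Lemma ip_sumr (I : Type) (r : seq I) (Q : pred I) (F : I -> V) w :
  ip w (\sum_(i <- r | Q i) F i) = \sum_(i <- r | Q i) ip w (F i).
Proof. exact: (big_morph (ip w) (fun u v => ipDr u v w) (ip0r w)). Qed.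

Lemma ip_nsq u : ip u u = (nsq u)%:C%C.
Proof. by rewrite RRe_real // ger0_real // hf_ge0. Qed.

Lemma nsq_ge0 u : 0 <= nsq u.
Proof. by have := hf_ge0 ipP u; rewrite ip_nsq ler0c. Qed.

Lemma nsq0 : nsq 0 = 0. Proof. by rewrite /sqnorm ip0l. Qed.

Lemma nsqZ a u : nsq (a *: u) = cn a * nsq u.
Proof.
apply: (@complexI R); rewrite -ip_nsq ipZl ipZr ip_nsq mulrA cnE.
by rewrite -rmorphM.
Qed.

Lemma nsqN u : nsq (- u) = nsq u.
Proof. by rewrite /sqnorm ipNl ipNr opprK. Qed.

Lemma nsqBC u v : nsq (u - v) = nsq (v - u).
Proof. by rewrite -nsqN opprB. Qed.

Lemma Re_ipC u v : complex.Re (ip v u) = complex.Re (ip u v).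
Proof. by rewrite ipC; case: (ip u v). Qed.

Lemma nsqD u v : nsq (u + v) = nsq u + nsq v + 2 * complex.Re (ip u v).
Proof.
rewrite /sqnorm ipDl !ipDr.
rewrite !(raddfD (@complex.Re R : Rcomplex R -> R)) /= (Re_ipC u v); ring.
Qed.

Lemma nsqB u v : nsq (u - v) = nsq u + nsq v - 2 * complex.Re (ip u v).
Proof.
rewrite nsqD nsqN ipNr (raddfN (@complex.Re R : Rcomplex R -> R)) /=; ring.
Qed.

Lemma parallelogram u v : nsq (u + v) + nsq (u - v) = 2 * nsq u + 2 * nsq v.
Proof. rewrite nsqD nsqB; ring. Qed.

Lemma nsqD_le u v : nsq (u + v) <= 2 * nsq u + 2 * nsq v.
Proof. by rewrite -parallelogram lerDl nsq_ge0. Qed.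

Lemma nsqB_le u v w : nsq (u - w) <= 2 * nsq (u - v) + 2 * nsq (v - w).
Proof. by have := nsqD_le (u - v) (v - w); rewrite addrA subrK. Qed.

(** As the form is only semidefinite, [nsq v = 0] does not force v to be 0. Both cases come from the
    nonnegativity of [|u - t <u,v> v|^2] for real t: t is the inverse of [nsq v] when that is
    positive, and a large number otherwise. *)
Lemma cauchy_schwarz u v : cn (ip u v) <= nsq u * nsq v.
Proof.
have key (t : R) : 0 <= nsq u - 2 * t * cn (ip u v) + t ^+ 2 * cn (ip u v) * nsq v.
  have := nsq_ge0 (u - (t%:C%C * ip u v) *: v).
  rewrite nsqB nsqZ cnM cn_real ipZr rmorphM /=.
  rewrite -(mulrA _ (ip u v)^*) (mulrC (ip u v)^*) cnE.
  rewrite conj_real -!rmorphM /=.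
  set a := nsq u; set b := nsq v; set c := cn _.
  by congr (0 <= _); ring.
have := nsq_ge0 v; rewrite le_eqVlt => /orP[/eqP v0|v0]; last first.
  have := key (nsq v)^-1; rewrite -(ler_pM2r v0) mul0r.
  have vn0 : nsq v != 0 by rewrite gt_eqF.
  set a := nsq u in key *; set b := nsq v in v0 vn0 key *; set c := cn _ => h.
  have : (a - 2 * b^-1 * c + b^-1 ^+ 2 * c * b) * b = a * b - c by field.
  by move: h => /[swap] -> ; rewrite subr_ge0.
rewrite -v0 mulr0 leNgt; apply/negP => c0.
have cn0 : cn (ip u v) != 0 by rewrite gt_eqF.
(* For [nsq v = 0] the expression is affine in t; this t gives it the value [- nsq u - 2], which is
   negative. *)
have := key ((nsq u + 1) / cn (ip u v)); rewrite -v0 mulr0 addr0.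
set a := nsq u; set c := cn _ in c0 cn0 *.
have -> : a - 2 * ((a + 1) / c) * c = - a - 2 by field.
by have := nsq_ge0 u; rewrite -/a; lra.
Qed.

Lemma hlim_cst u : hlim (fun=> u) u.
Proof. by rewrite hconvE subrr nsq0; exact: cvg_cst. Qed.

Lemma hlimP (u : nat -> V) l : hlim u l <->
  (forall e, 0 < e -> exists N, forall n, (N <= n)%N -> nsq (u n - l) < e).
Proof. by apply: nonneg_cvg0P => n; exact: nsq_ge0. Qed.

Lemma hlimD u v l m : hlim u l -> hlim v m -> hlim (fun n => u n + v n) (l + m).
Proof.
move=> h1 h2; apply: (squeeze0 (v := fun n => 2 * nsq (u n - l) + 2 * nsq (v n - m))).
- by move=> n; exact: nsq_ge0.
- by move=> n; rewrite opprD addrACA; exact: nsqD_le.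
- by apply: cvg0D; exact: cvg0Z.
Qed.

Lemma hlimZ a u l : hlim u l -> hlim (fun n => a *: u n) (a *: l).
Proof.
move=> h; apply: (squeeze0 (v := fun n => cn a * nsq (u n - l))).
- by move=> n; exact: nsq_ge0.
- by move=> n; rewrite -scalerBr nsqZ.
- exact: cvg0Z.
Qed.

Lemma hlim_ipl u l v : hlim u l -> clim (fun n => ip (u n) v) (ip l v).
Proof.
move=> h; apply: (squeeze0 (v := fun n => nsq v * nsq (u n - l))).
- by move=> n; exact: cn_ge0.
- by move=> n; rewrite -ipBl mulrC; exact: cauchy_schwarz.
- exact: cvg0Z.
Qed.

Lemma hlim_ip u v l m : hlim u l -> hlim v m ->
  clim (fun n => ip (u n) (v n)) (ip l m).
Proof.
move=> hu hv.
apply: (squeeze0 (v := fun n => 2 * (nsq (u n - l) * (2 * nsq (v n - m) + 2 * nsq m))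
    + 2 * (nsq l * nsq (v n - m)))).
- by move=> n; exact: cn_ge0.
- move=> n; have -> : ip (u n) (v n) - ip l m = ip (u n - l) (v n) + ip l (v n - m).
    by rewrite ipBl ipBr; ring.
  apply: (le_trans (cnD_le _ _)); apply: lerD; rewrite ler_pM2l //.
    apply: (le_trans (cauchy_schwarz _ _)); apply: ler_wpM2l; first exact: nsq_ge0.
    by rewrite -{1}(subrK m (v n)); exact: nsqD_le.
  exact: cauchy_schwarz.
- apply: cvg0D; last by apply: cvg0Z; exact: cvg0Z.
  apply: cvg0Z; rewrite -(mul0r (2 * 0 + 2 * nsq m)); apply: cvgM => //.
  by apply: cvgD; [apply: cvgM => //; exact: cvg_cst|exact: cvg_cst].
Qed.

Lemma hlim_unique u l m : hlim u l -> hlim u m -> nsq (l - m) = 0.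
Proof.
move=> h1 h2.
have h : (fun=> nsq (l - m)) @ \oo --> (0 : R).
  apply: (squeeze0 (v := fun n => 2 * nsq (u n - l) + 2 * nsq (u n - m))).
  - by move=> n; exact: nsq_ge0.
  - by move=> n; rewrite (nsqBC (u n) l); exact: nsqB_le.
  - by apply: cvg0D; exact: cvg0Z.
by apply: (cvg_unique _ _ h) => //; exact: cvg_cst.
Qed.

Lemma hlim_cauchy u l : hlim u l -> forall e : R, 0 < e ->
  exists N, forall m n, (N <= m)%N -> (N <= n)%N -> nsq (u m - u n) < e.
Proof.
move=> /hlimP h e e0; have e40 : 0 < e / 4 by lra.
have [N HN] := h _ e40; exists N => m n Nm Nn.
apply: (le_lt_trans (nsqB_le _ l _)).
have := HN m Nm; have := HN n Nn; rewrite (nsqBC (u n)); lra.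
Qed.

Lemma csub_lim S (u : nat -> V) l : csub S ->
  (forall n, S (u n)) -> hlim u l -> S l.
Proof.
move=> cS Su /hlimP h; apply: (csub_closed cS) => e e0.
have [N HN] := h e e0; exists (u N) => //; rewrite nsqBC; exact: HN.
Qed.

Lemma csub_sum S (I : Type) (r : seq I) (Q : pred I) (F : I -> V) :
  csub S -> (forall i, Q i -> S (F i)) -> S (\sum_(i <- r | Q i) F i).
Proof. by move=> cS; apply: big_ind; [exact: csub0 cS|exact: csubD cS]. Qed.

Lemma csubN S u : csub S -> S u -> S (- u).
Proof. by move=> cS Su; rewrite -scaleN1r; exact: (csubZ cS). Qed.

Lemma csubB S u v : csub S -> S u -> S v -> S (u - v).
Proof. by move=> cS Su Sv; apply: (csubD cS) => //; exact: csubN. Qed.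

Lemma csub_congr S u v : csub S -> nsq (u - v) = 0 -> S u -> S v.
Proof.
move=> cS uv Su; apply: (csub_closed cS) => e e0; exists u => //.
by rewrite nsqBC uv.
Qed.

Lemma csubI S S' : csub S -> csub S' -> csub (S `&` S').
Proof.
move=> cS cS'; split.
- by split; [exact: csub0 cS|exact: csub0 cS'].
- by move=> u v [? ?] [? ?]; split; [exact: (csubD cS)|exact: (csubD cS')].
- by move=> a u [? ?]; split; [exact: (csubZ cS)|exact: (csubZ cS')].
- by move=> v h; split; [apply: (csub_closed cS)|apply: (csub_closed cS')] => e /h [y [? ?] ?];
    exists y.
Qed.

Lemma csub_orthl (G : set V) : csub [set v | forall g, G g -> ip v g = 0].
Proof.
split=> /=.
- by move=> g _; exact: ip0l.
- by move=> u v hu hv g Gg; rewrite ipDl hu // hv // addr0.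
- by move=> a u hu g Gg; rewrite ipZl hu // mulr0.
move=> v h g Gg; apply: cn_eq0; apply/le_anti; rewrite cn_ge0 andbT.
apply/ler_addgt0Pl => e e0; rewrite addr0.
(* The added 1 avoids a division by [nsq g], which may vanish. *)
have g1 : 0 < nsq g + 1 by rewrite ltr_wpDl // nsq_ge0.
have [y hy] := h (e / (nsq g + 1)) (divr_gt0 e0 g1).
rewrite ltr_pdivlMr // => hlt.
have -> : ip v g = ip (v - y) g by rewrite ipBl hy // subr0.
apply: (le_trans (cauchy_schwarz _ _)); apply: le_trans (ltW hlt).
by apply: ler_wpM2l; rewrite ?nsq_ge0 // lerDl.
Qed.

Lemma ip_eq0C u v : ip u v = 0 -> ip v u = 0.
Proof. by move=> h; rewrite ipC h rmorph0. Qed.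

(** A minimizing sequence for the distance from v to S is Cauchy by the parallelogram law, since
    midpoints stay in S; minimality under the perturbations [l + a t] then gives orthogonality. *)
Lemma projection_theorem S v : csub S ->
  exists2 p, S p & forall s, S s -> ip (v - p) s = 0.
Proof.
move=> cS; set D := [set nsq (v - s) | s in S].
have D0 : D !=set0 by exists (nsq (v - 0)); exists 0 => //; exact: csub0 cS.
have Dlb : lbound D 0 by move=> _ [s _ <-]; exact: nsq_ge0.
have hD : has_inf D by split => //; exists 0.
set dd := inf D.
have dle s : S s -> dd <= nsq (v - s) by move=> Ss; apply: ge_inf; [exists 0|exists s].
have /choice [s hs] (n : nat) : exists s, S s /\ nsq (v - s) < dd + n.+1%:R^-1.
  have n0 : 0 < n.+1%:R^-1 :> R by rewrite invr_gt0.
  by have [_ [s Ss <-] h] := inf_adherent n0 hD; exists s.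
have [l hl] : exists l, hlim s l.
  apply: (hf_complete ipP) => e e0.
  have [N _ hN] := near_infty_natSinv_lt (PosNum (divr_gt0 e0 (ltr0n R 4))).
  exists N => m n Nm Nn.
  have hm : m.+1%:R^-1 < e / 4 by exact: (hN m).
  have hn : n.+1%:R^-1 < e / 4 by exact: (hN n).
  have [Sm vm] := hs m; have [Sn vn] := hs n.
  have Smn : S (2^-1 *: (s m + s n)) by apply: (csubZ cS); exact: (csubD cS).
  have := dle _ Smn; have := parallelogram (v - s m) (v - s n).
  have -> : v - s m + (v - s n) = (2 : R[i]) *: (v - 2^-1 *: (s m + s n)).
    rewrite scalerBr scalerA divff ?pnatr_eq0 // scale1r.
    by rewrite scaler_nat mulr2n opprD addrACA.
  have -> : v - s m - (v - s n) = s n - s m.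
    by rewrite opprB addrC addrA subrK.
  rewrite nsqZ (_ : cn 2 = 4) ?(nsqBC (s n)); last first.
    by rewrite -(rmorph_nat (real_complex R)) cn_real; ring.
  move: hm hn vm vn; move: (m.+1%:R^-1) (n.+1%:R^-1) => a b hm hn vm vn h1 h2.
  by lra.
have Sl : S l by apply: (csub_lim cS _ hl) => n; case: (hs n).
exists l => // t St.
have hld : nsq (v - l) <= dd.
  have hv : hlim (fun n => v - s n) (v - l).
    apply: hlimD; first exact: hlim_cst.
    by have := hlimZ (-1) hl; rewrite hconvE; under eq_fun do rewrite !scaleN1r.
  have h1 := hlim_ip hv hv.
  have h2 : (fun n => nsq (v - s n)) @ \oo --> nsq (v - l).
    exact: clim_Re h1.
  have h3 : (fun n => dd + n.+1%:R^-1) @ \oo --> dd + 0.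
    by apply: cvgD; [exact: cvg_cst|exact: cvg_harmonic].
  rewrite addr0 in h3.
  apply: (ler_cvg_to h2 h3); apply: nearW => n; by case: (hs n) => _ /ltW.
have key (a : R[i]) : 2 * complex.Re (a^* * ip (v - l) t) <= cn a * nsq t.
  have := dle _ (csubD cS Sl (csubZ cS a St)).
  rewrite opprD addrA nsqB nsqZ ipZr => h; have := le_trans hld h.
  by set c := complex.Re _; lra.
set c := ip (v - l) t.
apply: cn_eq0; apply/le_anti; rewrite cn_ge0 andbT leNgt; apply/negP => c0.
have t1 : 0 < nsq t + 1 by rewrite ltr_wpDl // nsq_ge0.
(* With a = c / k and k = [nsq t + 1], [key] reads 2 k |c|^2 <= (k - 1) |c|^2 after clearing
   denominators, which is impossible for nonzero c. *)
have := key ((nsq t + 1)^-1%:C%C * c); rewrite cnM cn_real rmorphM /= -mulrA.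
rewrite (mulrC c^*) -/c cnE.
rewrite conj_real -rmorphM /=; set k := nsq t + 1 in t1 *.
have -> : nsq t = k - 1 by rewrite /k; ring.
rewrite -(ler_pM2r (exprn_gt0 2 t1)).
have kn0 : k != 0 by rewrite gt_eqF.
have -> : 2 * (k^-1 * cn c) * k ^+ 2 = 2 * cn c * k by field.
have -> : k^-1 ^+ 2 * cn c * (k - 1) * k ^+ 2 = cn c * (k - 1) by field.
by nra.
Qed.

End hilbert_form.

Lemma eq_hlim (R : realType) (V : lmodType R[i]) (ip : V -> V -> R[i])
  (u v : nat -> V) l : u =1 v -> hconv ip u l -> hconv ip v l.
Proof. by move=> /funext ->. Qed.

(** * Closed linear spans, and the unitary map between families with equal Gram matrices *)

Section closed_linear_span.
Context (R : realType) (I : choiceType).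

(** Combinations are lists of coefficients and indices rather than vectors, so that one list can be
    evaluated in two different families; this is what [iso_rel] needs. *)
Definition comb (V : lmodType R[i]) (x : I -> V) (s : seq (R[i] * I)) : V :=
  \sum_(p <- s) p.1 *: x p.2.

Definition indices_in (K : set I) (s : seq (R[i] * I)) : Prop :=
  forall p, p \in s -> K p.2.

Definition clsp (V : lmodType R[i]) ip (x : I -> V) (K : set I) : set V :=
  [set v | forall e : R, 0 < e ->
    exists2 s, indices_in K s & sqnorm ip (v - comb x s) < e].

Lemma indices_in_cat K s t : indices_in K s -> indices_in K t -> indices_in K (s ++ t).
Proof. by move=> hs ht p; rewrite mem_cat => /orP[/hs|/ht]. Qed.

Definition scale_comb (a : R[i]) (s : seq (R[i] * I)) :=
  [seq (a * p.1, p.2) | p <- s].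

Lemma indices_in_scale K a s : indices_in K s -> indices_in K (scale_comb a s).
Proof. by move=> hs p /mapP[q /hs Kq ->]. Qed.

Lemma indices_in1 (K : set I) a : K a -> indices_in K [:: (1, a)].
Proof. by move=> Ka p; rewrite inE => /eqP ->. Qed.

Section one_family.
Variables (V : lmodType R[i]) (ip : V -> V -> R[i]) (ipP : hilbert_form ip).
Variable (x : I -> V).
Local Notation nsq := (sqnorm ip).
Local Notation hlim := (hconv ip).
Local Notation csub := (closed_subspace ip).
Local Notation clsp := (clsp ip).

Lemma comb_nil : comb x [::] = 0. Proof. exact: big_nil. Qed.
Lemma comb_cat s t : comb x (s ++ t) = comb x s + comb x t.
Proof. exact: big_cat. Qed.
Lemma comb_scale a s : comb x (scale_comb a s) = a *: comb x s.
Proof.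
by rewrite /comb big_map scaler_sumr; apply: eq_bigr => p _; rewrite scalerA.
Qed.
Lemma comb1 a : comb x [:: (1, a)] = x a.
Proof. by rewrite /comb big_seq1 scale1r. Qed.

Lemma clsp_csub K : csub (clsp x K).
Proof.
split.
- by move=> e e0; exists [::] => //; rewrite comb_nil subrr (nsq0 ipP).
- move=> u v hu hv e e0; have e4 : 0 < e / 4 by lra.
  have [s Ks hs] := hu _ e4; have [t Kt ht] := hv _ e4.
  exists (s ++ t); first exact: indices_in_cat.
  rewrite comb_cat opprD addrACA; apply: (le_lt_trans (nsqD_le ipP _ _)); lra.
- move=> a u hu e e0; have c1 : 0 < cn a + 1 by rewrite ltr_wpDl // cn_ge0.
  have [s Ks hs] := hu _ (divr_gt0 e0 c1).
  exists (scale_comb a s); first exact: indices_in_scale.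
  rewrite comb_scale -scalerBr (nsqZ ipP).
  move: hs; rewrite ltr_pdivlMr // mulrC; apply: le_lt_trans.
  by apply: ler_wpM2r; rewrite ?(nsq_ge0 ipP) // lerDl.
- move=> v hv e e0; have e4 : 0 < e / 4 by lra.
  have [y hy vy] := hv _ e4; have [s Ks hs] := hy _ e4; exists s => //.
  apply: (le_lt_trans (nsqB_le ipP _ y _)); lra.
Qed.

Lemma clsp_comb (K : set I) s : indices_in K s -> clsp x K (comb x s).
Proof. by move=> Ks e e0; exists s => //; rewrite subrr (nsq0 ipP). Qed.

Lemma clsp_gen (K : set I) a : K a -> clsp x K (x a).
Proof. by move=> Ka; rewrite -comb1; apply: clsp_comb; exact: indices_in1. Qed.

Lemma csub_comb S (K : set I) s : csub S -> (forall a, K a -> S (x a)) ->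
  indices_in K s -> S (comb x s).
Proof.
move=> cS KS Ks; rewrite /comb big_seq; apply: (csub_sum _ cS) => p ps.
by apply: (csubZ cS); apply: KS; exact: Ks.
Qed.

Lemma clsp_min S K : csub S -> (forall a, K a -> S (x a)) -> clsp x K `<=` S.
Proof.
move=> cS KS v hv; apply: (csub_closed cS) => e /hv [s Ks hs]; exists (comb x s) => //.
exact: csub_comb Ks.
Qed.

Lemma clspS K K' : K `<=` K' -> clsp x K `<=` clsp x K'.
Proof. by move=> KK; apply: (clsp_min (clsp_csub _)) => a /KK; exact: clsp_gen. Qed.

Lemma clsp_orthl K v u : (forall a, K a -> ip (x a) u = 0) -> clsp x K v -> ip v u = 0.
Proof.
move=> h /(clsp_min (csub_orthl ipP [set u])) hv.
by apply: hv => // a Ka g ->; exact: h.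
Qed.

Lemma clsp_orthr K v u : (forall a, K a -> ip u (x a) = 0) -> clsp x K v -> ip u v = 0.
Proof.
by move=> h hv; apply: (ip_eq0C ipP); apply: clsp_orthl hv => a Ka; apply: (ip_eq0C ipP); exact: h.
Qed.

Lemma clsp_seq K v : clsp x K v ->
  exists2 s : nat -> seq (R[i] * I), (forall n, indices_in K (s n)) &
    hlim (fun n => comb x (s n)) v.
Proof.
move=> hv; have n0 (n : nat) : 0 < n.+1%:R^-1 :> R by rewrite invr_gt0.
have /choice[s hs] (n : nat) : exists s, indices_in K s /\ nsq (v - comb x s) < n.+1%:R^-1.
  by have [s ? ?] := hv _ (n0 n); exists s.
exists s => [n|]; first by case: (hs n).
apply: (squeeze0 (v := fun n => n.+1%:R^-1)) => [n|n|]; first exact: (nsq_ge0 ipP).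
  by rewrite (nsqBC ipP); case: (hs n) => _ /ltW.
exact: cvg_harmonic.
Qed.

(** The vectors that L sends into a closed subspace form a closed subspace, L being linear and
    isometric; hence it is enough to test the generators. *)
Lemma clsp_isometry (L : V -> V) (K K' : set I) :
  (forall u v, L (u + v) = L u + L v) -> (forall a u, L (a *: u) = a *: L u) ->
  (forall u, nsq (L u) = nsq u) ->
  (forall a, K a -> clsp x K' (L (x a))) ->
  forall v, clsp x K v -> clsp x K' (L v).
Proof.
move=> LD LZ Ln Lx; have cS := clsp_csub K'.
have L0 : L 0 = 0 by rewrite -(scale0r (0 : V)) LZ !scale0r.
have LN u : L (- u) = - L u by rewrite -(scaleN1r u) LZ scaleN1r.
suff : csub [set v | clsp x K' (L v)] by move=> h; exact: (clsp_min h).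
split => /=.
- by rewrite L0; exact: csub0 cS.
- by move=> u v hu hv; rewrite LD; exact: (csubD cS).
- by move=> a u hu; rewrite LZ; exact: (csubZ cS).
- move=> v hv; apply: (csub_closed cS) => e /hv [y hy vy]; exists (L y) => //.
  by rewrite -LN -LD Ln.
Qed.

End one_family.

Section transport.
Variables (V V' : lmodType R[i]) (ip : V -> V -> R[i]) (ip' : V' -> V' -> R[i]).
Variables (ipP : hilbert_form ip) (ipP' : hilbert_form ip').
Variables (x : I -> V) (y : I -> V').
Hypothesis xy : forall a b, ip (x a) (x b) = ip' (y a) (y b).

(* graph of the unitary map between the closed spans sending x a to y a *)
Definition iso_rel (v : V) (v' : V') : Prop :=
  exists2 s : nat -> seq (R[i] * I),
    hconv ip (fun n => comb x (s n)) v & hconv ip' (fun n => comb y (s n)) v'.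

Lemma ip_comb s t : ip (comb x s) (comb x t) = ip' (comb y s) (comb y t).
Proof.
rewrite /comb (ip_suml ipP) (ip_suml ipP'); apply: eq_bigr => p _.
rewrite (ip_sumr ipP) (ip_sumr ipP'); apply: eq_bigr => r _.
by rewrite !(ipZl ipP, ipZr ipP, ipZl ipP', ipZr ipP') xy.
Qed.

Lemma comb_sub (W : lmodType R[i]) (z : I -> W) s t :
  comb z s - comb z t = comb z (s ++ scale_comb (-1) t).
Proof. by rewrite comb_cat comb_scale scaleN1r. Qed.

Lemma iso_rel_ip v v' u u' : iso_rel v v' -> iso_rel u u' -> ip v u = ip' v' u'.
Proof.
move=> [s h1 h2] [t k1 k2].
apply: (clim_unique (hlim_ip ipP h1 k1)); apply: clim_eq (hlim_ip ipP' h2 k2) => n.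
by rewrite ip_comb.
Qed.

Lemma iso_rel_nsq v v' : iso_rel v v' -> sqnorm ip v = sqnorm ip' v'.
Proof. by move=> h; rewrite /sqnorm (iso_rel_ip h h). Qed.

Lemma iso_relD v v' u u' : iso_rel v v' -> iso_rel u u' -> iso_rel (v + u) (v' + u').
Proof.
move=> [s h1 h2] [t k1 k2]; exists (fun n => s n ++ t n).
  by apply: eq_hlim (hlimD ipP h1 k1) => n; rewrite comb_cat.
by apply: eq_hlim (hlimD ipP' h2 k2) => n; rewrite comb_cat.
Qed.

Lemma iso_relZ a v v' : iso_rel v v' -> iso_rel (a *: v) (a *: v').
Proof.
move=> [s h1 h2]; exists (fun n => scale_comb a (s n)).
  by apply: eq_hlim (hlimZ ipP a h1) => n; rewrite comb_scale.
by apply: eq_hlim (hlimZ ipP' a h2) => n; rewrite comb_scale.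
Qed.

Lemma iso_relB v v' u u' : iso_rel v v' -> iso_rel u u' -> iso_rel (v - u) (v' - u').
Proof.
by move=> h k; rewrite -(scaleN1r u) -(scaleN1r u'); apply: iso_relD => //; exact: iso_relZ.
Qed.

Lemma iso_rel_comb s : iso_rel (comb x s) (comb y s).
Proof. by exists (fun=> s); [exact: (hlim_cst ipP)|exact: (hlim_cst ipP')]. Qed.

Lemma iso_rel_gen a : iso_rel (x a) (y a).
Proof. by rewrite -(comb1 x) -(comb1 y); exact: iso_rel_comb. Qed.

Lemma iso_rel_sum (J : finType) (F : J -> V) (F' : J -> V') :
  (forall j, iso_rel (F j) (F' j)) -> iso_rel (\sum_j F j) (\sum_j F' j).
Proof.
move=> h; elim/big_rec2 : _ => [|j v v' _ hv]; last exact: iso_relD.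
by rewrite -(comb_nil x) -(comb_nil y); exact: iso_rel_comb.
Qed.

(** An approximating sequence of combinations remains Cauchy when it is evaluated in the other
    family, and completeness supplies the limit. The image is determined only up to null vectors,
    hence a relation and not a function. *)
Lemma iso_rel_exists K v : clsp ip x K v -> exists2 v', clsp ip' y K v' & iso_rel v v'.
Proof.
move=> /(clsp_seq ipP) [s Ks hs].
have [v' hv'] : exists v', hconv ip' (fun n => comb y (s n)) v'.
  apply: (hf_complete ipP') => e e0; have [N HN] := hlim_cauchy ipP hs e0.
  exists N => m n Nm Nn; rewrite comb_sub /sqnorm -ip_comb -comb_sub; exact: HN.
exists v'; last by exists s.
apply: (csub_lim ipP' (clsp_csub ipP' y K) _ hv') => n.
exact: (clsp_comb ipP').
Qed.

End transport.

Lemma iso_rel_sym (V V' : lmodType R[i]) ip ip' (x : I -> V) (y : I -> V') v v' :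
  iso_rel ip ip' x y v v' -> iso_rel ip' ip y x v' v.
Proof. by case=> s h k; exists s. Qed.

End closed_linear_span.

(** * Expansions in orthonormal families *)

Section orthonormal_expansion.
Context (R : realType) (J : finType).
Variables (V : lmodType R[i]) (ip : V -> V -> R[i]) (ipP : hilbert_form ip).
Variable (xi : nat -> J -> V).
Hypothesis xi_on : forall l a m b, ip (xi l a) (xi m b) = ((l == m) && (a == b))%:R.
Local Notation nsq := (sqnorm ip).
Local Notation hlim := (hconv ip).

Definition uncurried (p : nat * J) := xi p.1 p.2.

Definition partial_exp (u : V) N := \sum_(l < N) \sum_a ip u (xi l a) *: xi l a.

Lemma ip_partial_exp u N m b : (m < N)%N -> ip (partial_exp u N) (xi m b) = ip u (xi m b).
Proof.
move=> mN; rewrite (ip_suml ipP) (bigD1 (Ordinal mN)) //= [X in _ + X]big1 ?addr0.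
  rewrite (ip_suml ipP) (bigD1 b) //= [X in _ + X]big1 ?addr0.
    by rewrite (ipZl ipP) xi_on !eqxx mulr1.
  by move=> a ab; rewrite (ipZl ipP) xi_on (negbTE ab) andbF mulr0.
move=> l lm; rewrite (ip_suml ipP) big1 // => a _; rewrite (ipZl ipP) xi_on.
by rewrite (_ : (l == m :> nat) = false) ?mulr0 //; apply: negbTE; exact: lm.
Qed.

(** Pythagoras: [u - partial_exp u N] is orthogonal to every combination of the first N blocks, in
    particular to the difference of the two approximations. *)
Lemma partial_exp_best u N s :
  indices_in [set p : nat * J | (p.1 < N)%N] s ->
  nsq (u - partial_exp u N) <= nsq (u - comb uncurried s).
Proof.
move=> hs; have -> : u - comb uncurried s =
    (u - partial_exp u N) + (partial_exp u N - comb uncurried s) by rewrite addrA subrK.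
have h m b : (m < N)%N -> ip (u - partial_exp u N) (xi m b) = 0.
  by move=> mN; rewrite (ipBl ipP) ip_partial_exp // subrr.
have h1 : ip (u - partial_exp u N) (partial_exp u N) = 0.
  rewrite (ip_sumr ipP) big1 // => l _; rewrite (ip_sumr ipP) big1 // => a _.
  by rewrite (ipZr ipP) h // mulr0.
have h2 : ip (u - partial_exp u N) (comb uncurried s) = 0.
  apply: (clsp_orthr ipP (x := uncurried) (K := [set p | (p.1 < N)%N])).
    by move=> [l a] /= lN; exact: h.
  exact: (clsp_comb ipP).
by rewrite [leRHS](nsqD ipP) (ipBr ipP) h1 h2 subrr mulr0 addr0 lerDl (nsq_ge0 ipP).
Qed.

Lemma partial_exp_lim u : clsp ip uncurried setT u -> hlim (partial_exp u) u.
Proof.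
move=> hu; apply/(hlimP ipP) => e e0; have [s _ hs] := hu _ e0.
(* N exceeds every index that occurs in s, so the combination s competes with the partial expansion
   of order N. *)
exists (\max_(p <- s) (p.2.1).+1)%N => N hN; rewrite (nsqBC ipP).
apply: le_lt_trans hs; apply: partial_exp_best => p ps /=.
apply: leq_trans hN; exact: (@leq_bigmax_seq _ _ _ (fun p : R[i] * (nat * J) => (p.2.1).+1)).
Qed.

Lemma parseval u v : clsp ip uncurried setT u ->
  clim (fun N => \sum_(l < N) \sum_a ip u (xi l a) * ip (xi l a) v) (ip u v).
Proof.
move=> /partial_exp_lim /(hlim_ipl ipP v); apply: clim_eq => N.
rewrite (ip_suml ipP); apply: eq_bigr => l _; rewrite (ip_suml ipP).
by apply: eq_bigr => a _; rewrite (ipZl ipP).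
Qed.

End orthonormal_expansion.

(** * Alternating projections between the spans of two orthonormal families *)

Section alternating_projections.
Context (R : realType) (q : nat).
Variables (V : lmodType R[i]) (ip : V -> V -> R[i]) (ipP : hilbert_form ip).
Local Notation nsq := (sqnorm ip).
Local Notation hlim := (hconv ip).
Local Notation csub := (closed_subspace ip).

Definition orthonormal_family (xi : nat -> 'I_q -> V) :=
  forall l a m b, ip (xi l a) (xi m b) = ((l == m) && (a == b))%:R.

Definition span_of (xi : nat -> 'I_q -> V) : set V := clsp ip (uncurried xi) setT.

Definition proj (S : set V) (v : V) : V :=
  xget 0 [set p | S p /\ forall s, S s -> ip (v - p) s = 0].

Lemma projP S v : csub S -> S (proj S v) /\ forall s, S s -> ip (v - proj S v) s = 0.
Proof.
move=> cS; rewrite /proj; case: xgetP => [p _ //|].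
by have [p Sp hp] := projection_theorem ipP v cS => /(_ p) [].
Qed.

Definition pick (k : nat) (xi eta : nat -> 'I_q -> V) := if odd k then eta else xi.

(* The powers of - Q P applied to xi_0, with P and Q the projections onto the spans
   of the xi_j and of the eta_k; their sum is the Neumann series of eps. *)
Fixpoint alt_vec (xi eta : nat -> 'I_q -> V) (k : nat) (a : 'I_q) : V :=
  if k is k'.+1 then - proj (span_of (pick k xi eta)) (alt_vec xi eta k' a) else xi 0%N a.

Variables (xi eta : nat -> 'I_q -> V).
Hypotheses (xi_on : orthonormal_family xi) (eta_on : orthonormal_family eta).

Local Notation s := (alt_vec xi eta).
Local Notation Sp k := (span_of (pick k xi eta)).

Lemma span_csub zeta : csub (span_of zeta). Proof. exact: clsp_csub. Qed.

Lemma span_gen zeta l a : span_of zeta (zeta l a).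
Proof. exact: (clsp_gen ipP (uncurried zeta) (a := (l, a))). Qed.

Lemma alt_vec_span k a : Sp k (s k a).
Proof.
case: k => [|k] /=; first exact: span_gen.
by apply: (csubN (span_csub _)); case: (projP (s k a) (span_csub (pick k.+1 xi eta))).
Qed.

Lemma alt_vecS k a v : Sp k.+1 v -> ip (s k.+1 a) v = - ip (s k a) v.
Proof.
move=> hv; rewrite /= (ipNl ipP); congr (- _).
have [_ h] := projP (s k a) (span_csub (pick k.+1 xi eta)).
by have := h v hv; rewrite (ipBl ipP) => /subr0_eq ->.
Qed.

Lemma pick_parity k m : odd k = odd m -> pick k xi eta = pick m xi eta.
Proof. by rewrite /pick => ->. Qed.

(** Both sides equal [- <s_k, s_m>]: the parity condition puts [s_m] in the span onto which
    [s_(k+1)] is projected, and [s_k] in the span onto which [s_(m+1)] is projected. *)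
Lemma alt_vec_shift k m a b : odd k.+1 = odd m -> ip (s k.+1 a) (s m b) = ip (s k a) (s m.+1 b).
Proof.
move=> km; rewrite alt_vecS; last by rewrite (pick_parity km); exact: alt_vec_span.
rewrite (ipC ipP (s m.+1 b)) alt_vecS; first by rewrite rmorphN /= -(ipC ipP).
have -> : pick m.+1 xi eta = pick k xi eta by apply: pick_parity; rewrite /= -km /= negbK.
exact: alt_vec_span.
Qed.

Lemma alt_vec_double k m a b : odd k = odd m -> ip (s k a) (s m b) = ip (s (k + m) a) (s 0 b).
Proof.
elim: m k => [|m IH] k; first by rewrite addn0.
move=> km; rewrite -(alt_vec_shift a b (k := k)); last by rewrite /= km /= negbK.
by rewrite IH; [rewrite addSnnS|rewrite /= km /= negbK].
Qed.

Section matrix_coefficients.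
Variables (alpha alpha' : int -> 'M[R[i]]_q) (n : nat).
Hypothesis alphaE : forall l j a b,
  alpha (n + j + l + 1)%N%:Z a b = - ip (xi l a) (eta j b).
Hypothesis alphaE' : forall l j a b,
  alpha' (n + j + l + 1)%N%:Z a b = - ip (eta l a) (xi j b).

Lemma pick_on k : orthonormal_family (pick k xi eta).
Proof. by rewrite /pick; case: ifP. Qed.

(** Induction on k: expanding [s_k] by Parseval in the family that spans it turns the inner products
    of [s_(k+1)] into the recursion of [altseq]; the minus sign in [alt_vec] matches the one in the
    hypotheses on [alpha] and [alpha']. *)
Lemma altseqE k j a b : altseq alpha alpha' n k j a b = ip (s k a) (pick k xi eta j b).
Proof.
elim: k j a b => [|k IH] j a b /=.
  by rewrite mxE xi_on eq_sym; case: eqP => _; rewrite ?andbT ?mul0rn ?mulr1n.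
rewrite mxE; apply: (proj2 (@clim_series _ _ _ _)).
rewrite -/(s k.+1 a) alt_vecS; last exact: span_gen.
rewrite -mulN1r; apply: clim_eq (climZ (-1) (parseval ipP (@pick_on k) _ (alt_vec_span k a))).
move=> N; rewrite mulr_sumr; apply: eq_bigr => l _.
rewrite mxE mulr_sumr; apply: eq_bigr => m _; rewrite IH mulN1r -mulrN; congr (_ * _).
by rewrite /pick /=; case: (odd k) => /=; rewrite ?alphaE ?alphaE'.
Qed.

End matrix_coefficients.

Variables (M : set V) (cM : csub M).
Hypotheses (Mxi : forall l a, M (xi l a)) (Meta : forall l a, M (eta l a)).

(** The part of M invisible to both families. In the application it lies in the span of the observed
    block X_{-n}, ..., X_{-1}, to which the residuals are orthogonal. *)
Definition core : set V := [set v | [/\ M v, forall l a, ip v (xi l a) = 0 &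
  forall l a, ip v (eta l a) = 0]].

Variables (a : 'I_q) (eps : V).
Hypotheses (Meps : M eps) (eps_core : forall v, core v -> ip eps v = 0).
Hypothesis eps_eta : forall l b, ip eps (eta l b) = 0.
Hypothesis eps_xi : forall l b, ip eps (xi l b) = ip (xi 0%N a) (xi l b).

(** An even number of terms is kept, so that the last projection is onto the span of the [eta]: the
    sum is then exactly orthogonal to that span, and only its last term disturbs the inner products
    with the [xi]. *)
Definition alt_sum N (b : 'I_q) := \sum_(k < 2 * N) s k b.

Lemma alt_sumS N b : alt_sum N.+1 b = alt_sum N b + (s (2 * N) b + s (2 * N).+1 b).
Proof. by rewrite /alt_sum mulnS add2n !big_ord_recr /= addrA. Qed.

Lemma eps_span v : span_of xi v -> ip eps v = ip (xi 0%N a) v.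
Proof.
move=> hv; apply/eqP; rewrite -subr_eq0 -(ipBl ipP); apply/eqP.
by apply: (clsp_orthr ipP _ hv) => -[l b] _; rewrite (ipBl ipP) eps_xi subrr.
Qed.

Lemma eps_span_eta v : span_of eta v -> ip eps v = 0.
Proof. by move=> hv; apply: (clsp_orthr ipP _ hv) => -[l b] _; exact: eps_eta. Qed.

Lemma alt_sum_eta N b v : span_of eta v -> ip (alt_sum N b) v = 0.
Proof.
move=> hv; elim: N => [|N IH]; first by rewrite /alt_sum muln0 big_ord0 (ip0l ipP).
rewrite alt_sumS (ipDl ipP) IH add0r (ipDl ipP) alt_vecS ?subrr //.
by rewrite /pick /= mul2n odd_double.
Qed.

(** Against the span of the [xi], each odd term cancels with the even term that follows it; the
    first term and the last one remain. *)
Lemma alt_sum_xi N b v : span_of xi v ->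
  ip (alt_sum N.+1 b) v = ip (xi 0%N b) v + ip (s (2 * N).+1 b) v.
Proof.
move=> hv; elim: N => [|N IH].
  by rewrite alt_sumS /alt_sum muln0 big_ord0 add0r (ipDl ipP).
rewrite alt_sumS (ipDl ipP) {}IH -addrA; congr (_ + _).
rewrite (ipDl ipP) addrA mulnS add2n (alt_vecS (k := (2 * N).+1)); first by rewrite subrr add0r.
by rewrite /pick /= mul2n odd_double.
Qed.

Lemma alt_vec_even k b : span_of xi (s (2 * k) b).
Proof. by have := alt_vec_span (2 * k) b; rewrite /pick mul2n odd_double. Qed.

Lemma alt_vec_odd k b : span_of eta (s (2 * k).+1 b).
Proof. by have := alt_vec_span (2 * k).+1 b; rewrite /pick /= mul2n odd_double. Qed.

Lemma ip_alt_sum N b v : (forall w, span_of eta w -> ip w v = 0) ->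
  ip (alt_sum N b) v = \sum_(k < N) ip (s (2 * k) b) v.
Proof.
move=> hv; elim: N => [|N IH]; first by rewrite /alt_sum muln0 !big_ord0 (ip0l ipP).
rewrite alt_sumS (ipDl ipP) IH big_ord_recr /= (ipDl ipP) (hv (s _.+1 b)) ?addr0 //.
exact: alt_vec_odd.
Qed.

Lemma ip_alt_sum_odd N b v : (forall w, span_of xi w -> ip w v = 0) ->
  ip (alt_sum N b) v = \sum_(k < N) ip (s (2 * k).+1 b) v.
Proof.
move=> hv; elim: N => [|N IH]; first by rewrite /alt_sum muln0 !big_ord0 (ip0l ipP).
rewrite alt_sumS (ipDl ipP) IH big_ord_recr /= (ipDl ipP) (hv (s (2 * N) b)) ?add0r //.
exact: alt_vec_even.
Qed.

Let S N := \sum_(k < N) nsq (s k a).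

(** The vector [xi_0] is the term [s_0], so [alt_vec_double] lets the index 2k be split evenly as k
    + k. *)
Lemma ip_even k : ip (s (2 * k) a) (xi 0%N a) = (nsq (s k a))%:C%C.
Proof. by rewrite mul2n -addnn -(alt_vec_double a a (m := k)) // (ip_nsq ipP). Qed.

(** Odd terms lie in the span of the [eta] and do not see [eps]; on even terms [eps] acts like
    [xi_0], so that [ip_even] applies. *)
Lemma ip_eps_alt_sum N : ip (alt_sum N a) eps = (S N)%:C%C.
Proof.
rewrite ip_alt_sum; last by move=> w hw; apply: (ip_eq0C ipP); exact: eps_span_eta.
rewrite rmorph_sum; apply: eq_bigr => k _.
by rewrite (ipC ipP) eps_span -?(ipC ipP) ?ip_even //; exact: alt_vec_even.
Qed.

(* The partial sums are Cauchy because <s_j, s_k> only depends on j + k when j and k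
   have the same parity, so that all their inner products are sums of |s_k|^2. *)
Lemma ip_alt_sum2 N m : ip (alt_sum N a) (alt_sum m.+1 a) = (S N + S m.+1 - S (N + m.+1))%:C%C.
Proof.
rewrite ip_alt_sum; last by move=> w hw; apply: (ip_eq0C ipP); exact: alt_sum_eta.
have -> : S N + S m.+1 - S (N + m.+1) =
    \sum_(k < N) (nsq (s k a) - nsq (s (k + m.+1) a)).
  rewrite sumrB -addrA; congr (_ + _); rewrite addnC /S big_split_ord opprD addrA subrr add0r.
  by congr (- _); apply: eq_bigr => k _; rewrite [X in _ = nsq (s X a)]addnC.
rewrite rmorph_sum; apply: eq_bigr => k _ /=.
rewrite (ipC ipP) alt_sum_xi; last exact: alt_vec_even.
rewrite rmorphD rmorphB /= -!(ipC ipP) ip_even; congr (_ + _).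
rewrite -ip_even mulnDr -(alt_vec_double a a (m := (2 * m.+1)%N)); last first.
  by rewrite !mul2n !odd_double.
rewrite (ipC ipP (s (2 * m.+1) a)) mulnS add2n alt_vecS; last first.
  by rewrite /pick /= mul2n odd_double /=; exact: alt_vec_even.
by rewrite rmorphN /= opprK -(ipC ipP).
Qed.

Lemma S_mono : nondecreasing_seq S.
Proof.
apply/nondecreasing_seqP => N; rewrite /S big_ord_recr /= lerDl; exact: (nsq_ge0 ipP).
Qed.

Lemma S_bounded N : S N <= nsq eps.
Proof.
case: N => [|m]; first by rewrite /S big_ord0 (nsq_ge0 ipP).
have S0 : 0 <= S m.+1 by rewrite sumr_ge0 // => k _; exact: (nsq_ge0 ipP).
(* By [ip_alt_sum2] this squared norm is twice [S_(m+1)] minus [S_(2m+2)], and S is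
   nondecreasing. *)
have h : nsq (alt_sum m.+1 a) <= S m.+1.
  rewrite /sqnorm ip_alt_sum2 /= lerBlDr lerD2l; apply: S_mono; exact: leq_addr.
have := cauchy_schwarz ipP (alt_sum m.+1 a) eps; rewrite ip_eps_alt_sum cn_real => h2.
have [->|Sn0] := eqVneq (S m.+1) 0; first exact: (nsq_ge0 ipP).
have Sp : 0 < S m.+1 by rewrite lt_def Sn0.
rewrite -(ler_pM2l Sp) -expr2; apply: (le_trans h2).
by apply: ler_wpM2r h; exact: (nsq_ge0 ipP).
Qed.

Lemma S_cvg : cvgn S.
Proof.
apply: nondecreasing_is_cvgn; first exact: S_mono.
by exists (nsq eps) => _ [N _ <-]; exact: S_bounded.
Qed.

Lemma nsq_alt_sumB N m :
  nsq (alt_sum N.+1 a - alt_sum m.+1 a) =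
  2 * S (N.+1 + m.+1) - S (N.+1 + N.+1) - S (m.+1 + m.+1).
Proof.
rewrite (nsqB ipP) /sqnorm !ip_alt_sum2 /=; ring.
Qed.

Lemma S_close e : 0 < e -> exists N, forall m n, (N <= m)%N -> (N <= n)%N -> S m - S n < e.
Proof.
move=> e0; have /cvgrPdist_lt h := S_cvg; have e2 : 0 < e / 2 by lra.
have [N _ HN] := h _ e2; exists N => m n Nm Nn.
have := HN m Nm; have := HN n Nn; rewrite /= !ltr_norml => /andP[? ?] /andP[? ?]; lra.
Qed.

Lemma core_alt_sum N v : core v -> ip (alt_sum N a) v = 0.
Proof.
case=> Mv vxi veta; rewrite (ip_suml ipP) big1 // => k _.
apply: (clsp_orthl ipP _ (alt_vec_span k a)) => -[l b] _.
by apply: (ip_eq0C ipP); rewrite /uncurried /pick; case: ifP.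
Qed.

(** The partial sums have a limit z by [nsq_alt_sumB]. It has the same inner products as [eps] with
    both families, so [z - eps] lies in [core]; since z and [eps] are both orthogonal to [core], the
    difference is null. *)
Lemma alt_sum_lim : hlim (alt_sum ^~ a) eps.
Proof.
have [z hz] : exists z, hlim (alt_sum ^~ a) z.
  apply: (hf_complete ipP) => e e0; have [N HN] := S_close (divr_gt0 e0 (ltr0n R 2)).
  exists N.+1 => -[//|m] [//|n]; rewrite !ltnS => Nm Nn; rewrite nsq_alt_sumB.
  have h1 : (N <= m.+1 + n.+1)%N by rewrite (leq_trans Nm) // addSn ltnW // ltnS leq_addr.
  have h2 : (N <= m.+1 + m.+1)%N by rewrite (leq_trans Nm) // addSn ltnW // ltnS leq_addr.
  have h3 : (N <= n.+1 + n.+1)%N by rewrite (leq_trans Nn) // addSn ltnW // ltnS leq_addr.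
  have := HN _ _ h1 h2; have := HN _ _ h1 h3; lra.
have span_M k b : M (s k b).
  apply: (clsp_min cM _ (alt_vec_span k b)) => -[l c] _.
  by rewrite /uncurried /pick; case: ifP.
have Mz : M z by apply: (csub_lim ipP cM _ hz) => N; apply: (csub_sum _ cM) => k _; exact: span_M.
have zeta l b : ip z (eta l b) = 0.
  apply: (clim_unique (hlim_ipl ipP (eta l b) hz)).
  apply: clim_eq (clim_cst 0) => N; rewrite alt_sum_eta //; exact: span_gen.
have zcore v : core v -> ip z v = 0.
  move=> cv; apply: (clim_unique (hlim_ipl ipP v hz)).
  by apply: clim_eq (clim_cst 0) => N; rewrite core_alt_sum.
(* The squared norms of the terms are increments of the convergent sequence S, so the error term of
   [alt_sum_xi] disappears in the limit. *)
have tail : (fun N => nsq (s (2 * N).+1 a)) @ \oo --> (0 : R).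
  apply/nonneg_cvg0P => [N|e e0]; first exact: (nsq_ge0 ipP).
  have [N HN] := S_close e0; exists N => n Nn.
  have h1 : (N <= (2 * n).+1)%N by rewrite (leq_trans Nn) // mul2n -addnn leqW // leq_addr.
  have := HN _ _ (leqW h1) h1; rewrite /S big_ord_recr /=.
  by rewrite addrAC subrr add0r.
have zxi l b : ip z (xi l b) = ip (xi 0%N a) (xi l b).
  have h' := clim_shift (hlim_ipl ipP (xi l b) hz).
  apply: (clim_unique h').
  have : clim (fun N => ip (xi 0%N a) (xi l b) + ip (s (2 * N).+1 a) (xi l b))
       (ip (xi 0%N a) (xi l b) + 0).
    apply: climD; first exact: clim_cst.
    apply: (squeeze0 (v := fun N => nsq (s (2 * N).+1 a))) tail => [N|N]; first exact: cn_ge0.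
    rewrite subr0; apply: le_trans (cauchy_schwarz ipP _ _) _.
    by rewrite /sqnorm xi_on !eqxx /= mulr1.
  rewrite addr0; apply: clim_eq => N; rewrite alt_sum_xi //; exact: span_gen.
have cz : core (z - eps).
  split; first exact: (csubB cM).
  - by move=> l b; rewrite (ipBl ipP) zxi eps_xi subrr.
  - by move=> l b; rewrite (ipBl ipP) zeta eps_eta subrr.
have z0 : nsq (z - eps) = 0.
  by rewrite /sqnorm {1}(ipBl ipP) zcore // eps_core // subrr.
rewrite hconvE; apply: (squeeze0 (v := fun n => 2 * nsq (alt_sum n a - z))) => [n|n|].
- exact: (nsq_ge0 ipP).
- by have := nsqB_le ipP (alt_sum n a) z eps; rewrite z0 mulr0 addr0.
- exact: cvg0Z.
Qed.

End alternating_projections.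

(** * Integration of complex functions and completeness of L^2 *)

Section complex_integration.
Context d (T : measurableType d) (R : realType) (mu : {measure set T -> \bar R}).
Variables (D : set T) (mD : measurable D).
Implicit Types (f g : T -> R[i]).

Definition cmeas f := measurable_fun D (fun x => complex.Re (f x)) /\
  measurable_fun D (fun x => complex.Im (f x)).

Definition rint (g : T -> R) := mu.-integrable D (fun x => (g x)%:E).

Definition cint f := rint (fun x => complex.Re (f x)) /\ rint (fun x => complex.Im (f x)).

Lemma cReD (z u : R[i]) : complex.Re (z + u) = complex.Re z + complex.Re u.
Proof. by case: z u => ? ? []. Qed.
Lemma cImD (z u : R[i]) : complex.Im (z + u) = complex.Im z + complex.Im u.
Proof. by case: z u => ? ? []. Qed.
Lemma cReN (z : R[i]) : complex.Re (- z) = - complex.Re z. Proof. by case: z. Qed.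
Lemma cImN (z : R[i]) : complex.Im (- z) = - complex.Im z. Proof. by case: z. Qed.
Lemma cReM (z u : R[i]) : complex.Re (z * u) =
  complex.Re z * complex.Re u - complex.Im z * complex.Im u.
Proof. by case: z u => ? ? []. Qed.
Lemma cImM (z u : R[i]) : complex.Im (z * u) =
  complex.Re z * complex.Im u + complex.Im z * complex.Re u.
Proof. by case: z u => ? ? []. Qed.
Lemma cReJ (z : R[i]) : complex.Re (z^*) = complex.Re z. Proof. by case: z. Qed.
Lemma cImJ (z : R[i]) : complex.Im (z^*) = - complex.Im z. Proof. by case: z. Qed.

Lemma cmeas_cst z : cmeas (fun=> z).
Proof. by split; exact: measurable_cst. Qed.

Lemma cmeasD f g : cmeas f -> cmeas g -> cmeas (fun x => f x + g x).
Proof.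
move=> [f1 f2] [g1 g2]; split.
  by under eq_fun do rewrite cReD; exact: measurable_funD.
by under eq_fun do rewrite cImD; exact: measurable_funD.
Qed.

Lemma cmeasM f g : cmeas f -> cmeas g -> cmeas (fun x => f x * g x).
Proof.
move=> [f1 f2] [g1 g2]; split.
  by under eq_fun do rewrite cReM; apply: measurable_funB; exact: measurable_funM.
by under eq_fun do rewrite cImM; apply: measurable_funD; exact: measurable_funM.
Qed.

Lemma cmeasJ f : cmeas f -> cmeas (fun x => (f x)^*).
Proof.
move=> [f1 f2]; split; first by under eq_fun do rewrite cReJ.
by under eq_fun do rewrite cImJ; exact: measurableT_comp.
Qed.

Lemma cmeasN f : cmeas f -> cmeas (fun x => - f x).
Proof.
move=> [f1 f2]; split.
  by under eq_fun do rewrite cReN; exact: measurableT_comp.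
by under eq_fun do rewrite cImN; exact: measurableT_comp.
Qed.

Lemma cmeasB f g : cmeas f -> cmeas g -> cmeas (fun x => f x - g x).
Proof. by move=> mf /cmeasN; exact: cmeasD. Qed.

Lemma cmeas_sum (I : Type) (r : seq I) (Q : pred I) (F : I -> T -> R[i]) :
  (forall i, cmeas (F i)) -> cmeas (fun x => \sum_(i <- r | Q i) F i x).
Proof.
move=> mF; elim: r => [|i r IH].
  by rewrite (_ : (fun x => _) = fun=> 0); [exact: cmeas_cst|apply/funext => x; rewrite big_nil].
rewrite (_ : (fun x => _) = fun x => if Q i then F i x + \sum_(i <- r | Q i) F i x
  else \sum_(i <- r | Q i) F i x); last by apply/funext => x; rewrite big_cons.
by case: (Q i) => //; exact: cmeasD.
Qed.

Lemma cmeas_prod (I : Type) (r : seq I) (Q : pred I) (F : I -> T -> R[i]) :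
  (forall i, cmeas (F i)) -> cmeas (fun x => \prod_(i <- r | Q i) F i x).
Proof.
move=> mF; elim: r => [|i r IH].
  by rewrite (_ : (fun x => _) = fun=> 1); [exact: cmeas_cst|apply/funext => x; rewrite big_nil].
rewrite (_ : (fun x => _) = fun x => if Q i then F i x * \prod_(i <- r | Q i) F i x
  else \prod_(i <- r | Q i) F i x); last by apply/funext => x; rewrite big_cons.
by case: (Q i) => //; exact: cmeasM.
Qed.

Lemma cmeas_cn f : cmeas f -> measurable_fun D (fun x => cn (f x)).
Proof. by move=> [f1 f2]; apply: measurable_funD; exact: measurable_funX. Qed.

Lemma rintD (g1 g2 : T -> R) : rint g1 -> rint g2 -> rint (fun x => g1 x + g2 x).
Proof. by move=> h1 h2; exact: (integrableD mD h1 h2). Qed.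

Lemma rintZ k (g1 : T -> R) : rint g1 -> rint (fun x => k * g1 x).
Proof. by move=> h1; exact: (integrableZl mD k h1). Qed.

Lemma rintN (g1 : T -> R) : rint g1 -> rint (fun x => - g1 x).
Proof. by move=> /(rintZ (-1)); rewrite /rint; under eq_fun do rewrite mulN1r. Qed.

Lemma rint_abs (g1 : T -> R) : rint g1 -> rint (fun x => `|g1 x|).
Proof.
move=> /integrableP[/measurable_EFinP m lt1]; apply/integrableP; split.
  by apply/measurable_EFinP; exact: measurableT_comp.
apply: le_lt_trans lt1; rewrite le_eqVlt; apply/orP; left; apply/eqP.
by apply: eq_integral => x _ /=; rewrite normr_id.
Qed.

Lemma rint_le (g1 g2 : T -> R) : measurable_fun D g1 -> rint g2 ->
  (forall x, D x -> `|g1 x| <= g2 x) -> rint g1.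
Proof.
move=> m1 h2 h; apply: le_integrable h2 => //; first exact/measurable_EFinP.
by move=> x Dx /=; rewrite lee_fin (le_trans (h x Dx)) // ler_norm.
Qed.

Lemma rint_meas (g : T -> R) : rint g -> measurable_fun D g.
Proof. by move=> /measurable_int /measurable_EFinP. Qed.

Lemma cint_meas f : cint f -> cmeas f.
Proof. by move=> [/rint_meas ? /rint_meas ?]; split. Qed.

Lemma normr_le_sqr (a b : R) : 0 <= b -> a ^+ 2 <= b ^+ 2 -> `|a| <= b.
Proof. by move=> b0 ab; rewrite -(ler_pXn2r (n := 2)) ?nnegrE // real_normK ?num_real. Qed.

Lemma cint_dom f (g : T -> R) : cmeas f -> rint g ->
  (forall x, D x -> 0 <= g x) -> (forall x, D x -> cn (f x) <= g x ^+ 2) -> cint f.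
Proof.
move=> [f1 f2] hg g0 fg; split; apply: rint_le hg _ => // x Dx;
  apply: normr_le_sqr; rewrite ?g0 //; apply: le_trans (fg x Dx).
  by rewrite lerDl sqr_ge0.
by rewrite lerDr sqr_ge0.
Qed.

Lemma cintD f g : cint f -> cint g -> cint (fun x => f x + g x).
Proof.
move=> [f1 f2] [g1 g2]; split.
  by rewrite /rint; under eq_fun do rewrite cReD; exact: rintD.
by rewrite /rint; under eq_fun do rewrite cImD; exact: rintD.
Qed.

Lemma cintZ z f : cint f -> cint (fun x => z * f x).
Proof.
move=> [f1 f2]; split.
  by rewrite /rint; under eq_fun do rewrite cReM; apply: rintD; [|apply: rintN]; exact: rintZ.
by rewrite /rint; under eq_fun do rewrite cImM; apply: rintD; exact: rintZ.
Qed.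

Lemma cint0 : cint (fun=> 0).
Proof. by split; exact: integrable0. Qed.

Lemma cint_sum (I : Type) (r : seq I) (Q : pred I) (F : I -> T -> R[i]) :
  (forall i, cint (F i)) -> cint (fun x => \sum_(i <- r | Q i) F i x).
Proof.
move=> mF; elim: r => [|i r IH].
  by rewrite (_ : (fun x => _) = fun=> 0); [exact: cint0|apply/funext => x; rewrite big_nil].
rewrite (_ : (fun x => _) = fun x => if Q i then F i x + \sum_(i <- r | Q i) F i x
  else \sum_(i <- r | Q i) F i x); last by apply/funext => x; rewrite big_cons.
by case: (Q i) => //; exact: cintD.
Qed.

Local Notation I := (cintegral mu D).

Lemma cintegralD f g : cint f -> cint g -> I (fun x => f x + g x) = I f + I g.
Proof.
move=> [f1 f2] [g1 g2]; rewrite /cintegral.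
under eq_Rintegral do rewrite cReD.
under [X in Complex _ X]eq_Rintegral do rewrite cImD.
by rewrite !RintegralD.
Qed.

Lemma cintegralZ z f : cint f -> I (fun x => z * f x) = z * I f.
Proof.
move=> [f1 f2]; rewrite /cintegral.
under eq_Rintegral do rewrite cReM.
under [X in Complex _ X]eq_Rintegral do rewrite cImM.
rewrite RintegralB ?RintegralD //; try exact: rintZ.
by rewrite !RintegralZl //; case: z.
Qed.

Lemma cintegralJ f : cint f -> I (fun x => (f x)^*) = (I f)^*.
Proof.
move=> [f1 f2]; rewrite /cintegral; under eq_Rintegral do rewrite cReJ.
under [X in Complex _ X]eq_Rintegral do rewrite cImJ -mulN1r.
by rewrite RintegralZl // mulN1r.
Qed.

Lemma cintegral0 : I (fun=> 0) = 0.
Proof. by rewrite /cintegral /= !Rintegral_cst // !mul0r. Qed.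

Lemma cintegral_sum (K : Type) (r : seq K) (Q : pred K) (F : K -> T -> R[i]) :
  (forall i, cint (F i)) ->
  I (fun x => \sum_(i <- r | Q i) F i x) = \sum_(i <- r | Q i) I (F i).
Proof.
move=> mF; elim: r => [|i r IH].
  rewrite big_nil (_ : (fun x => _) = fun=> 0); first exact: cintegral0.
  by apply/funext => x; rewrite big_nil.
rewrite (_ : (fun x => _) = fun x => if Q i then F i x + \sum_(i <- r | Q i) F i x
  else \sum_(i <- r | Q i) F i x); last by apply/funext => x; rewrite big_cons.
by rewrite big_cons; case: (Q i) => //; rewrite cintegralD ?IH //; exact: cint_sum.
Qed.

Lemma Rintegral_ae (g1 g2 : T -> R) : measurable_fun D g1 -> measurable_fun D g2 ->
  {ae mu, forall x, D x -> g1 x = g2 x} -> Rintegral mu D g1 = Rintegral mu D g2.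
Proof.
move=> m1 m2 h; rewrite /Rintegral; congr fine; apply: ae_eq_integral => //.
- exact/measurable_EFinP.
- exact/measurable_EFinP.
- by apply: filterS h => x h Dx; rewrite h.
Qed.

Lemma cintegral_ae f g : cmeas f -> cmeas g ->
  {ae mu, forall x, D x -> f x = g x} -> I f = I g.
Proof.
move=> [f1 f2] [g1 g2] h; rewrite /cintegral; congr Complex; apply: Rintegral_ae => //.
  by apply: filterS h => x h Dx; rewrite h.
by apply: filterS h => x h Dx; rewrite h.
Qed.

Lemma rint_ae (g1 g2 : T -> R) : rint g1 -> measurable_fun D g2 ->
  {ae mu, forall x, D x -> g1 x = g2 x} -> rint g2.
Proof.
move=> h1 m2 h; have /integrableP[m1 lt1] := h1; apply/integrableP.
have m2' : measurable_fun D (fun x => (g2 x)%:E) by exact/measurable_EFinP.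
split => //; apply: le_lt_trans lt1; rewrite le_eqVlt; apply/orP; left; apply/eqP.
apply: ae_eq_integral => //.
- exact: measurableT_comp.
- exact: measurableT_comp.
- by apply: filterS h => x h Dx /=; rewrite h.
Qed.

Lemma aeS1 (P Q : T -> Prop) : (forall x, P x -> Q x) ->
  {ae mu, forall x, P x} -> {ae mu, forall x, Q x}.
Proof. by move=> h; exact: filterS. Qed.

Lemma aeS2 (P Q S : T -> Prop) : (forall x, P x -> Q x -> S x) ->
  {ae mu, forall x, P x} -> {ae mu, forall x, Q x} -> {ae mu, forall x, S x}.
Proof. by move=> h; exact: filterS2. Qed.

Lemma ae_fin (J : finType) (P : J -> T -> Prop) :
  (forall j, {ae mu, forall x, P j x}) -> {ae mu, forall x, forall j, P j x}.
Proof.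
move=> h; have : {ae mu, forall x, forall j, j \in enum J -> P j x}.
  elim: (enum J) => [|j r IH]; first exact: aeW.
  by apply: aeS2 (h j) IH => x hj hr i; rewrite inE => /orP[/eqP ->|/hr].
by apply: aeS1 => x hx j; apply: hx; rewrite mem_enum.
Qed.

Lemma cLfun2P f : cLfun mu D 2 f <-> cmeas f /\ rint (fun x => cn (f x)).
Proof.
rewrite /cLfun (_ : (fun x => (complex.Re `|f x| ^+ 2)%:E) = fun x => (cn (f x))%:E).
  by split=> [[]|[[]]].
by apply/funext => x; rewrite Re_normr_cn.
Qed.

Lemma Rintegral_eq0 (g : T -> R) : rint g -> (forall x, D x -> 0 <= g x) ->
  Rintegral mu D g = 0 -> {ae mu, forall x, D x -> g x = 0}.
Proof.
move=> hg g0 h.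
have : (\int[mu]_(x in D) `|(g x)%:E| = 0)%E.
  have -> : (\int[mu]_(x in D) `|(g x)%:E| = \int[mu]_(x in D) (g x)%:E)%E.
    by apply: eq_integral => x; rewrite inE => Dx; rewrite gee0_abs // lee_fin g0.
  by rewrite -[LHS]fineK ?integrable_fin_num // [X in X%:E](_ : _ = 0).
have mg : measurable_fun D (fun x => (g x)%:E) by have /integrableP[] := hg.
move=> /(ae_eq_integral_abs mu mD mg); apply: filterS => x h' Dx.
by have := h' Dx => -[].
Qed.

End complex_integration.

(** * The Hilbert space L^2 and its completeness *)

Section L2_space.
Context d (T : measurableType d) (R : realType) (mu : {measure set T -> \bar R}).
Variables (D : set T) (mD : measurable D).
Implicit Types (f g : T -> R[i]).

Local Notation rint := (rint mu D).
Local Notation cint := (cint mu D).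
Local Notation cmeas := (cmeas D).

(** Measurability of D is a parameter of the predicate because closure under linear combinations,
    attached to the predicate as a structure, relies on it. *)
Definition L2pred of measurable D : {pred T -> R[i]} := fun f => `[< cLfun mu D 2 f >].

Lemma L2predP f : f \in L2pred mD <-> cmeas f /\ rint (fun x => cn (f x)).
Proof. by rewrite -cLfun2P; split=> /asboolP. Qed.

Lemma L2pred_submod : submod_closed (L2pred mD).
Proof.
split.
  apply/L2predP; split; first exact: cmeas_cst.
  rewrite /rint (_ : (fun x => _) = fun=> 0%E); first exact: integrable0.
  by apply/funext => x; rewrite cn0.
move=> a f g /L2predP [mf hf] /L2predP [mg hg]; apply/L2predP.
have m : cmeas (fun x => a * f x + g x).
  by apply: cmeasD => //; apply: cmeasM => //; exact: cmeas_cst.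
split; first exact: m.
apply: (rint_le mD (g2 := fun x => 2 * (cn a * cn (f x)) + 2 * cn (g x))).
- exact: (cmeas_cn m).
- by apply: rintD => //; apply: rintZ => //; exact: rintZ.
- by move=> x _; rewrite ger0_norm ?cn_ge0 // -cnM; exact: cnD_le.
Qed.

HB.instance Definition _ := GRing.isSubmodClosed.Build _ _ (L2pred mD) L2pred_submod.

Record L2 := MkL2 { L2fun :> T -> R[i]; _ : L2fun \in L2pred mD }.

HB.instance Definition _ := [isSub for L2fun].
HB.instance Definition _ := [Choice of L2 by <:].
HB.instance Definition _ := [SubChoice_isSubLmodule of L2 by <:].

Lemma L2D (f g : L2) x : (f + g) x = f x + g x. Proof. by []. Qed.
Lemma L2N (f : L2) x : (- f) x = - f x. Proof. by []. Qed.
Lemma L2Z a (f : L2) x : (a *: f) x = a * f x. Proof. by []. Qed.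

Lemma L2_meas (f : L2) : cmeas f.
Proof. by have /L2predP[] := valP f. Qed.

Lemma L2_sq (f : L2) : rint (fun x => cn (f x)).
Proof. by have /L2predP[] := valP f. Qed.

Definition ipL2 (f g : L2) : R[i] := cintegral mu D (fun x => f x * (g x)^*).

Lemma L2_cint (f g : L2) : cint (fun x => f x * (g x)^*).
Proof.
apply: (cint_dom mD (g := fun x => cn (f x) + cn (g x))).
- by apply: cmeasM; [|apply: cmeasJ]; exact: L2_meas.
- by apply: rintD => //; exact: L2_sq.
- by move=> x _; rewrite addr_ge0 ?cn_ge0.
- move=> x _; rewrite cnM cnJ; have := cn_ge0 (f x); have := cn_ge0 (g x).
  by move: (cn _) (cn _) => a b ha hb; nra.
Qed.

Lemma nsq_L2 (f : L2) : sqnorm ipL2 f = Rintegral mu D (fun x => cn (f x)).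
Proof. by rewrite /sqnorm /ipL2 /=; apply: eq_Rintegral => x _; rewrite cnE. Qed.

Lemma nsq_L2E (f : L2) : (\int[mu]_(x in D) (cn (f x))%:E = (sqnorm ipL2 f)%:E)%E.
Proof. by rewrite nsq_L2 /Rintegral fineK // integrable_fin_num //; exact: L2_sq. Qed.

Lemma limn_einf_le (u : (\bar R)^nat) c N :
  (forall n, (N <= n)%N -> (u n <= c)%E) -> (limn_einf u <= c)%E.
Proof.
move=> h; rewrite limn_einf_lim; apply: lime_le; first exact: is_cvg_einfs.
exists N => // n Nn; apply: le_trans (h n Nn); apply: ereal_inf_lbound.
by exists n => /=.
Qed.

Lemma measurable_fun_limn_einf (g : (T -> \bar R)^nat) :
  (forall n, measurable_fun D (g n)) -> measurable_fun D (fun x => limn_einf (g ^~ x)).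
Proof.
move=> mg; rewrite (_ : (fun x => _) = fun x => (- limn_esup (fun n => - g n x))%E).
  apply: measurableT_comp => //; apply: measurable_fun_limn_esup => n.
  exact: measurableT_comp.
by apply/funext => x; rewrite -limn_einfN; congr limn_einf; apply/funext => n /=; rewrite oppeK.
Qed.

Lemma sum_half N : \sum_(k < N) (2^-1 : R) ^+ k <= 2.
Proof.
suff -> : \sum_(k < N) (2^-1 : R) ^+ k = 2 - 2 * 2^-1 ^+ N by rewrite gerBl mulr_ge0 // exprn_ge0.
elim: N => [|N IH]; first by rewrite big_ord0 expr0 mulr1 subrr.
by rewrite big_ord_recr /= IH exprS; field.
Qed.

(** The hypothesis says that |u_k| is at most the square root of C divided by 2^k, so a geometric
    series dominates. *)
Lemma fast_series_cvg (u : nat -> R) C :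
  (forall k, u k ^+ 2 * 4 ^+ k <= C) -> cvgn (series u).
Proof.
move=> h; have C0 : 0 <= C by apply: le_trans (h 0%N); rewrite mulr_ge0 ?sqr_ge0 ?exprn_ge0.
apply: normed_cvg; apply: (@series_le_cvg _ _ (geometric (Num.sqrt C) (2^-1))) => [n|n|n|] /=.
- exact: normr_ge0.
- by rewrite mulr_ge0 ?sqrtr_ge0 ?exprn_ge0.
- apply: normr_le_sqr; first by rewrite mulr_ge0 ?sqrtr_ge0 ?exprn_ge0.
  have E : (2^-1 ^+ n) ^+ 2 * 4 ^+ n = 1 :> R.
    by rewrite exprAC -exprMn (_ : 2^-1 ^+ 2 * 4 = 1) ?expr1n //; field.
  rewrite exprMn sqr_sqrtr // -(ler_pM2r (exprn_gt0 n (ltr0n R 4))).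
  by rewrite -(mulrA C) E mulr1; exact: h.
- by apply: is_cvg_geometric_series; rewrite ger0_norm // invf_lt1 // ltr1n.
Qed.

(** Riesz-Fischer: a fast subsequence converges almost everywhere, and Fatou turns this into norm
    convergence of the whole sequence. The subsequence is returned as well, because determinants
    will need pointwise limits. *)
Lemma L2_complete (u : nat -> L2) :
  (forall e : R, 0 < e -> exists N, forall m n, (N <= m)%N -> (N <= n)%N ->
      sqnorm ipL2 (u m - u n) < e) ->
  exists l, hconv ipL2 u l /\ exists2 s : nat -> nat, (forall k, (k <= s k)%N) &
    {ae mu, forall x, D x -> clim (fun k => u (s k) x) (l x)}.
Proof.
(* Squared gaps below 8^-k, weighted by 4^k, have integrals at most 2^-k; where the weighted sum is
   finite, the gaps themselves are then of order 2^-k. *)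
move=> hu; pose e8 k : R := 8^-1 ^+ k.
have e80 k : 0 < e8 k by rewrite exprn_gt0.
have /choice [N0 hN0] k := hu _ (e80 k).
(* The sum dominates every [N0 i] with i <= k, and the summand k makes the indices tend to
   infinity. *)
pose s k := (k + \sum_(i < k.+1) N0 i)%N.
have sN k j : (k <= j)%N -> (N0 k <= s j)%N.
  move=> kj; rewrite /s; apply: leq_trans (leq_addl _ _).
  by rewrite (bigD1 (Ordinal (kj : (k < j.+1)%N))) //= leq_addr.
have hs k i j : (k <= i)%N -> (k <= j)%N -> sqnorm ipL2 (u (s i) - u (s j)) < e8 k.
  by move=> ki kj; apply: hN0; exact: sN.
pose F k x : \bar R := (4 ^+ k * cn (u (s k.+1) x - u (s k) x))%:E.
have F0 k x : D x -> (0 <= F k x)%E by move=> _; rewrite lee_fin mulr_ge0 ?exprn_ge0 ?cn_ge0.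
have rF k : rint (fun x => 4 ^+ k * cn (u (s k.+1) x - u (s k) x)).
  by apply: rintZ => //; exact: (L2_sq (u (s k.+1) - u (s k))).
have mF k : measurable_fun D (F k) by have /integrableP[] := rF k.
have intF k : (\int[mu]_(x in D) F k x <= (2^-1 ^+ k)%:E)%E.
  rewrite /F; under eq_integral do rewrite EFinM.
  have mk : measurable_fun D (fun x => (cn (u (s k.+1) x - u (s k) x))%:E).
    by have /integrableP[] := L2_sq (u (s k.+1) - u (s k)).
  rewrite (ge0_integralZl mu mD mk); first last.
  - by rewrite lee_fin exprn_ge0.
  - by move=> x _; rewrite lee_fin cn_ge0.
  rewrite (nsq_L2E (u (s k.+1) - u (s k))) -EFinM lee_fin.
  have := ltW (hs k _ _ (leqnSn k) (leqnn k)); rewrite -(ler_pM2l (exprn_gt0 k (ltr0n R 4))).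
  by move=> /le_trans; apply; rewrite -exprMn (_ : 4 * 8^-1 = 2^-1) //; field.
have iF : mu.-integrable D (fun x => \sum_(0 <= k <oo) F k x)%E.
  apply/integrableP; split.
    by apply: ge0_emeasurable_sum => // k x Dx _; exact: F0.
  rewrite (eq_integral (fun x => \sum_(0 <= k <oo) F k x)%E); last first.
    by move=> x; rewrite inE => Dx; rewrite gee0_abs // nneseries_ge0 // => k _ _; exact: F0.
  rewrite integral_nneseries //; apply: (@le_lt_trans _ _ 2%:E); last exact: ltry.
  apply: lime_le.
    by apply: is_cvg_nneseries => k _ _; apply: integral_ge0; exact: F0.
  apply: nearW => n; apply: (@le_trans _ _ (\sum_(0 <= k < n) (2^-1 ^+ k)%:E)%E).
    by apply: lee_sum => k _; exact: intF.
  by rewrite sumEFin lee_fin big_mkord sum_half.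
have aeF := integrable_ae mD iF.
have cvgRI x : D x -> (\sum_(0 <= k <oo) F k x)%E \is a fin_num ->
    cvgn (fun k => complex.Re (u (s k) x)) /\ cvgn (fun k => complex.Im (u (s k) x)).
  move=> Dx fx; set C := fine (\sum_(0 <= k <oo) F k x)%E.
  have hC k : 4 ^+ k * cn (u (s k.+1) x - u (s k) x) <= C.
    rewrite -lee_fin fineK //.
    apply: le_trans (nneseries_lim_ge (P := xpredT) k.+1 (fun n _ _ => F0 n x Dx)).
    rewrite big_mkord big_ord_recr /=; apply: leeDr.
    by apply: sume_ge0 => i _; exact: F0.
  have tele (v : nat -> R) : (forall k, (v k.+1 - v k) ^+ 2 * 4 ^+ k <= C) -> cvgn v.
    move=> /fast_series_cvg hv.
    rewrite (_ : v = (fun=> v 0%N) \+ series (fun k => v k.+1 - v k)).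
      by apply: is_cvgD => //; exact: is_cvg_cst.
    by apply/funext => k; rewrite /series /= telescope_sumr // addrC subrK.
  split; apply: tele => k; apply: le_trans (hC k); rewrite mulrC ler_pM2l ?exprn_gt0 //.
    by rewrite -cReN -cReD lerDl sqr_ge0.
  by rewrite -cImN -cImD lerDr sqr_ge0.
(* Upper limits are measurable on all of D and agree with the limit wherever the sequence
   converges. *)
pose fr x := fine (limn_esup (fun k => (complex.Re (u (s k) x))%:E)).
pose fi x := fine (limn_esup (fun k => (complex.Im (u (s k) x))%:E)).
pose f x : R[i] := Complex (fr x) (fi x).
have mf : cmeas f.
  have mfine : measurable_fun [set: \bar R] (@fine R) by exact: fine_measurable.
  split=> /=.
    apply: (measurableT_comp mfine); apply: measurable_fun_limn_esup => k.
    by apply/measurable_EFinP; case: (L2_meas (u (s k))).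
  apply: (measurableT_comp mfine); apply: measurable_fun_limn_esup => k.
  by apply/measurable_EFinP; case: (L2_meas (u (s k))).
have lim_esup (v : nat -> R) : cvgn v -> v @ \oo --> fine (limn_esup (fun k => (v k)%:E)).
  move=> cv; have h : (fun k => (v k)%:E) @ \oo --> (limn v)%:E.
    by apply: cvg_EFin; [exact: nearW|exact: cv].
  by rewrite (cvg_limn_einf_sup h).2.
have aef : {ae mu, forall x, D x -> clim (fun k => u (s k) x) (f x)}.
  apply: filterS aeF => x hx Dx; have [/lim_esup h1 /lim_esup h2] := cvgRI x Dx (hx Dx).
  rewrite /clim (_ : (fun n => _) = fun n =>
    (complex.Re (u (s n) x) - fr x) ^+ 2 + (complex.Im (u (s n) x) - fi x) ^+ 2); last first.
    by apply/funext => n; rewrite /cn cReD cImD cReN cImN.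
  have sq0 (v : nat -> R) l : v @ \oo --> l -> (fun n => (v n - l) ^+ 2) @ \oo --> (0 : R).
    move=> hv; have : (fun n => v n - l) @ \oo --> (0 : R).
      by rewrite -(subrr l); apply: cvgB => //; exact: cvg_cst.
    by move=> hw; rewrite -(mulr0 (0 : R)); under eq_fun do rewrite expr2; exact: cvgM.
  by apply: cvg0D; exact: sq0.
(* Fatou along the subsequence, with m fixed, bounds the distance from f to [u m]. *)
have close k m : (N0 k <= m)%N ->
    (\int[mu]_(x in D) (cn (f x - u m x))%:E <= (e8 k)%:E)%E.
  move=> km.
  have mk j : measurable_fun D (fun x => (cn (u (s j) x - u m x))%:E).
    by have /integrableP[] := L2_sq (u (s j) - u m).
  have mfm : measurable_fun D (fun x => (cn (f x - u m x))%:E).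
    by apply/measurable_EFinP; apply: cmeas_cn; apply: cmeasB => //; exact: L2_meas.
  rewrite (_ : (\int[mu]_(x in D) _ = \int[mu]_(x in D)
      limn_einf (fun j => (cn (u (s j) x - u m x))%:E))%E); last first.
    apply: ae_eq_integral => //; first exact: measurable_fun_limn_einf.
    apply: filterS aef => x hx Dx.
    have h : (fun j => (cn (u (s j) x - u m x))%:E) @ \oo --> (cn (f x - u m x))%:E.
      apply: cvg_EFin; first exact: nearW.
      have h1 : clim (fun j => u (s j) x - u m x) (f x - u m x).
        by apply: climD; [exact: hx|exact: clim_cst].
      have h2 : (fun j => complex.Re (u (s j) x - u m x)) @ \oo --> complex.Re (f x - u m x) :=
        clim_Re h1.
      have h3 : (fun j => complex.Im (u (s j) x - u m x)) @ \oo --> complex.Im (f x - u m x) :=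
        clim_Im h1.
      by apply: cvgD; under eq_fun do rewrite expr2; rewrite expr2; exact: cvgM.
    by rewrite (cvg_limn_einf_sup h).1.
  have mk0 j x : D x -> (0 <= (cn (u (s j) x - u m x))%:E)%E by rewrite lee_fin cn_ge0.
  apply: (le_trans (fatou mu mD mk mk0)).
  apply: (limn_einf_le (N := k)) => j kj; rewrite (nsq_L2E (u (s j) - u m)) lee_fin.
  by apply/ltW/hN0 => //; exact: sN.
have fL2 : f \in L2pred mD.
  have h : (fun x => f x - u (N0 0%N) x) \in L2pred mD.
    have mfu : cmeas (fun x => f x - u (N0 0%N) x) by apply: cmeasB => //; exact: L2_meas.
    apply/L2predP; split => //; apply/integrableP; split.
      by apply/measurable_EFinP; exact: cmeas_cn.
    under eq_integral do rewrite gee0_abs ?lee_fin ?cn_ge0 //.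
    by apply: le_lt_trans (close 0%N _ (leqnn _)) _; exact: ltry.
  have -> : f = (MkL2 h + u (N0 0%N) : L2) by apply/funext => x; rewrite L2D /= subrK.
  exact: (valP (MkL2 h + u (N0 0%N))).
exists (MkL2 fL2); split; last by exists s => // k; rewrite /s leq_addr.
apply/nonneg_cvg0P => [n|e e0].
  by rewrite nsq_L2; apply: Rintegral_ge0 => x _; exact: cn_ge0.
have [k hk] : exists k, e8 k < e.
  have h : (fun k => e8 k) @ \oo --> (0 : R) by apply: cvg_expr; rewrite ger0_norm // invf_lt1 // ltr1n.
  have /cvgrPdist_lt /(_ e e0) [K _ hK] := h; exists K; have := hK K (leqnn K).
  by rewrite sub0r normrN ger0_norm // ltW.
exists (N0 k) => n kn; apply: le_lt_trans hk; rewrite -lee_fin -nsq_L2E.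
apply: le_trans (close k n kn); rewrite le_eqVlt; apply/orP; left; apply/eqP.
by apply: eq_integral => x _; rewrite L2D L2N /= -cnN opprB.
Qed.

Lemma hilbert_L2 : hilbert_form ipL2.
Proof.
split.
- move=> f g h; rewrite /ipL2 -cintegralD //; try exact: L2_cint.
  by congr cintegral; apply/funext => x; rewrite L2D mulrDl.
- move=> a f g; rewrite /ipL2 -cintegralZ //; last exact: L2_cint.
  by congr cintegral; apply/funext => x; rewrite L2Z mulrA.
- move=> f g; rewrite /ipL2 -cintegralJ //; last exact: L2_cint.
  by congr cintegral; apply/funext => x; rewrite rmorphM /= conjCK mulrC.
- move=> f; have E : (fun x => f x * (f x)^*) = fun x => (cn (f x))%:C%C.
    by apply/funext => x; rewrite cnE.
  rewrite /ipL2 E lecE /= (Rintegral_cst mu mD) mul0r eqxx /=.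
  by apply: Rintegral_ge0 => x _; exact: cn_ge0.
- by move=> u /L2_complete [l [h _]]; exists l.
Qed.

End L2_space.

Section direct_sum.
Context (R : realType) (J : finType).
Variables (V : lmodType R[i]) (ip : V -> V -> R[i]) (ipP : hilbert_form ip).

Definition ip_sum (f g : {ffun J -> V}) : R[i] := \sum_j ip (f j) (g j).

Lemma nsq_ip_sum f : sqnorm ip_sum f = \sum_j sqnorm ip (f j).
Proof. by rewrite /sqnorm /ip_sum (raddf_sum (@complex.Re R : Rcomplex R -> R)). Qed.

Lemma cvg0_sum (v : J -> nat -> R) : (forall j, v j @ \oo --> (0 : R)) ->
  (fun n => \sum_j v j n) @ \oo --> (0 : R).
Proof.
move=> hv; elim: (index_enum J) => [|j r IH].
  by rewrite (_ : (fun n => _) = fun=> 0); [exact: cvg_cst|apply/funext => n; rewrite big_nil].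
rewrite (_ : (fun n => _) = fun n => v j n + \sum_(i <- r) v i n); first exact: cvg0D.
by apply/funext => n; rewrite big_cons.
Qed.

Lemma hilbert_sum : hilbert_form ip_sum.
Proof.
split.
- by move=> u v w; rewrite /ip_sum -big_split; apply: eq_bigr => j _; rewrite ffunE (ipDl ipP).
- by move=> a u w; rewrite /ip_sum mulr_sumr; apply: eq_bigr => j _; rewrite ffunE (ipZl ipP).
- by move=> u v; rewrite /ip_sum rmorph_sum; apply: eq_bigr => j _; exact: (ipC ipP).
- by move=> u; apply: sumr_ge0 => j _; exact: (hf_ge0 ipP).
move=> u hu.
have /choice [l hl] j : exists l, hconv ip (fun n => u n j) l.
  apply: (hf_complete ipP) => e /hu [N HN]; exists N => m n Nm Nn.
  apply: le_lt_trans (HN m n Nm Nn); rewrite nsq_ip_sum (bigD1 j) //= !ffunE lerDl.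
  by apply: sumr_ge0 => i _; exact: (nsq_ge0 ipP).
exists [ffun j => l j]; rewrite hconvE.
rewrite (_ : (fun n => _) = fun n => \sum_j sqnorm ip (u n j - l j)); first exact: cvg0_sum.
by apply/funext => n; rewrite nsq_ip_sum; apply: eq_bigr => j _; rewrite !ffunE.
Qed.

End direct_sum.

Section scaled_form.
Context (R : realType) (V : lmodType R[i]) (ip : V -> V -> R[i]) (ipP : hilbert_form ip).
Variables (c : R) (c0 : 0 < c).

Definition ip_scale (u v : V) : R[i] := c%:C%C * ip u v.

Lemma nsq_ip_scale u : sqnorm ip_scale u = c * sqnorm ip u.
Proof. by rewrite /sqnorm /ip_scale cReM /= mul0r subr0. Qed.

Lemma hilbert_scale : hilbert_form ip_scale.
Proof.
split.
- by move=> u v w; rewrite /ip_scale (ipDl ipP) mulrDr.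
- by move=> a u w; rewrite /ip_scale (ipZl ipP) mulrCA.
- by move=> u v; rewrite /ip_scale rmorphM /= conj_real -(ipC ipP).
- by move=> u; rewrite /ip_scale mulr_ge0 ?(hf_ge0 ipP) // ler0c ltW.
move=> u hu; have [l hl] : exists l, hconv ip u l.
  apply: (hf_complete ipP) => e e0; have [N HN] := hu _ (mulr_gt0 c0 e0).
  by exists N => m n Nm Nn; have := HN m n Nm Nn; rewrite nsq_ip_scale ltr_pM2l.
exists l; rewrite hconvE; under eq_fun do rewrite nsq_ip_scale; exact: cvg0Z.
Qed.

End scaled_form.

(** * Fourier coefficients on the circle *)

Section circle_calculus.
Context (R : realType).
Local Notation leb := (@lebesgue_measure R).
Definition circ : set R := `[- pi, pi]%classic.

Lemma mcirc : measurable (circ : set (measurableTypeR R)).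
Proof. exact: measurable_itv. Qed.

Definition crintD := @rintD _ _ _ leb _ mcirc.
Definition crintZ := @rintZ _ _ _ leb _ mcirc.
Definition crintN := @rintN _ _ _ leb _ mcirc.
Definition crint_abs := @rint_abs _ _ _ leb circ.
Definition crint_le := @rint_le _ _ _ leb _ mcirc.
Definition ccint_dom := @cint_dom _ _ _ leb _ mcirc.

Lemma leb_circ : leb circ = (2 * pi)%:E.
Proof.
rewrite /circ lebesgue_measure_itv /= lte_fin gtrN ?pi_gt0 // -EFinB opprK.
by congr EFin; ring.
Qed.

Lemma expiD (a b : R) : expi (a + b) = expi a * expi b.
Proof. by apply/eqP; rewrite eq_complex /= cosD sinD; apply/andP; split; apply/eqP; ring. Qed.

Lemma expiN (a : R) : expi (- a) = (expi a)^*.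
Proof. by rewrite /expi cosN sinN. Qed.

Lemma cn_expi (a : R) : cn (expi a) = 1. Proof. exact: cos2Dsin2. Qed.

Lemma expi_neq0 (a : R) : expi a != 0.
Proof. by apply/eqP => h; have := cn_expi a; rewrite h cn0 => /esym/eqP; rewrite oner_eq0. Qed.

Lemma expiV (a : R) : (expi a)^-1 = (expi a)^*.
Proof. by apply: (mulfI (expi_neq0 a)); rewrite mulfV ?expi_neq0 // cnE cn_expi. Qed.

Lemma expi0 : expi (0 : R) = 1.
Proof. by rewrite /expi cos0 sin0. Qed.

Lemma expiXn (a : R) n : expi a ^+ n = expi (n%:R * a).
Proof.
elim: n => [|n IH]; first by rewrite expr0 mul0r expi0.
by rewrite exprS IH -expiD -nat1r mulrDl mul1r.
Qed.

Lemma expiX (a : R) (k : int) : expi a ^ k = expi (k%:~R * a).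
Proof.
case: k => n; first by rewrite -exprnP expiXn.
by rewrite NegzE -exprnN expiXn expiV -expiN -mulNr rmorphN.
Qed.

Lemma expiXJ (a : R) (k : int) : (expi a ^ k)^* = expi a ^ (- k).
Proof. by rewrite !expiX rmorphN mulNr expiN. Qed.

Lemma expiXD (a : R) (k l : int) : expi a ^ (k + l) = expi a ^ k * expi a ^ l.
Proof. by rewrite expfzDr ?expi_neq0. Qed.

Lemma cn_expiX (a : R) (k : int) : cn (expi a ^ k) = 1.
Proof. by rewrite expiX cn_expi. Qed.

Lemma cont_meas (f : R -> R) (D : set R) : continuous f -> measurable_fun D f.
Proof. by move=> cf; apply: measurable_funTS; exact: continuous_measurable_fun. Qed.

Lemma cmeas_expiX (k : int) (D : set R) : cmeas D (fun a => expi a ^ k).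
Proof.
have hk : continuous (fun a : R => k%:~R * a) by move=> x; exact: mulrl_continuous.
split.
  rewrite (_ : (fun x => _) = fun a => cos (k%:~R * a)); last first.
    by apply/funext => x; rewrite expiX.
  apply: cont_meas => x.
  by apply: (continuous_comp (hk x)); exact: continuous_cos.
rewrite (_ : (fun x => _) = fun a => sin (k%:~R * a)); last first.
  by apply/funext => x; rewrite expiX.
apply: cont_meas => x.
by apply: (continuous_comp (hk x)); exact: continuous_sin.
Qed.

Lemma rint_cst (r : R) : rint leb circ (fun=> r).
Proof.
apply/integrableP; split; first exact: measurable_cst.
by rewrite integral_cst //=; [rewrite leb_circ -EFinM ltry|exact: mcirc].
Qed.

Definition cmean (g : R -> R[i]) : R[i] := ((2 * pi)^-1)%:C%C * cintegral leb circ g.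

Lemma circle_meanE q (f : R[i] -> 'M[R[i]]_q) i j :
  circle_mean f i j = cmean (fun a => f (expi a) i j).
Proof. by rewrite /circle_mean !mxE. Qed.

Lemma cint_bounded (f g : R -> R[i]) (B : R) : cint leb circ f -> cmeas circ g ->
  (forall x, circ x -> cn (g x) <= B) -> cint leb circ (fun x => g x * f x).
Proof.
move=> hf mg gB; have [f1 f2] := hf.
have B0 : 0 <= B.
  by apply: le_trans (gB 0 _); rewrite ?cn_ge0 // /circ /= in_itv /= oppr_le0 pi_ge0.
apply: (@ccint_dom _
  (fun x => (B + 1) * (`|complex.Re (f x)| + `|complex.Im (f x)|))).
- by apply: cmeasM => //; exact: cint_meas hf.
- by apply: crintZ; apply: crintD; exact: crint_abs.
- by move=> x _; rewrite mulr_ge0 ?addr_ge0 // ler_wpDr.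
move=> x Dx; rewrite cnM exprMn; apply: ler_pM; rewrite ?cn_ge0 //.
  by apply: (le_trans (gB x Dx)); nra.
rewrite /cn -(real_normK (num_real (complex.Re (f x)))) -(real_normK (num_real (complex.Im (f x)))).
have := normr_ge0 (complex.Re (f x)); have := normr_ge0 (complex.Im (f x)).
by move: `|_| `|_| => a b ha hb; nra.
Qed.

Lemma cint_expiX k f : cint leb circ f -> cint leb circ (fun x => expi x ^ k * f x).
Proof.
move=> hf; apply: (cint_bounded (B := 1) hf); first exact: cmeas_expiX.
by move=> x _; rewrite cn_expiX.
Qed.

Lemma cint_cst z : cint leb circ (fun=> z).
Proof. by split; exact: rint_cst. Qed.

Lemma cmeanD f g : cint leb circ f -> cint leb circ g ->
  cmean (fun x => f x + g x) = cmean f + cmean g.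
Proof. by move=> hf hg; rewrite /cmean cintegralD ?mulrDr //; exact: mcirc. Qed.

Lemma cmeanZ z f : cint leb circ f -> cmean (fun x => z * f x) = z * cmean f.
Proof. by move=> hf; rewrite /cmean cintegralZ //; [rewrite mulrCA|exact: mcirc]. Qed.

Lemma cmeanJ f : cint leb circ f -> cmean (fun x => (f x)^*) = (cmean f)^*.
Proof.
by move=> hf; rewrite /cmean cintegralJ //; [rewrite rmorphM /= conj_real|exact: mcirc].
Qed.

Lemma cmean_sum (K : Type) (r : seq K) (Q : pred K) (F : K -> R -> R[i]) :
  (forall i, cint leb circ (F i)) ->
  cmean (fun x => \sum_(i <- r | Q i) F i x) = \sum_(i <- r | Q i) cmean (F i).
Proof.
by move=> hF; rewrite /cmean cintegral_sum ?mulr_sumr //; exact: mcirc.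
Qed.

Lemma cmean_ae f g : cmeas circ f -> cmeas circ g ->
  {ae leb, forall x, circ x -> f x = g x} -> cmean f = cmean g.
Proof. by move=> mf mg h; rewrite /cmean (cintegral_ae mcirc mf mg h). Qed.

Lemma twopi_gt0 : 0 < (2 * pi : R). Proof. by rewrite mulr_gt0 // pi_gt0. Qed.

Lemma Rintegral_circ_cst (r : R) : Rintegral leb circ (fun=> r) = r * (2 * pi).
Proof.
have := Rintegral_cst leb mcirc r; have -> : fine (leb circ) = 2 * pi by rewrite leb_circ.
exact.
Qed.

Lemma cmean_cst z : cmean (fun=> z) = z.
Proof.
rewrite /cmean /cintegral /= !Rintegral_circ_cst.
have h : (2 * pi)^-1 * (2 * pi) = 1 :> R by rewrite mulVf // gt_eqF // twopi_gt0.
by case: z => a b; apply/eqP; rewrite eq_complex /=; apply/andP; split; apply/eqP;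
  rewrite mulrCA h; ring.
Qed.

Lemma mulc_continuous k : continuous (fun x : R => k * x).
Proof. by move=> x; exact: mulrl_continuous. Qed.

Lemma Rintegral_deriv (F f : R -> R) : continuous f -> (forall x : R, is_derive x 1 F (f x)) ->
  Rintegral leb circ f = F pi - F (- pi).
Proof.
move=> cf dF; rewrite /Rintegral /circ (@continuous_FTC2 _ _ F) //.
- by rewrite gtrN // pi_gt0.
- exact: continuous_subspaceT.
- have cF x : F @ x --> F x.
    by apply/differentiable_continuous/derivable1_diffP; have [] := dF x.
  split.
  + by move=> x _; have [] := dF x.
  + exact/cvg_at_right_filter/cF.
  + exact/cvg_at_left_filter/cF.
- by move=> x _; rewrite derive1E; have [_ ->] := dF x.
Qed.

Lemma is_derive_mulc (k x : R) : is_derive x (1 : R) (fun y : R => k * y) k.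
Proof.
have : is_derive x (1 : R) (k *: (@idfun R : R -> R)) (k *: (1 : R)) by exact: is_deriveZ.
by rewrite /GRing.scale /= mulr1.
Qed.

Lemma is_derive_scaled_comp (f : R -> R) (df : R) (c k x : R) :
  is_derive (k * x) (1 : R) f df -> is_derive x (1 : R) (fun y => c * f (k * y)) (c * (df * k)).
Proof.
move=> hf; have h1 : is_derive x (1 : R) (f \o (fun y => k * y)) (df * k).
  by apply: is_derive1_comp; exact: is_derive_mulc.
have : is_derive x (1 : R) (c *: (f \o (fun y => k * y))) (c *: (df * k)) by exact: is_deriveZ.
by [].
Qed.

Lemma Rintegral_cos k : k != 0 ->
  Rintegral leb circ (fun x => cos (k * x)) = 2 * sin (k * pi) / k.
Proof.
move=> k0.
have dF (x : R) : is_derive x 1 (fun y => k^-1 * sin (k * y)) (cos (k * x)).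
  have := @is_derive_scaled_comp sin (cos (k * x)) k^-1 k x (is_derive_sin _).
  by rewrite mulrCA mulVf // mulr1.
rewrite (Rintegral_deriv _ dF); first by rewrite mulrN sinN; ring.
by move=> x; apply: (continuous_comp (@mulc_continuous k x)); exact: continuous_cos.
Qed.

Lemma Rintegral_sin k : k != 0 -> Rintegral leb circ (fun x => sin (k * x)) = 0.
Proof.
move=> k0.
have dF (x : R) : is_derive x 1 (fun y => - k^-1 * cos (k * y)) (sin (k * x)).
  have := @is_derive_scaled_comp cos (- sin (k * x)) (- k^-1) k x (is_derive_cos _).
  by rewrite (_ : - k^-1 * (- sin (k * x) * k) = sin (k * x)) //; field.
rewrite (Rintegral_deriv _ dF); first by rewrite mulrN cosN subrr.
by move=> x; apply: (continuous_comp (@mulc_continuous k x)); exact: continuous_sin.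
Qed.

Lemma sin_intpi (k : int) : sin (k%:~R * pi) = 0 :> R.
Proof.
case: k => n.
  elim: n => [|n IH]; first by rewrite mul0r sin0.
  by rewrite -addn1 PoszD intrD mulrDl mul1r sinDpi IH oppr0.
rewrite NegzE rmorphN /= mulNr sinN; apply/eqP; rewrite oppr_eq0; apply/eqP.
elim: n.+1 => [|m IH]; first by rewrite mul0r sin0.
by rewrite -addn1 PoszD intrD mulrDl mul1r sinDpi IH oppr0.
Qed.

Lemma cmean_expiX (k : int) : cmean (fun x => expi x ^ k) = (k == 0)%:R.
Proof.
have [->|k0] := eqVneq k 0; first by under [X in cmean X]eq_fun do rewrite expr0z; rewrite cmean_cst.
have kR : k%:~R != 0 :> R by rewrite intr_eq0.
rewrite (_ : (fun x => _) = fun x => expi (k%:~R * x)); last by apply/funext => x; rewrite expiX.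
by rewrite /cmean /cintegral /= Rintegral_cos // Rintegral_sin // sin_intpi mulr0 mul0r mulr0.
Qed.

End circle_calculus.
Arguments circ {R}.

(** * Invariance of integrals under the reflection of the angle *)

Section change_of_sign.
Context (R : realType).
Local Notation leb := (@lebesgue_measure R).

Lemma circN (x : R) : circ (- x) <-> circ x.
Proof. by rewrite /circ /= !in_itv /= lerN2 lerNl andbC. Qed.

Lemma circ_opp : (-%R : R -> R) @^-1` circ = circ.
Proof. by apply/seteqP; split=> x /circN. Qed.

Lemma measurable_opp : measurable_fun [set: measurableTypeR R] (-%R : measurableTypeR R -> measurableTypeR R).
Proof. exact: oppr_measurable. Qed.

Lemma meas_refl d' (T' : measurableType d') (F : R -> T') :
  measurable_fun (circ : set (measurableTypeR R)) F ->
  measurable_fun (circ : set (measurableTypeR R)) (fun x => F (- x)).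
Proof.
move=> mF; apply: (measurable_comp (F := circ : set (measurableTypeR R)) (@mcirc R) _ mF).
  by move=> _ [x hx <-]; apply/circN.
exact: measurable_funTS measurable_opp.
Qed.

(** Lebesgue measure is its own image under negation. Nonnegative integrands suffice, as
    [Rintegral_refl] splits a real integrand into positive and negative parts. *)
Lemma integral_refl_ge0 (F : R -> \bar R) :
  measurable_fun (circ : set (measurableTypeR R)) F -> (forall x, circ x -> (0 <= F x)%E) ->
  (\int[leb]_(x in circ) F (- x)%R = \int[leb]_(x in circ) F x)%E.
Proof.
move=> mF F0; rewrite -{1}circ_opp.
rewrite -(ge0_integral_pushforward measurable_opp leb (@mcirc R) mF); last first.
  by move=> x; rewrite inE; exact: F0.
by apply: eq_measure_integral => A mA _; exact: lebesgue_measureN.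
Qed.

Lemma Rintegral_refl (g : R -> R) : measurable_fun (circ : set (measurableTypeR R)) g ->
  Rintegral leb circ (fun x => g (- x)) = Rintegral leb circ g.
Proof.
move=> /measurable_EFinP mg; rewrite /Rintegral; congr fine.
rewrite integralE [RHS]integralE; congr (_ - _)%E.
  rewrite -(integral_refl_ge0 (measurable_funepos mg)) => [|x _]; last exact: funepos_ge0.
  by apply: eq_integral => x _; rewrite !funeposE.
rewrite -(integral_refl_ge0 (measurable_funeneg mg)) => [|x _]; last exact: funeneg_ge0.
by apply: eq_integral => x _; rewrite !funenegE.
Qed.

Lemma cmeas_refl (f : R -> R[i]) :
  cmeas (circ : set (measurableTypeR R)) f -> cmeas (circ : set (measurableTypeR R)) (fun x => f (- x)).
Proof.
by move=> [f1 f2]; split; [exact: (meas_refl f1)|exact: (meas_refl f2)].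
Qed.

Lemma cmean_refl (f : R -> R[i]) : cmeas (circ : set (measurableTypeR R)) f ->
  cmean (fun x => f (- x)) = cmean f.
Proof.
move=> [f1 f2]; rewrite /cmean /cintegral; congr (_ * Complex _ _).
  exact: (Rintegral_refl f1).
exact: (Rintegral_refl f2).
Qed.

Lemma ae_refl (Q : R -> Prop) : {ae leb, forall x, circ x -> Q x} ->
  {ae leb, forall x, circ x -> Q (- x)}.
Proof.
move=> [N [mN N0 hN]]; exists (-%R @^-1` N); split.
- by rewrite -[X in measurable X]setTI; exact: measurable_opp.
- by have := lebesgue_measureN mN; rewrite /pushforward => ->.
- move=> x hx; apply: hN => h; apply: hx => Dx; apply: h; exact/circN.
Qed.

End change_of_sign.

(** * Uniqueness of Fourier coefficients for integrable functions *)

Section fourier_uniqueness.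
Context (R : realType).
Local Notation leb := (@lebesgue_measure R).

(** The point of this class is its stability under multiplication by trigonometric polynomials, in
    particular by [bump n] of [level t c x]. *)
Definition annih (f : R -> R[i]) := cint leb circ f /\
  forall k : int, cintegral leb circ (fun x => expi x ^ k * f x) = 0.

Lemma annihD f g : annih f -> annih g -> annih (fun x => f x + g x).
Proof.
move=> [f1 f2] [g1 g2]; split; first exact: (cintD (@mcirc R)).
move=> k; under [X in cintegral _ _ X]eq_fun do rewrite mulrDr.
by rewrite (cintegralD (@mcirc R)) ?f2 ?g2 ?addr0 //; exact: cint_expiX.
Qed.

Lemma annihZ z f : annih f -> annih (fun x => z * f x).
Proof.
move=> [f1 f2]; split; first exact: (cintZ (@mcirc R)).
move=> k; under [X in cintegral _ _ X]eq_fun do rewrite mulrCA.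
by rewrite (cintegralZ (@mcirc R)) ?f2 ?mulr0 //; exact: cint_expiX.
Qed.

Lemma annih_expi m f : annih f -> annih (fun x => expi x ^ m * f x).
Proof.
move=> [f1 f2]; split; first exact: cint_expiX.
by move=> k; under [X in cintegral _ _ X]eq_fun do rewrite mulrA -expiXD; exact: f2.
Qed.

(* A trigonometric polynomial of degree 1 with values in [0, 1] if |c| <= 1; as n
   tends to infinity, bump n (level t c x) tends to the indicator of the arc
   cos (x - t) >= c. *)
Definition level (t c x : R) : R := 2^-1 + (cos (x - t) - c) / 4.

Lemma annih_level t c f : annih f -> annih (fun x => (level t c x)%:C%C * f x).
Proof.
move=> hf.
have h := annihD (annihZ ((2^-1 - c / 4)%:C%C) hf)
  (annihD (annihZ (8^-1%:C%C * expi (- t)) (annih_expi 1 hf))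
          (annihZ (8^-1%:C%C * expi t) (annih_expi (-1) hf))).
rewrite (_ : (fun x => _) = fun x => (2^-1 - c / 4)%:C%C * f x +
  (8^-1%:C%C * expi (- t) * (expi x ^ 1 * f x) +
   8^-1%:C%C * expi t * (expi x ^ (-1) * f x))) //.
apply/funext => x; rewrite !mulrA -!mulrDl; congr (_ * _).
rewrite !expiX mulr1z mulrN1z mul1r mulN1r -!mulrA -!expiD /level cosB.
apply/eqP; rewrite eq_complex /= !cosD !sinD !cosN !sinN; apply/andP; split; apply/eqP.
  by field.
by field.
Qed.

Lemma annih_exp (p : R -> R) :
  (forall f, annih f -> annih (fun x => (p x)%:C%C * f x)) ->
  forall n f, annih f -> annih (fun x => (p x ^+ n)%:C%C * f x).
Proof.
move=> hp; elim=> [|n IH] f hf.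
  by under eq_fun do rewrite expr0 mul1r.
by have := hp _ (IH _ hf); congr annih; apply/funext => x; rewrite exprS rmorphM /= mulrA.
Qed.

Lemma annih_1B (p : R -> R) :
  (forall f, annih f -> annih (fun x => (p x)%:C%C * f x)) ->
  forall f, annih f -> annih (fun x => (1 - p x)%:C%C * f x).
Proof.
move=> hp f hf; have := annihD hf (annihZ (-1) (hp _ hf)); congr annih.
by apply/funext => x; rewrite rmorphB /= mulrBl mul1r mulN1r.
Qed.

(** A polynomial familiar from elementary proofs of the Stone-Weierstrass theorem, with threshold
    1/2: the exponent makes n (2 y)^n decide between small and large, and the factor n settles y =
    1/2, where (2 y)^n stays equal to 1. *)
Definition bump n (y : R) : R := 1 - (1 - y ^+ n) ^+ (n * 2 ^ n).

Lemma annih_bump t c n f : annih f -> annih (fun x => (bump n (level t c x))%:C%C * f x).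
Proof.
apply: annih_1B => {}f; apply: annih_exp => {}f; apply: annih_1B => {}f.
by apply: annih_exp => {}f; exact: annih_level.
Qed.

Lemma bernoulli_ge (a : R) m : 0 <= a -> 1 + m%:R * a <= (1 + a) ^+ m.
Proof.
move=> a0; elim: m => [|m IH]; first by rewrite expr0 mul0r addr0.
rewrite exprS; apply: (@le_trans _ _ ((1 + a) * (1 + m%:R * a))).
  by rewrite -natr1; have : 0 <= m%:R :> R by []; move: m%:R => r hr; nra.
by apply: ler_wpM2l IH; rewrite addr_ge0.
Qed.

Lemma bernoulli_le (a : R) m : 0 <= a <= 1 -> 1 - (1 - a) ^+ m <= m%:R * a.
Proof.
move=> /andP[a0 a1]; elim: m => [|m IH]; first by rewrite expr0 mul0r subrr.
have h0 : 0 <= (1 - a) ^+ m by rewrite exprn_ge0 // subr_ge0.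
have h1 : (1 - a) ^+ m <= 1 by rewrite exprn_ile1 // ?subr_ge0 // gerBl.
rewrite exprS -natr1; move: h0 h1 IH; move: ((1 - a) ^+ m) m%:R => u r *; nra.
Qed.

Lemma bump_bound n (y : R) : 0 <= y <= 1 -> 0 <= bump n y <= 1.
Proof.
move=> /andP[y0 y1]; have h0 : 0 <= 1 - y ^+ n by rewrite subr_ge0 exprn_ile1.
have h1 : 1 - y ^+ n <= 1 by rewrite gerBl exprn_ge0.
by rewrite /bump subr_ge0 gerBl exprn_ile1 //= exprn_ge0.
Qed.

(** With a = y^n and m the outer exponent, the product of (1 - a)^m and (1 + a)^m is at most 1,
    while Bernoulli's inequality gives (1 + a)^m >= 1 + m a >= 1 + n. *)
Lemma bump_high n (y : R) : 2^-1 <= y <= 1 -> 1 - n.+1%:R^-1 <= bump n y.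
Proof.
move=> /andP[y0 y1]; have y0' : 0 <= y by apply: le_trans y0.
rewrite /bump lerD2l lerN2; set a := y ^+ n; set m := (n * 2 ^ n)%N.
have a0 : 0 <= a by rewrite exprn_ge0.
have a1 : a <= 1 by rewrite exprn_ile1.
have h1 : (1 - a) ^+ m * (1 + a) ^+ m <= 1.
  by rewrite -exprMn exprn_ile1 // -?subr_sqr ?expr1n; nra.
have h2 : n.+1%:R <= (1 + a) ^+ m.
  apply: le_trans (bernoulli_ge m a0); rewrite -nat1r lerD2l /m natrM natrX -mulrA -exprMn.
  by rewrite ler_peMr // exprn_ege1 //; lra.
have h3 : 0 <= (1 - a) ^+ m by rewrite exprn_ge0 // subr_ge0.
rewrite -[_^-1]mul1r ler_pdivlMr ?ltr0n //; apply: le_trans h1.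
exact: ler_wpM2l.
Qed.

Lemma bump_low n (y : R) : 0 <= y < 2^-1 -> bump n y <= n%:R * (2 * y) ^+ n.
Proof.
move=> /andP[y0 y1]; rewrite /bump; apply: le_trans (bernoulli_le _ _) _.
  by rewrite exprn_ge0 //= exprn_ile1 //; lra.
by rewrite natrM natrX exprMn mulrA.
Qed.

(** With s the square root of r, n s^n is at most the geometric sum, hence bounded, and the other
    factor s^n tends to 0. *)
Lemma natr_expr_cvg0 (r : R) : 0 <= r < 1 -> (fun n => n%:R * r ^+ n) @ \oo --> (0 : R).
Proof.
move=> /andP[r0 r1]; set s := Num.sqrt r.
have s0 : 0 <= s by exact: sqrtr_ge0.
have ss : s ^+ 2 = r by rewrite sqr_sqrtr.
have s1 : s < 1 by rewrite -sqrtr1 ltr_sqrt.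
have d0 : 0 < 1 - s by rewrite subr_gt0.
have key n : n%:R * s ^+ n <= (1 - s)^-1.
  rewrite -[leRHS]mul1r ler_pdivlMr //.
  have h : n%:R * s ^+ n <= \sum_(k < n) s ^+ k.
    rewrite -[X in X%:R * _](card_ord n) mulr_natl -sumr_const; apply: ler_sum => k _.
    by apply: ler_wiXn2l => //; [exact: ltW|exact/ltnW/ltn_ord].
  have e : (\sum_(k < n) s ^+ k) * (1 - s) = 1 - s ^+ n.
    by rewrite -opprB mulrN mulrC -subrX1 opprB.
  apply: (@le_trans _ _ (1 - s ^+ n)); first by rewrite -e ler_wpM2r // ltW.
  by rewrite gerBl exprn_ge0.
apply: (squeeze0 (v := fun n => (1 - s)^-1 * s ^+ n)) => [n|n|].
- by rewrite mulr_ge0 // exprn_ge0.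
- rewrite -ss -exprM mulnC exprM expr2 mulrA; apply: ler_wpM2r; rewrite ?exprn_ge0 //.
- by apply: cvg0Z; apply: cvg_expr; rewrite ger0_norm.
Qed.

Lemma bump_cvg (y : R) : 0 <= y <= 1 ->
  (fun n => bump n y) @ \oo --> ((2^-1 <= y)%R%:R : R).
Proof.
move=> /andP[y0 y1]; case: (leP 2^-1 y) => hy.
  apply: (@squeeze_cvgr _ _ _ _ (fun n => 1 - n.+1%:R^-1) (fun=> 1)); last exact: cvg_cst.
    by apply: nearW => n; rewrite bump_high ?hy //=; have /andP[] := bump_bound n (introT andP (conj y0 y1)).
  by rewrite -[X in _ --> X]subr0; apply: cvgB; [exact: cvg_cst|exact: cvg_harmonic].
apply: (squeeze0 (v := fun n => n%:R * (2 * y) ^+ n)) => [n|n|].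
- by have /andP[] := bump_bound n (introT andP (conj y0 y1)).
- by apply: bump_low; rewrite y0.
- by apply: natr_expr_cvg0; apply/andP; split; lra.
Qed.

Lemma level_bound t c x : -1 <= c <= 1 -> 0 <= level t c x <= 1.
Proof.
move=> /andP[c0 c1]; rewrite /level; have := cos_le1 (x - t); have := cos_geN1 (x - t).
by move=> *; apply/andP; split; lra.
Qed.

Lemma level_ge t c x : (2^-1 <= level t c x) = (c <= cos (x - t)).
Proof. by rewrite /level lerDl pmulr_lge0 // subr_ge0. Qed.

Lemma meas_level t c : measurable_fun [set: measurableTypeR R] (level t c).
Proof.
apply: cont_meas => x; apply: cvgD; first exact: cvg_cst.
apply: cvgM; last exact: cvg_cst.
apply: cvgB; last exact: cvg_cst.
apply: (continuous_comp (f := fun x => x - t)); last exact: continuous_cos.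
by apply: cvgB; [exact: cvg_id|exact: cvg_cst].
Qed.

Definition cap (t c x : R) : R := (c <= cos (x - t))%R%:R.

(** Dominated convergence: the factors [bump] take values in [0, 1] and tend to the indicator [cap]
    at every point. *)
Lemma Rintegral_cap (g : R -> R) t c : -1 <= c <= 1 -> rint leb circ g ->
  (forall n, Rintegral leb circ (fun x => bump n (level t c x) * g x) = 0) ->
  rint leb circ (fun x => cap t c x * g x) /\
  Rintegral leb circ (fun x => cap t c x * g x) = 0.
Proof.
move=> hc hg h0; have mg := rint_meas hg.
have mb n : measurable_fun (circ : set (measurableTypeR R)) (fun x => bump n (level t c x)).
  apply: measurable_funB; first exact: measurable_cst.
  apply: measurable_funX; apply: measurable_funB; first exact: measurable_cst.
  by apply: measurable_funX; apply: measurable_funTS; exact: meas_level.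
have lim x : (fun n => (bump n (level t c x) * g x)%:E) @ \oo --> (cap t c x * g x)%:E.
  apply: cvg_EFin; first exact: nearW.
  apply: cvgM; last exact: cvg_cst.
  by rewrite /cap -level_ge; apply: bump_cvg; exact: level_bound.
have mf : measurable_fun (circ : set (measurableTypeR R)) (fun x => (cap t c x * g x)%:E).
  rewrite (_ : (fun x => _) = fun x => limn_esup (fun n => (bump n (level t c x) * g x)%:E)).
    apply: measurable_fun_limn_esup => n; apply/measurable_EFinP.
    exact: measurable_funM.
  by apply/funext => x; rewrite (cvg_limn_einf_sup (lim x)).2.
have bb n x : `|bump n (level t c x) * g x| <= `|g x|.
  have /andP[b0 b1] := bump_bound n (level_bound t x hc).
  by rewrite normrM (ger0_norm b0) ler_piMl.
have mbg n : measurable_fun (circ : set (measurableTypeR R))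
    (fun x => (bump n (level t c x) * g x)%:E).
  by apply/measurable_EFinP; exact: (measurable_funM (mb n) mg).
have aelim : {ae leb, forall x, circ x ->
    (fun n => (bump n (level t c x) * g x)%:E) @ \oo --> (cap t c x * g x)%:E}.
  by apply: aeW => x _; exact: lim.
have aeb : {ae leb, forall x, forall n : nat, circ x ->
    (`|(bump n (level t c x) * g x)%:E| <= `|g x|%:E)%E}.
  by apply: aeW => x n _; rewrite /= lee_fin; exact: bb.
have [h1 _ h3] := dominated_convergence (@mcirc R) mbg mf aelim (crint_abs hg) aeb.
split; first exact: h1.
rewrite /Rintegral; have h4 : (fun n => \int[leb]_(x in circ) (bump n (level t c x) * g x)%:E)%E = fun=> 0%E.
  apply/funext => n; rewrite -[LHS]fineK; last first.
    apply: integrable_fin_num; first exact: mcirc.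
    exact: (crint_le (measurable_funM (mb n) mg) (crint_abs hg) (fun x _ => bb n x)).
  by rewrite [fine _](h0 n).
have h5 : (fun=> 0%E : \bar R) @ \oo --> (\int[leb]_(x in circ) (cap t c x * g x)%:E)%E.
  by move: h3; rewrite -h4; exact.
by rewrite [X in fine X](_ : _ = 0%E) //; apply: (cvg_unique _ h5) => //; exact: cvg_cst.
Qed.

Lemma cos_cap (x y : R) : - pi <= x < pi -> - pi <= y < pi ->
  (cos ((x + pi) / 2) <= cos (y - (x - pi) / 2)) = (y <= x).
Proof.
move=> /andP[x0 x1] /andP[y0 y1]; set dl := (x + pi) / 2; set u := y - (x - pi) / 2.
have dI : dl \in `[0, pi] by rewrite in_itv /= /dl; apply/andP; split; lra.
case: (leP y x) => yx.
  have uI : `|u| \in `[0, pi].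
    by rewrite in_itv /= normr_ge0 ler_norml /u; apply/andP; split; lra.
  have -> : cos u = cos `|u| by case: (ger0P u); rewrite ?cosN.
  by rewrite leNgt ltr_cos // -leNgt ler_norml /u /dl; apply/andP; split; lra.
have u0 : dl < u by rewrite /u /dl; lra.
apply/negbTE; rewrite -ltNge; case: (leP u pi) => upi.
  by rewrite ltr_cos // in_itv /= upi andbT; apply: le_trans (ltW u0); case/andP: dI.
(* Beyond pi the distance is measured the other way round the circle. *)
have -> : cos u = cos (2 * pi - u).
  by rewrite mulr_natl addrC cosD2pi cosN.
have uI : 2 * pi - u \in `[0, pi] by rewrite in_itv /=; move: upi; rewrite /u => upi; apply/andP; split; lra.
by rewrite ltr_cos // /u /dl; lra.
Qed.

(** Arcs that start at -pi give a vanishing primitive for g extended by 0; Lebesgue differentiation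
    then recovers g almost everywhere. *)
Lemma Rintegral_eq0_ae (g : R -> R) : rint leb circ g ->
  (forall t c n, Rintegral leb circ (fun x => bump n (level t c x) * g x) = 0) ->
  {ae leb, forall x, circ x -> g x = 0}.
Proof.
move=> hg h0; pose G := g \_ circ.
have hG : leb.-integrable [set: measurableTypeR R] (EFin \o G).
  rewrite /G -restrict_EFin; apply/(integrable_mkcond _ (@mcirc R)); exact: hg.
have lG : locally_integrable [set: R] G by apply: integrable_locally; [exact: mcirc|exact: hg].
have hGy (y : R) : leb.-integrable `]-oo, y] (EFin \o G).
  by apply: (integrableS measurableT _ _ hG) => //; exact: measurable_itv.
have cap0 t c : -1 <= c <= 1 -> Rintegral leb circ (fun x => cap t c x * g x) = 0.
  by move=> hc; have [_ ->] := Rintegral_cap (t := t) hc hg (h0 t c).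
have F0 (x : R) : Rintegral leb `]-oo, x] G = 0.
  have sub t c : -1 <= c <= 1 ->
      (forall y, - pi <= y < pi -> (c <= cos (y - t)) = (y <= x)) -> Rintegral leb `]-oo, x] G = 0.
    move=> hc hy; rewrite -(cap0 t c hc) Rintegral_mkcond [RHS]Rintegral_mkcond.
    have hcap := (Rintegral_cap hc hg (h0 t c)).1.
    apply: (Rintegral_ae (D := setT)) => //.
    - apply/(measurable_restrictT _ _).1; first exact: measurable_itv.
      by apply/measurable_EFinP; have /integrableP[] := hGy x.
    - apply/(measurable_restrictT _ _).1; first exact: mcirc.
      exact: rint_meas hcap.
    (* The cap and the half-line can disagree only at pi, a null set. *)
    exists [set pi : R]; split; [exact: measurable_set1|exact: lebesgue_measure_set1|].
    move=> y /= h; apply: contrapT => ypi; apply: h => _.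
    have E1 : (y \in (`]-oo, x]%classic : set R)) = (y <= x) by rewrite mem_setE in_itv.
    have E2 : (y \in (circ : set R)) = (- pi <= y <= pi) by rewrite mem_setE in_itv.
    rewrite /G /patch E1 E2; case: ifPn => [|hyx].
      case: ifPn => // /andP[c1 c2] hyx; rewrite /cap hy ?hyx ?mul1r // c1 lt_neqAle c2 andbT.
      exact/eqP.
    case: ifPn => // /andP[c1 c2]; rewrite /cap hy ?(negbTE hyx) ?mul0r // c1 lt_neqAle c2 andbT.
    exact/eqP.
  have [x0|x0] := ltP x (- pi).
    transitivity (Rintegral leb `]-oo, x] (fun=> 0)).
      apply: eq_Rintegral => y; rewrite inE /= in_itv /= => yx.
      rewrite /G /patch; case: ifPn => //; rewrite inE /circ /= in_itv /= => /andP[y0 _].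
      by have := le_lt_trans (le_trans y0 yx) x0; rewrite ltxx.
    by rewrite Rintegral_cst ?mul0r //; exact: measurable_itv.
  have [x1|x1] := ltP x pi; last first.
    (* With c = -1 the cap is the whole circle, which settles x >= pi. *)
    apply: (sub 0 (-1)); first by rewrite lexx /=; lra.
    move=> y /andP[_ ypi]; rewrite cos_geN1; apply/esym/ltW; exact: lt_le_trans x1.
  apply: (sub ((x - pi) / 2) (cos ((x + pi) / 2))).
    by rewrite cos_geN1 cos_le1.
  by move=> y hy; apply: cos_cap => //; rewrite x0.
have [N [mN N0 hN]] := FTC1Ny hGy lG; exists N; split => // x hx; apply: hN => -[_ hG'].
apply: hx => Dx; have : G x = 0.
  rewrite -hG' (_ : (fun y => _) = fun=> 0); last by apply/funext => y; exact: F0.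
  by rewrite derive1_cst.
by rewrite /G /patch mem_set.
Qed.

(** The multipliers [bump] are real, so the real and imaginary parts of f are annihilated separately
    and the real case applies to each. *)
Theorem fourier_uniqueness (f : R -> R[i]) : cint leb circ f ->
  (forall k : int, cmean (fun x => expi x ^ k * f x) = 0) ->
  {ae leb, forall x, circ x -> f x = 0}.
Proof.
move=> hf h; have hc : 0 < (2 * pi)^-1 :> R by rewrite invr_gt0 twopi_gt0.
have hA : annih f.
  split => // k; apply/eqP; have := h k => /eqP; rewrite /cmean mulf_eq0 => /orP[|//].
  by rewrite (inj_eq (@complexI R) _ 0) gt_eqF.
have hb t c n : cintegral leb circ (fun x => (bump n (level t c x))%:C%C * f x) = 0.
  have [_ /(_ 0)] := annih_bump t c n hA.
  by under [X in cintegral _ _ X]eq_fun do rewrite expr0z mul1r.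
have hre : {ae leb, forall x, circ x -> complex.Re (f x) = 0}.
  apply: Rintegral_eq0_ae; first by case: hf.
  move=> t c n; have := congr1 (@complex.Re R) (hb t c n); rewrite /cintegral /=.
  by under [in LHS]eq_Rintegral do rewrite cReM /= mul0r subr0.
have him : {ae leb, forall x, circ x -> complex.Im (f x) = 0}.
  apply: Rintegral_eq0_ae; first by case: hf.
  move=> t c n; have := congr1 (@complex.Im R) (hb t c n); rewrite /cintegral /=.
  by under [in LHS]eq_Rintegral do rewrite cImM /= mul0r addr0.
apply: aeS2 hre him => x h1 h2 Dx; have := h1 Dx; have := h2 Dx.
by case: (f x) => a b /= -> ->.
Qed.

End fourier_uniqueness.

Section fatou_bound.
Context d (T : measurableType d) (R : realType) (mu : {measure set T -> \bar R}).
Variables (D : set T) (mD : measurable D).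

(** Integrability of the limit g belongs to the conclusion: for ln |1 - b z| with |b| = 1 it is not
    known beforehand. *)
Lemma fatou_bound (u : nat -> T -> R) (g : T -> R) (C : R) :
  (forall k, rint mu D (u k)) -> (forall k x, D x -> 0 <= u k x) ->
  (forall k, Rintegral mu D (u k) <= C) ->
  measurable_fun D g -> (forall x, D x -> 0 <= g x) ->
  {ae mu, forall x, D x -> (fun k => u k x) @ \oo --> g x} ->
  rint mu D g /\ Rintegral mu D g <= C.
Proof.
move=> ru u0 uC mg g0 ug.
have mu' k : measurable_fun D (fun x => (u k x)%:E) by have /integrableP[] := ru k.
have mg' : measurable_fun D (fun x => (g x)%:E) by exact/measurable_EFinP.
have u0' k x : D x -> (0 <= (u k x)%:E)%E by move=> Dx; rewrite lee_fin u0.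
have h : (\int[mu]_(x in D) (g x)%:E <= C%:E)%E.
  rewrite (_ : (\int[mu]_(x in D) _ = \int[mu]_(x in D) limn_einf (fun k => (u k x)%:E))%E).
    apply: (le_trans (fatou mu mD mu' u0')); apply: (limn_einf_le (N := 0%N)) => k _.
    have -> : (\int[mu]_(x in D) (u k x)%:E = (Rintegral mu D (u k))%:E)%E.
      by rewrite /Rintegral fineK //; apply: integrable_fin_num => //; exact: ru.
    by rewrite lee_fin uC.
  apply: ae_eq_integral => //; first exact: measurable_fun_limn_einf.
  apply: aeS1 ug => x hx Dx.
  have h : (fun k => (u k x)%:E) @ \oo --> (g x)%:E by apply: cvg_EFin; [exact: nearW|exact: hx].
  by rewrite (cvg_limn_einf_sup h).1.
have rg : rint mu D g.
  apply/integrableP; split => //; rewrite (eq_integral (fun x => (g x)%:E)) => [|x].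
    by apply: le_lt_trans h _; exact: ltry.
  by rewrite inE => Dx; rewrite gee0_abs // lee_fin g0.
split => //; rewrite -lee_fin; apply: le_trans h.
by rewrite /Rintegral fineK //; apply: integrable_fin_num.
Qed.

End fatou_bound.

(** * Jensen's inequality *)

Section log_factor.
Context (R : realType).
Local Notation leb := (@lebesgue_measure R).
Implicit Types (w z b r : R[i]).

(* 2 ln |z|; the junk value at z = 0 is 0 *)
Definition lncn z : R := ln (cn z).

Lemma lncnM z w : z != 0 -> w != 0 -> lncn (z * w) = lncn z + lncn w.
Proof.
have pos u : u != 0 -> cn u \is Num.pos.
  by move=> u0; rewrite posrE lt_def cn_ge0 andbT; apply: contra u0 => /eqP/cn_eq0 ->.
by move=> z0 w0; rewrite /lncn cnM lnM ?pos.
Qed.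

(** Partial sum of the power series of -log (1 - w). Only real parts are compared, so no branch of
    the complex logarithm has to be chosen. *)
Definition log_poly K w : R[i] := \sum_(k < K) (k.+1%:R)^-1 * w ^+ k.+1.

Lemma cn1B_gt0 w : cn w < 1 -> 0 < cn (1 - w).
Proof.
move=> w1; rewrite lt_def cn_ge0 andbT; apply/eqP => /cn_eq0/subr0_eq h.
by move: w1; rewrite -h (cn_real 1) expr1n ltxx.
Qed.

Lemma cn1B_ge w (rho : R) : 0 <= rho -> cn w <= rho ^+ 2 -> rho <= 1 -> (1 - rho) ^+ 2 <= cn (1 - w).
Proof.
case: w => a b; rewrite /cn /= => r0 h r1.
have ha : `|a| <= rho by apply: normr_le_sqr => //; apply: le_trans h; rewrite lerDl sqr_ge0.
have := ler_norm a; have := sqr_ge0 b; nra.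
Qed.

(** Mean value theorem along the segment from 0 to w: the derivative in t of ln |1 - t w|^2 plus
    twice the real part of [log_poly K] at t w is the remainder of a geometric series, namely -2 Re
    (w (t w)^K / (1 - t w)). *)
Lemma log_approx K w (rho : R) : 0 <= rho < 1 -> cn w <= rho ^+ 2 ->
  `|lncn (1 - w) + 2 * complex.Re (log_poly K w)| <= 2 * rho ^+ K / (1 - rho).
Proof.
move=> /andP[r0 r1] hw; case: w hw => a b hw.
(* Along the segment, |1 - t w|^2 and the partial sum are real polynomials in t, which makes
   differentiation formal. *)
pose Q : {poly R} := 1 - (2 * a) *: 'X + (a ^+ 2 + b ^+ 2) *: 'X^2.
pose P : {poly R} := \sum_(k < K) (2 * complex.Re (Complex a b ^+ k.+1) / k.+1%:R) *: 'X^(k.+1).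
have QE t : Q.[t] = cn (1 - t%:C%C * Complex a b).
  by rewrite /Q !hornerE /cn /=; ring.
have PE t : P.[t] = 2 * complex.Re (log_poly K (t%:C%C * Complex a b)).
  rewrite /P /log_poly (raddf_sum (@complex.Re R : Rcomplex R -> R)) mulr_sumr horner_sum.
  apply: eq_bigr => k _; rewrite hornerZ hornerXn exprMn -rmorphXn /=.
  rewrite -(rmorph_nat (real_complex R)) -fmorphV mulrA -rmorphM /= cReM /= mul0r subr0.
  by rewrite !mulrA; field; rewrite nat1r pnatr_eq0.
have cnt t : 0 <= t <= 1 -> cn (t%:C%C * Complex a b) <= rho ^+ 2.
  move=> /andP[t0 t1]; rewrite cnM cn_real; apply: le_trans hw.
  by rewrite ler_piMl ?cn_ge0 // exprn_ile1.
have r21 : rho ^+ 2 < 1 by rewrite expr_lt1.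
have Qpos t : 0 <= t <= 1 -> 0 < Q.[t].
  by move=> ht; rewrite QE cn1B_gt0 // (le_lt_trans (cnt t ht)).
have dG (t : R) : 0 <= t <= 1 ->
    is_derive t (1 : R) (fun t : R => ln Q.[t] + P.[t]) ((Q.[t])^-1 * Q^`().[t] + P^`().[t]).
  move=> ht; have h1 : is_derive t (1 : R) (@ln R \o horner Q) ((Q.[t])^-1 * Q^`().[t]).
    by apply: is_derive1_comp; exact: is_derive1_ln (Qpos t ht).
  have h2 := is_derive_poly P t.
  exact: (is_deriveD h1 h2).
have dGE t : 0 <= t <= 1 -> (Q.[t])^-1 * Q^`().[t] + P^`().[t] =
    - 2 * complex.Re (Complex a b * (t%:C%C * Complex a b) ^+ K / (1 - t%:C%C * Complex a b)).
  move=> ht; have q0 : Q.[t] != 0 by rewrite gt_eqF // Qpos.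
  have z0 : 1 - t%:C%C * Complex a b != 0.
    by apply/eqP => h; move: q0; rewrite QE h cn0 eqxx.
  have -> : P^`().[t] = 2 * complex.Re (Complex a b * \sum_(k < K) (t%:C%C * Complex a b) ^+ k).
    rewrite /P raddf_sum /= horner_sum mulr_sumr (raddf_sum (@complex.Re R : Rcomplex R -> R)) mulr_sumr.
    apply: eq_bigr => k _; rewrite derivZ derivXn hornerZ hornerMn hornerXn /=.
    rewrite exprMn -rmorphXn /= mulrCA -exprS cReM /= mul0r subr0 -mulr_natr.
    by field; rewrite nat1r pnatr_eq0.
  have geo : \sum_(k < K) (t%:C%C * Complex a b) ^+ k =
      (1 - (t%:C%C * Complex a b) ^+ K) / (1 - t%:C%C * Complex a b).
    apply: (mulIf z0); rewrite mulfVK // -opprB mulrN mulrC -subrX1 opprB //.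
  rewrite geo; set u := (t%:C%C * Complex a b) ^+ K.
  have inv : (1 - t%:C%C * Complex a b)^-1 = (Q.[t])^-1%:C%C * (1 - t%:C%C * Complex a b)^*.
    apply: (mulfI z0); rewrite mulfV // mulrCA cnE -QE -rmorphM /= mulVf //.
  have -> : (Q.[t])^-1 * Q^`().[t] =
      - 2 * complex.Re (Complex a b / (1 - t%:C%C * Complex a b)).
    rewrite inv mulrCA cReM /=; move: (Q.[t])^-1 => X.
    rewrite /Q !derivD -polyC1 !derivC derivN !derivZ derivX derivXn /= !hornerE /=; ring.
  have -> : Complex a b * ((1 - u) / (1 - t%:C%C * Complex a b)) =
    Complex a b / (1 - t%:C%C * Complex a b) - Complex a b * u / (1 - t%:C%C * Complex a b).
    by field.
  rewrite cReD cReN; ring.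
have dGi (t : R) : t \in `]0, 1[ ->
    is_derive t (1 : R) (fun t : R => ln Q.[t] + P.[t]) ((Q.[t])^-1 * Q^`().[t] + P^`().[t]).
  by rewrite in_itv /= => /andP[/ltW h0 /ltW h1]; apply: dG; rewrite h0.
have cG : {within `[0, 1], continuous (fun t : R => ln Q.[t] + P.[t])}.
  apply: derivable_within_continuous => t; rewrite in_itv /= => ht.
  by have [] := dG t ht.
have [c cI hc] := MVT ltr01 dGi cG.
have c01 : 0 <= c <= 1 by move: cI; rewrite in_itv /= => /andP[/ltW -> /ltW ->].
have G0 : ln Q.[0] + P.[0] = 0.
  rewrite QE PE mul0r subr0 (cn_real 1) expr1n ln1 add0r /log_poly big1 ?mulr0 // => k _.
  by rewrite expr0n /= mulr0.
move: hc; rewrite G0 !subr0 mulr1 QE PE mul1r /lncn => ->.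
rewrite dGE // normrM normrN (ger0_norm (ler0n _ 2)) -(mulrA 2); apply: ler_wpM2l => //.
apply: normr_le_sqr; first by rewrite divr_ge0 ?exprn_ge0 // subr_ge0 ltW.
set z := (X in complex.Re X); apply: (@le_trans _ _ (cn z)); first by rewrite lerDl sqr_ge0.
have cnV u : u != 0 -> cn u^-1 = (cn u)^-1.
  move=> u0; have nu : cn u != 0 by apply: contra u0 => /eqP/cn_eq0 ->.
  by apply: (mulfI nu); rewrite -cnM !mulfV // (cn_real 1) expr1n.
have cnX u n : cn (u ^+ n) = cn u ^+ n.
  by elim: n => [|n IH]; rewrite ?expr0 ?(cn_real 1) ?expr1n // !exprS cnM IH.
have z0 : 1 - c%:C%C * Complex a b != 0.
  by apply/eqP => h; have := Qpos c c01; rewrite QE h cn0 ltxx.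
have d0 : 0 < (1 - rho) ^+ 2 by rewrite exprn_gt0 // subr_gt0.
have hd := cn1B_ge r0 (cnt c c01) (ltW r1).
rewrite /z cnM cnV // cnM cnX expr_div_n.
apply: ler_pM.
- by rewrite mulr_ge0 ?exprn_ge0 ?cn_ge0.
- by rewrite invr_ge0 cn_ge0.
- rewrite -exprM mulnC exprM -[leRHS]mul1r; apply: ler_pM; rewrite ?cn_ge0 ?exprn_ge0 ?cn_ge0 //.
    by apply: le_trans hw _; exact: ltW.
  by apply: lerXn2r; rewrite ?nnegrE ?cn_ge0 ?sqr_ge0 // cnt.
- by rewrite lef_pV2 ?posrE // (lt_le_trans d0).
Qed.

End log_factor.

Section jensen_polynomial.
Context (R : realType).
Local Notation leb := (@lebesgue_measure R).
Implicit Types (w z b r : R[i]).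

Lemma ae_expi_neq r : {ae leb, forall x, circ x -> expi x != r}.
Proof.
pose N : set R := [set acos (complex.Re r)] `|` [set - acos (complex.Re r)].
exists N; split.
- by apply: measurableU; exact: measurable_set1.
- by apply: countable_lebesgue_measure0; apply: finite_set_countable; exact: finite_set2.
move=> x /= hx; apply: contrapT => hN; apply: hx; rewrite /circ /= in_itv /= => /andP[x0 x1].
apply/eqP => hr; apply: hN; rewrite /N -hr /=.
case: (leP 0 x) => hx; first by left; rewrite cosK // in_itv /= hx.
right; rewrite -cosN cosK ?opprK // in_itv /=; apply/andP; split; lra.
Qed.

Lemma cmeas_expi (D : set R) : cmeas (D : set (measurableTypeR R)) (fun x : R => expi x).
Proof.
have := @cmeas_expiX R 1 D; rewrite (_ : (fun a => _) = fun x => expi x) //.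
Qed.

Lemma meas_lncn (D : set R) (f : R -> R[i]) : cmeas (D : set (measurableTypeR R)) f ->
  measurable_fun (D : set (measurableTypeR R)) (fun x => lncn (f x)).
Proof. by move=> /cmeas_cn mf; apply: (measurableT_comp (@measurable_ln R)). Qed.

Lemma cmeas_factor (D : set R) b : cmeas (D : set (measurableTypeR R)) (fun x => 1 - b * expi x).
Proof.
apply: cmeasB; first exact: cmeas_cst.
by apply: cmeasM; [exact: cmeas_cst|exact: cmeas_expi].
Qed.

Lemma cnX z n : cn (z ^+ n) = cn z ^+ n.
Proof. by elim: n => [|n IH]; rewrite ?expr0 ?(cn_real 1) ?expr1n // !exprS cnM IH. Qed.

Lemma cn1B_le z : cn z <= 1 -> cn (1 - z) <= 4.
Proof.
move=> h; apply: (le_trans (cnD_le _ _)); rewrite cnN (cn_real 1) expr1n; lra.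
Qed.

Lemma log_poly_mean K b : Rintegral leb circ (fun x => 2 * complex.Re (log_poly K (b * expi x))) = 0.
Proof.
have E x : log_poly K (b * expi x) = \sum_(k < K) (k.+1%:R^-1 * b ^+ k.+1) * expi x ^ (k.+1 : int).
  by apply: eq_bigr => k _; rewrite exprMn mulrA -exprnP.
have hc (k : 'I_K) : cint leb circ (fun x => (k.+1%:R^-1 * b ^+ k.+1) * expi x ^ (k.+1 : int)).
  apply: (cintZ (@mcirc R)); have := @cint_expiX R k.+1 _ (@cint_cst R 1).
  by under [X in cint _ _ X -> _]eq_fun do rewrite mulr1.
have h : cintegral leb circ (fun x => log_poly K (b * expi x)) = 0.
  under [X in cintegral _ _ X]eq_fun do rewrite E.
  rewrite (cintegral_sum (@mcirc R)) // big1 // => k _.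
  rewrite (cintegralZ (@mcirc R)); last first.
    have := @cint_expiX R k.+1 _ (@cint_cst R 1).
    by under [X in cint _ _ X -> _]eq_fun do rewrite mulr1.
  have := @cmean_expiX R k.+1; rewrite /cmean => /eqP.
  rewrite mulf_eq0 (inj_eq (@complexI R) _ 0) gt_eqF ?invr_gt0 ?twopi_gt0 //= => /eqP ->.
  by rewrite mulr0.
have hs : cint leb circ (fun x => log_poly K (b * expi x)).
  under [X in cint _ _ X]eq_fun do rewrite E.
  exact: (cint_sum (@mcirc R)).
rewrite (RintegralZl _ (@mcirc R)); last by case: hs.
by have := congr1 (@complex.Re R) h; rewrite /cintegral /= => ->; rewrite mulr0.
Qed.

Lemma rint_log_poly K b : rint leb circ (fun x => 2 * complex.Re (log_poly K (b * expi x))).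
Proof.
have hs : cint leb circ (fun x => log_poly K (b * expi x)).
  rewrite (_ : (fun x => _) = fun x => \sum_(k < K) (k.+1%:R^-1 * b ^+ k.+1) * (expi x ^ (k.+1 : int) * 1)).
    apply: (cint_sum (@mcirc R)) => k; apply: (cintZ (@mcirc R)).
    by apply: cint_expiX; exact: cint_cst.
  by apply/funext => x; apply: eq_bigr => k _; rewrite mulr1 exprMn mulrA -exprnP.
by apply: crintZ; case: hs.
Qed.

(** As [log_poly] has no constant term, its mean vanishes; the integral therefore equals that of the
    error in [log_approx], which is of order rho^K for every K. *)
Lemma log_factor_mean b : cn b < 1 ->
  rint leb circ (fun x => lncn (1 - b * expi x)) /\
  Rintegral leb circ (fun x => lncn (1 - b * expi x)) = 0.
Proof.
move=> b1; set rho := Num.sqrt (cn b).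
have r0 : 0 <= rho by exact: sqrtr_ge0.
have r2 : rho ^+ 2 = cn b by rewrite sqr_sqrtr // cn_ge0.
have r1 : rho < 1 by rewrite -sqrtr1 ltr_sqrt.
have hw x : cn (b * expi x) <= rho ^+ 2 by rewrite cnM cn_expi mulr1 r2.
have r01 : 0 <= rho < 1 by rewrite r0.
have hI : rint leb circ (fun x => lncn (1 - b * expi x)).
  apply: (crint_le (meas_lncn (cmeas_factor _ b)) (rint_cst (2 * rho ^+ 0 / (1 - rho)))) => x _.
  have := log_approx 0 r01 (hw x); rewrite /log_poly big_ord0 /= mulr0 addr0; exact.
split => //; apply/eqP; rewrite -normr_eq0; apply/eqP/le_anti; rewrite normr_ge0 andbT.
have bound K : `|Rintegral leb circ (fun x => lncn (1 - b * expi x))| <=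
    (2 / (1 - rho) * (2 * pi)) * rho ^+ K.
  have -> : Rintegral leb circ (fun x => lncn (1 - b * expi x)) =
    Rintegral leb circ (fun x => lncn (1 - b * expi x) + 2 * complex.Re (log_poly K (b * expi x))).
    by rewrite (RintegralD (@mcirc R) hI (rint_log_poly K b)) log_poly_mean addr0.
  apply: (le_trans (le_normr_Rintegral (@mcirc R) (crintD hI (rint_log_poly K b)))).
  have -> : 2 / (1 - rho) * (2 * pi) * rho ^+ K = Rintegral leb circ (fun=> 2 * rho ^+ K / (1 - rho)).
    by rewrite Rintegral_circ_cst; ring.
  apply: (le_Rintegral (@mcirc R)).
  - exact: (crint_abs (crintD hI (rint_log_poly K b))).
  - exact: rint_cst.
  - by move=> x _; exact: log_approx.
have lim0 : (fun K => (2 / (1 - rho) * (2 * pi)) * rho ^+ K) @ \oo --> (0 : R).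
  by apply: cvg0Z; apply: cvg_expr; rewrite ger0_norm.
by apply: (ler_cvg_to (cvg_cst _) lim0); apply: nearW.
Qed.

(** The point b is replaced by r_k b inside the disk, where the mean is 0. Fatou's lemma carries
    this to |b| = 1 as an inequality, which is all that Jensen's inequality requires. *)
Lemma log_factor_ge0 b : cn b <= 1 ->
  rint leb circ (fun x => lncn (1 - b * expi x)) /\
  0 <= Rintegral leb circ (fun x => lncn (1 - b * expi x)).
Proof.
move=> b1; have [b0|b0] := eqVneq b 0.
  have [] := @log_factor_mean b; first by rewrite b0 cn0.
  by move=> ? ->.
pose r (k : nat) : R := 1 - k.+1%:R^-1.
have r01 k : 0 <= r k < 1.
  by rewrite /r subr_ge0 invf_le1 ?ler1n ?ltr0n //= gtrDl oppr_lt0 invr_gt0 ltr0n.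
have rb k : cn ((r k)%:C%C * b) < 1.
  have /andP[h0 h1] := r01 k; rewrite cnM cn_real.
  apply: le_lt_trans (_ : r k ^+ 2 < 1); last by rewrite expr_lt1.
  by rewrite ler_piMr // sqr_ge0.
(* On the closed disk |1 - z|^2 <= 4, so subtracting from ln 4 produces the nonnegative functions
   that Fatou's lemma asks for. *)
pose u k x := ln 4 - lncn (1 - ((r k)%:C%C * b) * expi x).
have pos4 z : cn z <= 1 -> 0 <= ln 4 - lncn (1 - z).
  (* At z = 1 the convention ln 0 = 0 still leaves a nonnegative difference. *)
  move=> hz; rewrite subr_ge0 /lncn; have [->|n0] := eqVneq (cn (1 - z)) 0.
    by rewrite ln0 // ln_ge0 // ler1n.
  by rewrite ler_ln ?posrE // ?cn1B_le // lt_def n0 cn_ge0.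
have cz (c : R[i]) (x : R) : cn c <= 1 -> cn (c * expi x) <= 1 by rewrite cnM cn_expi mulr1.
have ru k : rint leb circ (u k).
  have [h _] := log_factor_mean (rb k).
  by have := crintD (rint_cst (ln 4)) (crintN h).
have mg : measurable_fun (circ : set (measurableTypeR R)) (fun x => ln 4 - lncn (1 - b * expi x)).
  by apply: measurable_funB; [exact: measurable_cst|exact: (meas_lncn (cmeas_factor _ b))].
have uC k : Rintegral leb circ (u k) <= ln 4 * (2 * pi).
  have [h h0] := log_factor_mean (rb k).
  by rewrite /u (RintegralB (@mcirc R) (rint_cst (ln 4)) h) h0 subr0 Rintegral_circ_cst.
have lim : {ae leb, forall x, circ x ->
    (fun k => u k x) @ \oo --> ln 4 - lncn (1 - b * expi x)}.
  apply: aeS1 (@ae_expi_neq b^-1) => x hx Dx; have nb := hx Dx.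
  apply: cvgB; first exact: cvg_cst.
  have n0 : 1 - b * expi x != 0.
    apply: contra nb => /eqP/subr0_eq h; apply/eqP.
    by apply: (mulfI b0); rewrite -h mulfV.
  have p0 : 0 < cn (1 - b * expi x).
    by rewrite lt_def cn_ge0 andbT; apply: contra n0 => /eqP/cn_eq0 ->.
  apply: (cvg_comp (fun k => cn (1 - (r k)%:C%C * b * expi x)) (@ln R)); last exact: continuous_ln.
  have hr : r @ \oo --> (1 : R).
    by rewrite -[X in _ --> X]subr0; apply: cvgB; [exact: cvg_cst|exact: cvg_harmonic].
  have rc : clim (fun k => (r k)%:C%C) 1.
    rewrite /clim (_ : (fun n => _) = fun n => (r n - 1) * (r n - 1)); last first.
      by apply/funext => n; rewrite -(rmorph1 (real_complex R)) -rmorphB cn_real expr2.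
    rewrite -(mulr0 (0 : R)); apply: cvgM; rewrite -(subrr (1 : R)); apply: cvgB => //; exact: cvg_cst.
  have h1 : clim (fun k => 1 - (r k)%:C%C * b * expi x) (1 - b * expi x).
    apply: climD; first exact: clim_cst.
    have := climZ (- (b * expi x)) rc; rewrite mulr1; apply: clim_eq => k.
    by rewrite mulNr -mulrA mulrC.
  by apply: cvgD; under eq_fun do rewrite expr2; rewrite expr2; apply: cvgM;
    [exact: (clim_Re h1)|exact: (clim_Re h1)|exact: (clim_Im h1)|exact: (clim_Im h1)].
have u0 k x : circ x -> 0 <= u k x by move=> _; apply: pos4; apply: cz; exact: ltW (rb k).
have g0 (x : R) : circ x -> 0 <= ln 4 - lncn (1 - b * expi x) by move=> _; apply: pos4; exact: cz.
have [h1 h2] := fatou_bound (@mcirc R) ru u0 uC mg g0 lim.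
have hI : rint leb circ (fun x => lncn (1 - b * expi x)).
  have := crintD (rint_cst (ln 4)) (crintN h1); congr rint; apply/funext => x.
  by rewrite opprB addrCA subrr addr0.
split => //; move: h2; rewrite (RintegralB (@mcirc R) (rint_cst (ln 4)) hI) Rintegral_circ_cst.
by rewrite gerBl.
Qed.

(** For |r| <= 1 the modulus of z - r on the circle is that of 1 - r^* z, and [lncn r] is not
    positive; for |r| > 1 the factor r is taken out, leaving 1 - z / r with mean logarithm 0. *)
Lemma root_mean r : r != 0 ->
  rint leb circ (fun x => lncn (expi x - r)) /\
  (2 * pi : R) * lncn r <= Rintegral leb circ (fun x => lncn (expi x - r)).
Proof.
move=> r0; have [r1|r1] := leP (cn r) 1.
  have [h1 h2] := @log_factor_ge0 r^* (ltac:(by rewrite cnJ)).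
  have E : (fun x : R => lncn (expi x - r)) = fun x => lncn (1 - r^* * expi x).
    apply/funext => x; have -> : expi x - r = expi x * (1 - r^* * expi x)^*.
      by rewrite rmorphB rmorphM rmorph1 /= conjCK mulrBr mulr1 mulrCA cnE cn_expi mulr1.
    by rewrite /lncn cnM cn_expi mul1r cnJ.
  rewrite E; split => //; apply: le_trans h2; rewrite pmulr_rle0 ?twopi_gt0 //.
  by rewrite /lncn ln_le0.
have b1 : cn r^-1 < 1.
  have : cn (r^-1 * r) = 1 by rewrite mulVf // (cn_real 1) expr1n.
  rewrite cnM => h; have := cn_ge0 r^-1; nra.
have [h1 h2] := log_factor_mean b1.
have E : (fun x : R => lncn (expi x - r)) = fun x => lncn r + lncn (1 - r^-1 * expi x).
  apply/funext => x; have n0 : 1 - r^-1 * expi x != 0.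
    apply/eqP => h; have := @cn1B_gt0 _ (r^-1 * expi x); rewrite h cn0 ltxx cnM cn_expi mulr1.
    by move=> /(_ b1).
  by rewrite -lncnM // mulrBr mulr1 mulrA mulfV // mul1r /lncn -cnN opprB.
rewrite E; split; first exact: (crintD (rint_cst _) h1).
by rewrite (RintegralD (@mcirc R) (rint_cst _) h1) h2 addr0 Rintegral_circ_cst mulrC.
Qed.

(** Nonvanishing almost everywhere is carried through the induction, because [lncn] is additive only
    on nonzero factors. *)
Lemma prod_mean c (s : seq R[i]) : c != 0 -> (forall r, r \in s -> r != 0) ->
  [/\ {ae leb, forall x, circ x -> c * \prod_(r <- s) (expi x - r) != 0},
    rint leb circ (fun x => lncn (c * \prod_(r <- s) (expi x - r))) &
    (2 * pi : R) * lncn (c * \prod_(r <- s) (0 - r)) <=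
      Rintegral leb circ (fun x => lncn (c * \prod_(r <- s) (expi x - r)))].
Proof.
move=> c0; elim: s => [|r s IH] hs.
  under [X in rint _ _ X]eq_fun do rewrite big_nil.
  under [X in Rintegral _ _ X]eq_fun do rewrite big_nil.
  rewrite big_nil mulr1 Rintegral_circ_cst mulrC; split => //; last exact: rint_cst.
  by apply: aeW => x _; rewrite big_nil mulr1.
have [IH1 IH2 IH3] := IH (fun r' h => hs r' (mem_behead (s := r :: s) h)).
have r0 : r != 0 by apply: hs; rewrite mem_head.
have [h1 h2] := root_mean r0.
have E x : c * \prod_(r' <- r :: s) (expi x - r') = (expi x - r) * (c * \prod_(r' <- s) (expi x - r')).
  by rewrite big_cons mulrCA.
have ae0 : {ae leb, forall x, circ x -> c * \prod_(r' <- r :: s) (expi x - r') != 0}.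
  apply: aeS2 IH1 (@ae_expi_neq r) => x hx1 hx2 Dx.
  by rewrite E mulf_neq0 ?hx1 // subr_eq0 hx2.
have aeE : {ae leb, forall x, circ x ->
    lncn (expi x - r) + lncn (c * \prod_(r' <- s) (expi x - r')) =
    lncn (c * \prod_(r' <- r :: s) (expi x - r'))}.
  apply: aeS2 IH1 (@ae_expi_neq r) => x hx1 hx2 Dx.
  by rewrite E [RHS]lncnM ?hx1 // subr_eq0 hx2.
have mF : measurable_fun (circ : set (measurableTypeR R))
    (fun x => lncn (c * \prod_(r' <- r :: s) (expi x - r'))).
  apply: meas_lncn; apply: cmeasM; first exact: cmeas_cst.
  apply: cmeas_prod => r'; apply: cmeasB; [exact: cmeas_expi|exact: cmeas_cst].
have hsum := crintD h1 IH2.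
split => //; first exact: (rint_ae (@mcirc R) hsum mF aeE).
rewrite -(Rintegral_ae (@mcirc R) (rint_meas hsum) mF aeE) (RintegralD (@mcirc R) h1 IH2).
rewrite big_cons mulrCA lncnM ?sub0r ?oppr_eq0 //; last first.
  rewrite mulf_neq0 // prodf_seq_neq0; apply/allP => r' r's; rewrite sub0r oppr_eq0 /=.
  by apply: hs; rewrite inE r's orbT.
by rewrite mulrDr lerD // /lncn cnN.
Qed.

Lemma jensen_polynomial (p : {poly R[i]}) : p.[0] != 0 ->
  rint leb circ (fun x => lncn p.[expi x]) /\
  (2 * pi : R) * lncn p.[0] <= Rintegral leb circ (fun x => lncn p.[expi x]).
Proof.
move=> p0; have [s ps] := closed_field_poly_normal p.
have l0 : lead_coef p != 0 by rewrite lead_coef_eq0; apply: contraNneq p0 => ->; rewrite horner0.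
have pE z : p.[z] = lead_coef p * \prod_(r <- s) (z - r).
  by rewrite {1}ps hornerZ horner_prod; congr (_ * _); apply: eq_bigr => r _; rewrite !hornerE.
have root0 r : r \in s -> r != 0.
  move=> rs; apply: contraNneq p0 => r0; rewrite pE mulf_eq0; apply/orP; right.
  by rewrite prodf_seq_eq0; apply/hasP; exists r; rewrite // r0 subr0 eqxx.
have [_ h1 h2] := prod_mean l0 root0.
by under [X in rint _ _ X]eq_fun do rewrite pE; rewrite pE;
  under [X in Rintegral _ _ X]eq_fun do rewrite pE.
Qed.

End jensen_polynomial.

(** * Limits and bounds for determinants *)

Section complex_limits.
Context (R : realType).
Implicit Types (c : nat -> R[i]).

Lemma climP c l : clim c l <->
  (fun n => complex.Re (c n)) @ \oo --> complex.Re l /\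
  (fun n => complex.Im (c n)) @ \oo --> complex.Im l.
Proof.
split=> [h|[h1 h2]]; first by split; [exact: clim_Re|exact: clim_Im].
have sq0 (v : nat -> R) m : v @ \oo --> m -> (fun n => (v n - m) ^+ 2) @ \oo --> (0 : R).
  move=> hv; have hw : (fun n => v n - m) @ \oo --> (0 : R).
    by rewrite -(subrr m); apply: cvgB => //; exact: cvg_cst.
  by rewrite -(mulr0 (0 : R)); under eq_fun do rewrite expr2; exact: cvgM.
have := cvg0D (sq0 _ _ h1) (sq0 _ _ h2); rewrite /clim.
by under [X in _ -> X @ _ --> _]eq_fun do rewrite /cn cReD cImD cReN cImN.
Qed.

Lemma climM c1 c2 l1 l2 : clim c1 l1 -> clim c2 l2 -> clim (fun n => c1 n * c2 n) (l1 * l2).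
Proof.
move=> /climP[a1 a2] /climP[b1 b2]; apply/climP; split.
  rewrite cReM (_ : (fun n => _) = fun n =>
    complex.Re (c1 n) * complex.Re (c2 n) - complex.Im (c1 n) * complex.Im (c2 n)).
    by apply: cvgB; exact: cvgM.
  by apply/funext => n; rewrite cReM.
rewrite cImM (_ : (fun n => _) = fun n =>
  complex.Re (c1 n) * complex.Im (c2 n) + complex.Im (c1 n) * complex.Re (c2 n)).
  by apply: cvgD; exact: cvgM.
by apply/funext => n; rewrite cImM.
Qed.

Lemma clim_sum (K : Type) (r : seq K) (F : K -> nat -> R[i]) (L : K -> R[i]) :
  (forall k, clim (F k) (L k)) -> clim (fun n => \sum_(k <- r) F k n) (\sum_(k <- r) L k).
Proof.
move=> h; elim: r => [|k r IH].
  by rewrite big_nil; apply: clim_eq (clim_cst 0) => n; rewrite big_nil.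
by rewrite big_cons; apply: clim_eq (climD (h k) IH) => n; rewrite big_cons.
Qed.

Lemma cvg_fsum (K : Type) (r : seq K) (F : K -> nat -> R) (L : K -> R) :
  (forall k, F k @ \oo --> L k) -> (fun n => \sum_(k <- r) F k n) @ \oo --> \sum_(k <- r) L k.
Proof.
move=> h; elim: r => [|k r IH].
  by rewrite big_nil (_ : (fun n => _) = fun=> 0); [exact: cvg_cst|apply/funext => n; rewrite big_nil].
rewrite big_cons (_ : (fun n => _) = fun n => F k n + \sum_(j <- r) F j n); first exact: cvgD.
by apply/funext => n; rewrite big_cons.
Qed.

Lemma clim_prod (K : Type) (r : seq K) (F : K -> nat -> R[i]) (L : K -> R[i]) :
  (forall k, clim (F k) (L k)) -> clim (fun n => \prod_(k <- r) F k n) (\prod_(k <- r) L k).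
Proof.
move=> h; elim: r => [|k r IH].
  by rewrite big_nil; apply: clim_eq (clim_cst 1) => n; rewrite big_nil.
by rewrite big_cons; apply: clim_eq (climM (h k) IH) => n; rewrite big_cons.
Qed.

Lemma clim_det q (A : nat -> 'M[R[i]]_q) (B : 'M[R[i]]_q) :
  (forall i j, clim (fun n => A n i j) (B i j)) -> clim (fun n => \det (A n)) (\det B).
Proof.
move=> h; rewrite /determinant.
by apply: clim_sum => s; apply: climM; [exact: clim_cst|apply: clim_prod => i].
Qed.

Lemma clim_cn c l : clim c l -> (fun n => cn (c n)) @ \oo --> cn l.
Proof.
move=> /climP[h1 h2]; apply: cvgD; under eq_fun do rewrite expr2; rewrite expr2; exact: cvgM.
Qed.

Lemma clim_subseq c l (s : nat -> nat) : (forall k, (k <= s k)%N) -> clim c l ->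
  clim (fun k => c (s k)) l.
Proof.
move=> hs /nonneg_cvg0P h; apply/nonneg_cvg0P => [n|e e0]; first exact: cn_ge0.
have [N HN] := h (fun n => cn_ge0 _) e e0; exists N => n Nn; apply: HN; exact: leq_trans (hs n).
Qed.

Lemma cn1 : cn (1 : R[i]) = 1.
Proof. by rewrite (cn_real 1) expr1n. Qed.

Definition mxsize q (A : 'M[R[i]]_q) : R := 1 + \sum_i \sum_j cn (A i j).

Lemma mxsize_ge1 q (A : 'M[R[i]]_q) : 1 <= mxsize A.
Proof. by rewrite lerDl; apply: sumr_ge0 => i _; apply: sumr_ge0 => j _; exact: cn_ge0. Qed.

(** Cauchy-Schwarz against a constant vector, by induction: a term a is added to a sum b of n terms
    through |a + b|^2 <= (1 + n) |a|^2 + (1 + 1/n) |b|^2. *)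
Lemma cn_sum_le (K : finType) (F : K -> R[i]) : cn (\sum_k F k) <= #|K|%:R * \sum_k cn (F k).
Proof.
have key (r : seq K) : cn (\sum_(k <- r) F k) <= (size r)%:R * \sum_(k <- r) cn (F k).
  elim: r => [|k r IH]; first by rewrite !big_nil cn0 mulr0.
  rewrite !big_cons /=; set n := size r in IH *.
  set a := F k; set b := \sum_(k <- r) F k in IH *; set S := \sum_(k <- r) cn (F k) in IH *.
  have S0 : 0 <= S by apply: sumr_ge0 => i _; exact: cn_ge0.
  case: n IH => [|n] IH.
    have b0 : cn b = 0 by apply/le_anti; rewrite cn_ge0 andbT (le_trans IH) // mul0r.
    by rewrite (cn_eq0 b0) addr0 mul1r lerDl.
  have n0 : 0 < n.+1%:R :> R by rewrite ltr0n.
  have h : cn (a + b) <= (1 + n.+1%:R) * cn a + (1 + n.+1%:R^-1) * cn b.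
    rewrite /cn; case: (a) (b) => a1 a2 [b1 b2] /=.
    have nn : n.+1%:R * n.+1%:R^-1 = 1 :> R by rewrite mulfV // gt_eqF.
    have m0 : 0 < n.+1%:R^-1 :> R by rewrite invr_gt0.
    move: nn n0 m0; move: n.+1%:R (n.+1%:R^-1) => N M nn N0 M0.
    have sq x y : x * y *+ 2 <= N * x ^+ 2 + M * y ^+ 2.
      have : 0 <= M * (N * x - y) ^+ 2 by rewrite mulr_ge0 ?sqr_ge0 // ltW.
      have -> : M * (N * x - y) ^+ 2 = (N * M) * N * x ^+ 2 - 2 * (N * M) * x * y + M * y ^+ 2.
        by ring.
      by rewrite nn; lra.
    have := sq a1 b1; have := sq a2 b2; rewrite !sqrrD; nra.
  apply: (le_trans h); rewrite -[n.+2%:R]nat1r [leRHS]mulrDr lerD2l.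
  apply: (@le_trans _ _ ((1 + n.+1%:R^-1) * (n.+1%:R * S))).
    by apply: ler_wpM2l IH; rewrite addr_ge0 // invr_ge0.
  by rewrite mulrA mulrDl mul1r mulVf ?gt_eqF // addrC.
by have := key (enum K); rewrite -cardE !big_enum.
Qed.

(** Leibniz's expansion has q! products, each of squared modulus at most [mxsize A ^+ q], and ln m
    <= m. The bound is crude but linear in the squared moduli of the entries, hence integrable for
    square integrable matrices. A zero determinant is harmless, as ln 0 = 0. *)
Lemma ln_det_le q (A : 'M[R[i]]_q) : lncn (\det A) <= 2 * ln q`!%:R + q%:R * mxsize A.
Proof.
have S1 := mxsize_ge1 A; have S0 : 0 < mxsize A by apply: lt_le_trans S1.
have f1 : 1 <= q`!%:R :> R by rewrite ler1n fact_gt0.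
have f0 : 0 < q`!%:R :> R by apply: lt_le_trans f1.
have ent i j : cn (A i j) <= mxsize A.
  apply: (@le_trans _ _ (\sum_j' cn (A i j'))).
    by rewrite (bigD1 j) //= lerDl sumr_ge0 // => k _; exact: cn_ge0.
  apply: (@le_trans _ _ (\sum_i' \sum_j' cn (A i' j'))); last by rewrite lerDr.
  rewrite [leRHS](bigD1 i) //= lerDl sumr_ge0 // => k _.
  by rewrite sumr_ge0 // => l _; exact: cn_ge0.
have bound : cn (\det A) <= q`!%:R ^+ 2 * mxsize A ^+ q.
  apply: (le_trans (cn_sum_le _)); rewrite card_Sn expr2 -mulrA; apply: ler_wpM2l; first exact: ltW.
  rewrite -[X in X%:R * _]card_Sn mulr_natl -sumr_const; apply: ler_sum => s _.
  rewrite cnM cnX cnN cn1 expr1n mul1r; have -> : cn (\prod_i A i (s i)) = \prod_i cn (A i (s i)).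
    by exact: (big_morph _ (@cnM R) cn1).
  have -> : mxsize A ^+ q = \prod_(i < q) mxsize A by rewrite prodr_const card_ord.
  apply: ler_prod => i _.
  by rewrite cn_ge0 ent.
have [d0|d0] := eqVneq (cn (\det A)) 0.
  rewrite /lncn d0 ln0 // addr_ge0 ?mulr_ge0 ?ln_ge0 // ltW //.
have dp : 0 < cn (\det A) by rewrite lt_def d0 cn_ge0.
have h : lncn (\det A) <= ln (q`!%:R ^+ 2 * mxsize A ^+ q).
  by rewrite /lncn ler_ln // posrE // (lt_le_trans dp).
apply: (le_trans h); rewrite lnM ?posrE ?exprn_gt0 // !lnXn // !mulr_natl lerD2l.
rewrite lerMn2r; apply/orP; right; have := @le_ln1Dx _ (mxsize A - 1).
have -> : 1 + (mxsize A - 1) = mxsize A by ring.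
move=> h1.
apply: (le_trans (h1 _)); last by rewrite gerBl.
by rewrite ltrBrDr addNr.
Qed.

End complex_limits.

Section common_subsequence.
Context d (T : measurableType d) (R : realType) (mu : {measure set T -> \bar R}).
Variables (D : set T) (mD : measurable D).
Local Notation ip := (@ipL2 _ _ _ mu _ mD).

Lemma L2_ae0 (f : L2 mu mD) : sqnorm ip f = 0 -> {ae mu, forall x, D x -> f x = 0}.
Proof.
rewrite nsq_L2 => h; have := Rintegral_eq0 mD (L2_sq f) (fun x _ => cn_ge0 (f x)) h.
by apply: aeS1 => x hx Dx; apply: cn_eq0; exact: hx.
Qed.

(** Subsequences are extracted one index at a time, so that finally all entries of a matrix converge
    together almost everywhere. *)
Lemma common_subsequence (J : finType) (u : J -> nat -> L2 mu mD) (l : J -> L2 mu mD) :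
  (forall j, hconv ip (u j) (l j)) ->
  exists2 s : nat -> nat, (forall k, (k <= s k)%N) &
    {ae mu, forall x, forall j, D x -> clim (fun k => u j (s k) x) (l j x)}.
Proof.
move=> hu; have ipP := hilbert_L2 mu mD.
suff [s hs h] : exists2 s : nat -> nat, (forall k, (k <= s k)%N) &
    {ae mu, forall x, forall j, j \in enum J -> D x -> clim (fun k => u j (s k) x) (l j x)}.
  by exists s => //; apply: aeS1 h => x hx j; apply: hx; rewrite mem_enum.
elim: (enum J) => [|j r [s hs IH]]; first by exists id => //; exact: aeW.
have conv : hconv ip (fun k => u j (s k)) (l j).
  have /(hlimP ipP) h := hu j; apply/(hlimP ipP) => e e0; have [N HN] := h e e0.
  by exists N => n Nn; apply: HN; exact: leq_trans (hs n).
have [l' [hl' [s' hs' ae']]] := L2_complete (hlim_cauchy ipP conv).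
have ael := L2_ae0 (hlim_unique ipP conv hl').
exists (fun k => s (s' k)); first by move=> k; exact: leq_trans (hs _).
apply: aeS2 IH (aeS2 _ ae' ael (S := fun x => D x -> clim (fun k => u j (s (s' k)) x) (l j x))) => [x h1 h2 i|].
  rewrite inE => /orP[/eqP ->|ir] Dx; first exact: h2.
  by apply: (clim_subseq hs' (c := fun k => u i (s k) x)); exact: h1.
by move=> x h1 h2 Dx; have := h2 Dx; rewrite L2D L2N => /subr0_eq ->; exact: h1.
Qed.

End common_subsequence.

(** * Square integrable functions on the circle *)

Section circle_L2.
Context (R : realType).
Local Notation leb := (@lebesgue_measure R).
Local Notation L2c := (L2 leb (@mcirc R)).

Definition sq_circ (f : R -> R[i]) : Prop := cLfun leb circ 2 f.

Definition toL2 (f : R -> R[i]) : L2c := insubd (0 : L2c) f.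

Lemma toL2E f : sq_circ f -> toL2 f = f :> (R -> R[i]).
Proof. by move=> hf; rewrite /toL2 -[LHS]/(val _) insubdK //; apply/asboolP. Qed.

Lemma L2_sq_circ (f : L2c) : sq_circ f.
Proof. by have /asboolP := valP f. Qed.

Lemma L2_eq (f g : L2c) : (f =1 g :> (R -> R[i])) -> f = g.
Proof. by move=> h; apply: val_inj; apply/funext. Qed.

Definition ipc : L2c -> L2c -> R[i] :=
  ip_scale (@ipL2 _ _ _ leb _ (@mcirc R)) ((2 * pi)^-1).

Lemma hilbert_ipc : hilbert_form ipc.
Proof. by apply: hilbert_scale; [exact: hilbert_L2|rewrite invr_gt0 twopi_gt0]. Qed.

Lemma ipcE (f g : L2c) : ipc f g = cmean (fun x => f x * (g x)^*).
Proof. by []. Qed.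

Lemma cint_sq (f g : R -> R[i]) : sq_circ f -> sq_circ g -> cint leb circ (fun x => f x * (g x)^*).
Proof.
move=> hf hg; have := L2_cint (toL2 f) (toL2 g).
by rewrite (_ : (fun x => toL2 f x * (toL2 g x)^*) = fun x => f x * (g x)^*) // !toL2E.
Qed.

Lemma sq_bounded f (g : R -> R[i]) B : sq_circ f -> cmeas (circ : set (measurableTypeR R)) g ->
  (forall x, circ x -> cn (g x) <= B) -> sq_circ (fun x => g x * f x).
Proof.
move=> /cLfun2P [mf hf] mg gB; apply/cLfun2P; have m := cmeasM mg mf; split => //.
apply: (crint_le (cmeas_cn m) (crintZ B hf)) => x Dx.
by rewrite ger0_norm ?cn_ge0 // cnM; apply: ler_wpM2r; [exact: cn_ge0|exact: gB].
Qed.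

Lemma sq_bounded_ae f (g : R -> R[i]) B : sq_circ f -> cmeas (circ : set (measurableTypeR R)) g ->
  {ae leb, forall x, circ x -> cn (g x) <= B} -> sq_circ (fun x => g x * f x).
Proof.
move=> /cLfun2P [mf hf] mg gB; apply/cLfun2P; have m := cmeasM mg mf; split => //.
have mB : measurable_fun (circ : set (measurableTypeR R)) (fun x => Num.min (cn (g x)) B * cn (f x)).
  apply: measurable_funM; last exact: cmeas_cn.
  by apply: measurable_minr; [exact: cmeas_cn|exact: measurable_cst].
apply: (@rint_ae _ _ _ leb _ (@mcirc R) (fun x => Num.min (cn (g x)) B * cn (f x))).
- apply: (crint_le mB (crintZ `|B| hf)) => x Dx.
  rewrite normrM (ger0_norm (cn_ge0 (f x))); apply: ler_wpM2r; first exact: cn_ge0.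
  rewrite minEle; case: ifP => [hB|_]; last exact: lexx.
  by rewrite ger0_norm ?cn_ge0 // (le_trans hB) // ler_norm.
- exact: (cmeas_cn m).
- by apply: aeS1 gB => x hx Dx; rewrite cnM min_l // hx.
Qed.

Lemma sq_expiX k f : sq_circ f -> sq_circ (fun x => expi x ^ k * f x).
Proof.
move=> hf; apply: (sq_bounded (B := 1) hf); first exact: cmeas_expiX.
by move=> x _; rewrite cn_expiX.
Qed.

Lemma sq_cst z : sq_circ (fun=> z).
Proof. by apply/cLfun2P; split; [exact: cmeas_cst|exact: rint_cst]. Qed.

Lemma sq_expi k : sq_circ (fun x => expi x ^ k).
Proof.
have := sq_expiX k (sq_cst 1); congr sq_circ.
by apply/funext => x; rewrite mulr1.
Qed.

Lemma L2_sum (K : Type) (r : seq K) (F : K -> L2c) x :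
  (\sum_(k <- r) F k : L2c) x = \sum_(k <- r) F k x.
Proof.
by elim: r => [|k r IH]; rewrite ?big_nil // !big_cons L2D IH.
Qed.

Lemma sq_sum (K : finType) (F : K -> R -> R[i]) :
  (forall k, sq_circ (F k)) -> sq_circ (fun x => \sum_k F k x).
Proof.
move=> h; have := L2_sq_circ (\sum_k toL2 (F k)); congr sq_circ.
by apply/funext => x; rewrite L2_sum; apply: eq_bigr => k _; rewrite toL2E.
Qed.

Definition zc (k : int) : L2c := toL2 (fun x => expi x ^ k).

Lemma zcE k x : zc k x = expi x ^ k.
Proof. by rewrite /zc toL2E //; exact: sq_expi. Qed.

Lemma ipc_zc f k : ipc f (zc k) = cmean (fun x => f x * expi x ^ (- k)).
Proof. by rewrite ipcE; congr cmean; apply/funext => x; rewrite zcE expiXJ. Qed.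

Definition powers (l : nat) (_ : 'I_1) : L2c := zc l.

Lemma zc_on k l : ipc (zc k) (zc l) = (k == l)%:R.
Proof.
rewrite ipc_zc -subr_eq0 -cmean_expiX; congr cmean; apply/funext => x.
by rewrite zcE -expiXD.
Qed.

Lemma powers_on l a m b : ipc (powers l a) (powers m b) = ((l == m) && (a == b))%:R.
Proof. by rewrite zc_on eqz_nat (ord1 a) (ord1 b) eqxx andbT. Qed.

Lemma ipc_ae0 (f : L2c) : (forall k : int, ipc f (zc k) = 0) -> {ae leb, forall x, circ x -> f x = 0}.
Proof.
move=> h; apply: fourier_uniqueness => [|k].
  have := L2_cint f (zc 0); congr cint; apply/funext => x.
  by rewrite zcE expr0z rmorph1 mulr1.
by have := h (- k); rewrite ipc_zc opprK => <-; congr cmean; apply/funext => x; rewrite mulrC.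
Qed.

Lemma nsq_ae0 (f : L2c) : {ae leb, forall x, circ x -> f x = 0} -> sqnorm ipc f = 0.
Proof.
move=> h; rewrite /ipc nsq_ip_scale nsq_L2.
rewrite (Rintegral_ae (@mcirc R) (rint_meas (L2_sq f)) (measurable_cst (0 : R))).
  by rewrite Rintegral_circ_cst mul0r mulr0.
by apply: aeS1 h => x hx Dx; rewrite hx // cn0.
Qed.

(** After projection onto the span of the powers z^l with l >= 0, the remainder of f has no nonzero
    Fourier coefficient, so it is null by uniqueness. *)
Lemma analytic_clsp (f : L2c) : (forall k : nat, ipc f (zc (- k.+1%:Z)) = 0) ->
  clsp ipc (uncurried powers) setT f.
Proof.
move=> hf; have ipP := hilbert_ipc.
have [p Sp hp] := projection_theorem ipP f (clsp_csub ipP (uncurried powers) setT).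
apply: (csub_congr ipP (clsp_csub ipP _ _) _ Sp); rewrite (nsqBC ipP).
apply: nsq_ae0; apply: ipc_ae0 => -[k|k].
  exact: (hp _ (clsp_gen ipP (uncurried powers) (a := (k, ord0)) I)).
rewrite NegzE (ipBl ipP) hf sub0r; apply/eqP; rewrite oppr_eq0; apply/eqP.
by apply: (clsp_orthl ipP _ Sp) => -[l a] _; rewrite /uncurried /powers zc_on.
Qed.

Lemma partial_exp_horner (f : L2c) N x :
  partial_exp ipc powers f N x = (\sum_(l < N) ipc f (zc l) *: 'X^l).[expi x].
Proof.
rewrite L2_sum horner_sum; apply: eq_bigr => l _.
by rewrite L2_sum big_ord1 L2Z zcE hornerZ hornerXn.
Qed.

Lemma nsq_partial_exp (f : L2c) N : sqnorm ipc (partial_exp ipc powers f N) <= sqnorm ipc f.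
Proof.
have ipP := hilbert_ipc; rewrite -[f in leRHS](subrK (partial_exp ipc powers f N)) (nsqD ipP).
have h m b : (m < N)%N -> ipc (f - partial_exp ipc powers f N) (powers m b) = 0.
  by move=> mN; rewrite (ipBl ipP) (ip_partial_exp ipP powers_on) // subrr.
rewrite (_ : ipc (f - _) _ = 0) ?mulr0 ?addr0 ?lerDr ?(nsq_ge0 ipP) //.
rewrite (ip_sumr ipP) big1 // => l _; rewrite (ip_sumr ipP) big1 // => a _.
by rewrite (ipZr ipP) h // mulr0.
Qed.

Lemma hconv_ipc (u : nat -> L2c) l : hconv ipc u l ->
  hconv (@ipL2 _ _ _ leb _ (@mcirc R)) u l.
Proof.
rewrite !hconvE; under eq_fun do rewrite nsq_ip_scale.
move=> /(cvg0Z (2 * pi)); under eq_fun do rewrite mulrA mulfV ?mul1r ?gt_eqF ?twopi_gt0 //.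
exact.
Qed.

(** * Jensen's inequality for the determinant of an analytic matrix function *)

Section matrix_jensen.
Variables (q : nat) (G : R -> 'M[R[i]]_q).
Hypothesis G2 : forall i j, sq_circ (fun x => G x i j).
Hypothesis G_analytic : forall i j (k : nat), cmean (fun x => expi x ^ (k.+1 : int) * G x i j) = 0.
Hypothesis detG_neq0 : {ae leb, forall x, circ x -> \det (G x) != 0}.
Hypothesis detG_int : rint leb circ (fun x => lncn (\det (G x))).

Let g i j : L2c := toL2 (fun x => G x i j).
Let gE i j x : g i j x = G x i j. Proof. by rewrite /g toL2E. Qed.
Let G0 : 'M[R[i]]_q := \matrix_(i, j) cmean (fun x => G x i j).
Let PN N : 'M[{poly R[i]}]_q := \matrix_(i, j) \sum_(l < N) ipc (g i j) (zc l) *: 'X^l.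
Let GN N x : 'M[R[i]]_q := \matrix_(i, j) partial_exp ipc powers (g i j) N x.

Let detPN N z : (\det (PN N)).[z] = \det (map_mx (horner_eval z) (PN N)).
Proof. by rewrite det_map_mx. Qed.

Let detPNx N x : (\det (PN N)).[expi x] = \det (GN N x).
Proof.
by rewrite detPN; congr (\det _); apply/matrixP => i j; rewrite !mxE partial_exp_horner.
Qed.

Let detPN0 N : (\det (PN N.+1)).[0] = \det G0.
Proof.
rewrite detPN; congr (\det _); apply/matrixP => i j; rewrite !mxE /horner_eval horner_sum.
rewrite big_ord_recl big1 => [|l _]; last by rewrite hornerZ hornerXn expr0n /= mulr0.
rewrite addr0 hornerZ hornerXn expr0 mulr1 ipc_zc; congr cmean; apply/funext => x.
by rewrite expr0z mulr1 gE.
Qed.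

Let rint_size (H : 'I_q -> 'I_q -> L2c) :
  rint leb circ (fun x => 1 + \sum_i \sum_j cn (H i j x)) /\
  Rintegral leb circ (fun x => 1 + \sum_i \sum_j cn (H i j x)) =
    2 * pi * (1 + \sum_i \sum_j sqnorm ipc (H i j)).
Proof.
have hs (K : finType) (F : K -> R -> R) : (forall k, rint leb circ (F k)) ->
    rint leb circ (fun x => \sum_k F k x) /\
    Rintegral leb circ (fun x => \sum_k F k x) = \sum_k Rintegral leb circ (F k).
  move=> hF; elim: (index_enum K) => [|k r [IH1 IH2]].
    rewrite (_ : (fun x => _) = fun=> 0); last by apply/funext => x; rewrite big_nil.
    by rewrite big_nil Rintegral_circ_cst mul0r; split => //; exact: rint_cst.
  rewrite (_ : (fun x => _) = fun x => F k x + \sum_(k <- r) F k x); last first.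
    by apply/funext => x; rewrite big_cons.
  rewrite (RintegralD (@mcirc R) (hF k) IH1) IH2 big_cons; split => //.
  exact: (crintD (hF k) IH1).
have h1 i := hs _ (fun j x => cn (H i j x)) (fun j => L2_sq (H i j)).
have [h2 h3] := hs _ (fun i x => \sum_j cn (H i j x)) (fun i => (h1 i).1).
split; first exact: (crintD (rint_cst 1) h2).
rewrite (RintegralD (@mcirc R) (rint_cst 1) h2) Rintegral_circ_cst mul1r h3 [RHS]mulrDr [in RHS]mulr1.
congr (_ + _); rewrite mulr_sumr; apply: eq_bigr => i _; rewrite (h1 i).2 mulr_sumr.
apply: eq_bigr => j _; rewrite nsq_ip_scale nsq_L2 mulrA mulfV ?mul1r //.
by rewrite gt_eqF // twopi_gt0.
Qed.

(* Jensen's inequality passes to the limit in the Fourier polynomials of G: since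
   ln |det G|^2 <= 2 ln q! + q |G|^2, Fatou's lemma applies to the difference. *)
Theorem matrix_jensen : \det G0 != 0 ->
  2 * pi * lncn (\det G0) <= Rintegral leb circ (fun x => lncn (\det (G x))).
Proof.
move=> G0n; have ipP := hilbert_ipc.
have conv (ij : 'I_q * 'I_q) : hconv (@ipL2 _ _ _ leb _ (@mcirc R))
    (fun N => partial_exp ipc powers (g ij.1 ij.2) N) (g ij.1 ij.2).
  apply: hconv_ipc; apply: (partial_exp_lim ipP powers_on); apply: analytic_clsp => k.
  rewrite ipc_zc opprK -[RHS](G_analytic ij.1 ij.2 k); congr cmean; apply/funext => x.
  by rewrite gE mulrC.
have [s hs aes] := common_subsequence conv.
pose K := 2 * ln q`!%:R : R.
(* The index [s k.+1] is positive, so the constant Fourier term is always present and the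
   determinant at 0 is exactly that of [G0]. *)
pose u k x := K + q%:R * mxsize (GN (s k.+1) x) - lncn (\det (GN (s k.+1) x)).
have jp k : rint leb circ (fun x => lncn (\det (GN (s k.+1) x))) /\
    2 * pi * lncn (\det G0) <= Rintegral leb circ (fun x => lncn (\det (GN (s k.+1) x))).
  have sk : s k.+1 = (s k.+1).-1.+1 by rewrite prednK //; exact: leq_trans (hs _).
  have d0 : (\det (PN (s k.+1))).[0] = \det G0 by rewrite sk detPN0.
  have := @jensen_polynomial _ (\det (PN (s k.+1))); rewrite d0 => /(_ G0n).
  by rewrite (_ : (fun x => lncn (\det (PN (s k.+1))).[expi x]) =
    fun x => lncn (\det (GN (s k.+1) x))) //; apply/funext => x; rewrite detPNx.
have szN N : rint leb circ (fun x => mxsize (GN N x)) /\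
    Rintegral leb circ (fun x => mxsize (GN N x)) <=
    2 * pi * (1 + \sum_i \sum_j sqnorm ipc (g i j)).
  have [h1 h2] := rint_size (fun i j => partial_exp ipc powers (g i j) N).
  rewrite (_ : (fun x => _) = fun x => 1 + \sum_i \sum_j cn (partial_exp ipc powers (g i j) N x)).
    split => //; rewrite h2 ler_pM2l ?twopi_gt0 // lerD2l; apply: ler_sum => i _.
    by apply: ler_sum => j _; exact: nsq_partial_exp.
  apply/funext => x; rewrite /mxsize; congr (_ + _); apply: eq_bigr => i _.
  by apply: eq_bigr => j _; rewrite mxE.
have szG : rint leb circ (fun x => mxsize (G x)) /\
    Rintegral leb circ (fun x => mxsize (G x)) = 2 * pi * (1 + \sum_i \sum_j sqnorm ipc (g i j)).
  have := rint_size g; rewrite (_ : (fun x => 1 + _) = fun x => mxsize (G x)) //.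
  apply/funext => x; rewrite /mxsize; congr (_ + _); apply: eq_bigr => i _.
  by apply: eq_bigr => j _; rewrite gE.
set Sg := 1 + \sum_i \sum_j sqnorm ipc (g i j) in szN szG.
have ru1 N : rint leb circ (fun x => K + q%:R * mxsize (GN N x)).
  by apply: crintD; [exact: rint_cst|apply: crintZ; exact: (szN N).1].
have ru k : rint leb circ (u k) by exact: (crintD (ru1 _) (crintN (jp k).1)).
have u0 k x : circ x -> 0 <= u k x by move=> _; rewrite /u subr_ge0; exact: ln_det_le.
pose C := K * (2 * pi) + q%:R * (2 * pi * Sg) - 2 * pi * lncn (\det G0).
have uC k : Rintegral leb circ (u k) <= C.
  rewrite /u (RintegralB (@mcirc R) (ru1 _) (jp k).1).
  rewrite (RintegralD (@mcirc R) (rint_cst K) (crintZ _ (szN _).1)) Rintegral_circ_cst.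
  rewrite (RintegralZl _ (@mcirc R) (szN _).1); apply: lerB; last exact: (jp k).2.
  by rewrite lerD2l; apply: ler_wpM2l => //; exact: (szN _).2.
have rg1 : rint leb circ (fun x => K + q%:R * mxsize (G x)).
  by apply: crintD; [exact: rint_cst|apply: crintZ; exact: szG.1].
pose v x := K + q%:R * mxsize (G x) - lncn (\det (G x)).
have rv : rint leb circ v by exact: (crintD rg1 (crintN detG_int)).
have v0 x : circ x -> 0 <= v x by move=> _; rewrite /v subr_ge0; exact: ln_det_le.
have lim : {ae leb, forall x, circ x -> (fun k => u k x) @ \oo --> v x}.
  apply: aeS2 aes detG_neq0 => x h1 h2 Dx.
  have ce i j : clim (fun k => GN (s k.+1) x i j) (G x i j).
    have := clim_shift (h1 (i, j) Dx); rewrite gE; apply: clim_eq => k.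
    by rewrite mxE.
  apply: cvgB.
    apply: cvgD; first exact: cvg_cst.
    apply: cvgM; first exact: cvg_cst.
    apply: cvgD; first exact: cvg_cst.
    by apply: cvg_fsum => i; apply: cvg_fsum => j; exact: clim_cn.
  apply: (cvg_comp (fun k => cn (\det (GN (s k.+1) x))) (@ln R)).
    by apply: clim_cn; apply: clim_det.
  apply: continuous_ln; rewrite lt_def cn_ge0 andbT; apply: contra (h2 Dx) => /eqP/cn_eq0 ->.
  by [].
have [_ hC] := fatou_bound (@mcirc R) ru u0 uC (rint_meas rv) v0 lim.
move: hC; rewrite /v (RintegralB (@mcirc R) rg1 detG_int).
rewrite (RintegralD (@mcirc R) (rint_cst K) (crintZ _ szG.1)) Rintegral_circ_cst.
by rewrite (RintegralZl _ (@mcirc R) szG.1) szG.2 /C lerD2l lerN2.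
Qed.

End matrix_jensen.

End circle_L2.

(** * Szego's theorem *)

Section adjoint.
Context (R : realType).
Local Notation C := R[i].

Lemma adjE m n (A : 'M[C]_(m, n)) i j : (A^t*) i j = (A j i)^*.
Proof. by rewrite !mxE. Qed.

Lemma adjM m n p (A : 'M[C]_(m, n)) (B : 'M[C]_(n, p)) : (A *m B)^t* = B^t* *m A^t*.
Proof. by rewrite trmx_mul map_mxM. Qed.

Lemma det_adj n (A : 'M[C]_n) : \det (A^t*) = (\det A)^*.
Proof. by rewrite det_map_mx det_tr. Qed.

Lemma cnM_adj n (A : 'M[C]_n) : (cn (\det A))%:C%C = \det (A *m A^t*).
Proof. by rewrite det_mulmx det_adj cnE. Qed.

(** By diagonalization the determinant is a product of factors 1 + e_i with e_i >= 0. It is at least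
    as large as each factor, so it equals 1 only if every eigenvalue vanishes. *)
Lemma psd_det1 n (N : 'M[C]_n) : N^t* = N -> (forall v : 'rV[C]_n, 0 <= (v *m N *m v^t*) 0 0) ->
  exists2 s : R, 0 <= s & \det (1%:M + N) = (1 + s)%:C%C /\ (s = 0 -> N = 0).
Proof.
move=> hN N0; have nN : N \is normalmx by apply/normalmxP; rewrite hN.
have /orthomx_spectralP := nN; set P := spectralmx N; set D := spectral_diag N => NE.
have uP : P \is unitarymx by exact: spectral_unitarymx.
have PPa : P *m P^t* = 1%:M by apply/unitarymxP.
have PuP : P \in unitmx by exact: unitarymx_unit.
have DE : diag_mx D = P *m N *m P^t*.
  by rewrite [in RHS]NE !mulmxA mulmxV // mul1mx -mulmxA PPa mulmx1.
have D0 i : 0 <= D 0 i.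
  have := N0 (row i P); rewrite -row_mul; congr (0 <= _).
  have -> : D 0 i = diag_mx D i i by rewrite mxE eqxx mulr1n.
  rewrite DE mxE [RHS]mxE; apply: eq_bigr => j _; rewrite adjE !mxE; congr (_ * _).
pose e i := complex.Re (D 0 i).
have De i : D 0 i = (e i)%:C%C by rewrite /e RRe_real // ger0_real.
have e0 i : 0 <= e i by have := D0 i; rewrite De ler0c.
have detE : \det (1%:M + N) = (\prod_i (1 + e i))%:C%C.
  have -> : 1%:M + N = invmx P *m diag_mx (\row_i (1 + D 0 i)) *m P.
    have -> : diag_mx (\row_i (1 + D 0 i)) = 1%:M + diag_mx D.
      by apply/matrixP => i j; rewrite !mxE; case: eqP; rewrite ?mulr1n ?mulr0n ?addr0.
    by rewrite mulmxDr mulmx1 mulmxDl mulVmx // -NE.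
  rewrite !det_mulmx mulrAC -det_mulmx mulVmx // det1 mul1r det_diag rmorph_prod.
  by apply: eq_bigr => i _; rewrite mxE De rmorphD rmorph1.
have ge1 i : 1 + e i <= \prod_j (1 + e j).
  rewrite (bigD1 i) //= ler_peMr ?addr_ge0 //.
  by apply: (big_ind (fun x => 1 <= x)) => // [x y|j _]; [exact: mulr_ege1|rewrite lerDl].
have ge1' : 1 <= \prod_j (1 + e j).
  by apply: (big_ind (fun x => 1 <= x)) => // [x y|j _]; [exact: mulr_ege1|rewrite lerDl].
exists (\prod_j (1 + e j) - 1); first by rewrite subr_ge0.
split; first by rewrite detE addrCA subrr addr0.
move=> /eqP; rewrite subr_eq0 => /eqP p1.
have ez i : e i = 0 by have := ge1 i; rewrite p1 gerDl => h; apply/le_anti; rewrite h e0.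
rewrite NE; have -> : D = 0 by apply/rowP => i; rewrite De ez mxE.
by rewrite raddf0 mulmx0 mul0mx.
Qed.

(** Congruence by the inverse of c reduces to [psd_det1]. The factor 1 + s is the form in which
    Jensen's inequality will force s = 0. *)
Lemma psd_det n (c N : 'M[C]_n) : c \in unitmx -> N^t* = N ->
  (forall v : 'rV[C]_n, 0 <= (v *m N *m v^t*) 0 0) ->
  exists2 s : R, 0 <= s & \det (c *m c^t* + N) = (cn (\det c) * (1 + s))%:C%C /\ (s = 0 -> N = 0).
Proof.
move=> cu hN N0; pose N' := invmx c *m N *m (invmx c)^t*.
have aca : (invmx c)^t* *m c^t* = 1%:M by rewrite -adjM mulmxV // trmx1 map_mx1.
have NE : N = c *m N' *m c^t*.
  by rewrite /N' !mulmxA mulmxV // mul1mx -mulmxA aca mulmx1.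
have [||s s0 [h1 h2]] := @psd_det1 n N'.
- by rewrite /N' !adjM trmxCK hN mulmxA.
- by move=> v; have := N0 (v *m invmx c); rewrite adjM !mulmxA.
exists s => //; split; last by move=> /h2 h; rewrite NE h mulmx0 mul0mx.
have -> : c *m c^t* + N = c *m (1%:M + N') *m c^t*.
  by rewrite mulmxDr mulmxDl mulmx1 -NE.
by rewrite !det_mulmx det_adj mulrAC cnE h1 -rmorphM.
Qed.

End adjoint.

Section szego.
Context (R : realType) (q : nat).
Local Notation leb := (@lebesgue_measure R).
Local Notation L2c := (L2 leb (@mcirc R)).

Definition rowsp := {ffun 'I_q -> L2c}.
Definition ipr : rowsp -> rowsp -> R[i] := ip_sum (@ipc R).

Lemma hilbert_ipr : hilbert_form ipr. Proof. exact: hilbert_sum (@hilbert_ipc R). Qed.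

Definition shift (m : int) (f : rowsp) : rowsp :=
  [ffun j => toL2 (fun x => expi x ^ m * f j x)].

Lemma shiftE m f j x : shift m f j x = expi x ^ m * f j x.
Proof. by rewrite ffunE toL2E //; apply: sq_expiX; exact: L2_sq_circ. Qed.

Lemma row_eq (f g : rowsp) : (forall j x, f j x = g j x) -> f = g.
Proof. by move=> h; apply/ffunP => j; apply: L2_eq => x; exact: h. Qed.

Lemma shiftD m f g : shift m (f + g) = shift m f + shift m g.
Proof. by apply: row_eq => j x; rewrite shiftE [in LHS]ffunE [in RHS]ffunE !L2D !shiftE mulrDr. Qed.

Lemma shiftZ m a f : shift m (a *: f) = a *: shift m f.
Proof. by apply: row_eq => j x; rewrite shiftE [in LHS]ffunE [in RHS]ffunE !L2Z shiftE mulrCA. Qed.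

Lemma ipr_shift m f g : ipr (shift m f) g = cmean (fun x => expi x ^ m * \sum_j f j x * (g j x)^*).
Proof.
rewrite /ipr /ip_sum; under eq_bigr do rewrite ipcE.
rewrite -cmean_sum; last first.
  by move=> j; exact: (L2_cint (shift m f j) (g j)).
congr cmean; apply/funext => x; rewrite mulr_sumr; apply: eq_bigr => j _.
by rewrite shiftE mulrA.
Qed.

Lemma shift0 f : shift 0 f = f.
Proof. by apply: row_eq => j x; rewrite shiftE expr0z mul1r. Qed.

Lemma iprE f g : ipr f g = cmean (fun x => \sum_j f j x * (g j x)^*).
Proof.
by rewrite -[f in LHS]shift0 ipr_shift; congr cmean; apply/funext => x; rewrite expr0z mul1r.
Qed.

Lemma nsq_shift m f : sqnorm ipr (shift m f) = sqnorm ipr f.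
Proof.
rewrite /sqnorm !iprE; congr (complex.Re (cmean _)); apply/funext => x.
apply: eq_bigr => j _; rewrite shiftE rmorphM /= mulrACA expiXJ -expiXD subrr expr0z mul1r.
by [].
Qed.

Lemma cint_rows (f g : rowsp) : cint leb circ (fun x => \sum_j f j x * (g j x)^*).
Proof. by apply: (cint_sum (@mcirc R)) => j; exact: L2_cint. Qed.

Definition crow (k : int) (i : 'I_q) : rowsp := [ffun j => (i == j)%:R *: zc R (- k)].

Lemma crowE k i j x : crow k i j x = (i == j)%:R * expi x ^ (- k).
Proof. by rewrite ffunE L2Z zcE. Qed.

Lemma ipr_crow f k i : ipr f (crow k i) = cmean (fun x => expi x ^ k * f i x).
Proof.
rewrite iprE; congr cmean; apply/funext => x; rewrite (bigD1 i) //= big1 ?addr0.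
  by rewrite crowE eqxx mul1r expiXJ opprK mulrC.
by move=> j ji; rewrite crowE eq_sym (negbTE ji) mul0r rmorph0 mulr0.
Qed.

Lemma crow_on k i l j : ipr (crow k i) (crow l j) = ((k == l) && (i == j))%:R.
Proof.
rewrite ipr_crow; under [X in cmean X]eq_fun do rewrite crowE mulrCA -expiXD.
have -> : (fun x : R => (i == j)%:R * expi x ^ (l - k)) =
  fun x => (i == j)%:R * (expi x ^ (l - k) * 1) by apply/funext => x; rewrite mulr1.
rewrite cmeanZ; last by apply: cint_expiX; exact: cint_cst.
under [X in cmean X]eq_fun do rewrite mulr1.
by rewrite cmean_expiX subr_eq0 (eq_sym l k) -natrM mulnb andbC.
Qed.

Lemma shift_crow m k i : shift m (crow k i) = crow (k - m) i.
Proof.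
by apply: row_eq => j x; rewrite shiftE !crowE mulrCA -expiXD opprB addrC.
Qed.

Variable h : R -> 'M[R[i]]_q.
Hypothesis h2 : forall i j, sq_circ (fun x => h x i j).

Definition hrow (a : int * 'I_q) : rowsp :=
  [ffun j => toL2 (fun x => expi x ^ (- a.1) * h x a.2 j)].

Definition upto (m : int) : set (int * 'I_q) := [set a | a.1 <= m].

Lemma hrowE a j x : hrow a j x = expi x ^ (- a.1) * h x a.2 j.
Proof. by rewrite ffunE toL2E //; exact: sq_expiX. Qed.

Lemma shift_hrow m k i : shift m (hrow (k, i)) = hrow (k - m, i).
Proof.
by apply: row_eq => j x; rewrite shiftE !hrowE /= mulrA -expiXD opprB addrC.
Qed.

Lemma shift_clsp m n v : clsp ipr hrow (upto n) v -> clsp ipr hrow (upto (n - m)) (shift m v).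
Proof.
apply: (clsp_isometry hilbert_ipr (@shiftD m) (@shiftZ m) (@nsq_shift m)) => -[k i] hk.
by rewrite shift_hrow; apply: (clsp_gen hilbert_ipr); rewrite /upto /= lerD2r.
Qed.

Lemma ipr_hrow k i l j : ipr (hrow (k, i)) (hrow (l, j)) =
  cmean (fun x => expi x ^ (l - k) * (h x *m (h x)^t*) i j).
Proof.
rewrite iprE; congr cmean; apply/funext => x; rewrite mxE mulr_sumr; apply: eq_bigr => r _.
by rewrite !hrowE /= rmorphM /= expiXJ opprK adjE mulrACA -expiXD addrC.
Qed.

Lemma ipr_hrow_crow k i l j : ipr (hrow (k, i)) (crow l j) =
  cmean (fun x => expi x ^ (l - k) * h x i j).
Proof.
by rewrite ipr_crow; congr cmean; apply/funext => x; rewrite hrowE /= mulrA -expiXD.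
Qed.

Hypothesis h_analytic : forall i j (k : nat), cmean (fun x => expi x ^ (k.+1 : int) * h x i j) = 0.
Hypothesis deth_neq0 : {ae leb, forall x, circ x -> \det (h x) != 0}.
Hypothesis deth_int : rint leb circ (fun x => lncn (\det (h x))).

Definition hmean : 'M[R[i]]_q := \matrix_(i, j) cmean (fun x => h x i j).

Hypothesis hmean_neq0 : \det hmean != 0.
Hypothesis h_outer : Rintegral leb circ (fun x => lncn (\det (h x))) = 2 * pi * lncn (\det hmean).

Lemma ipr_hrow_crow_lt k i l j : k < l -> ipr (hrow (k, i)) (crow l j) = 0.
Proof.
move=> kl; rewrite ipr_hrow_crow.
have : 0 < l - k by rewrite subr_gt0.
by case: (l - k) => [[|m]|m] // _; exact: h_analytic.
Qed.

Lemma ipr_hrow_crow_eq k i j : ipr (hrow (k, i)) (crow k j) = hmean i j.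
Proof.
rewrite ipr_hrow_crow subrr mxE; congr cmean; apply/funext => x.
by rewrite expr0z mul1r.
Qed.

Definition hconst i : rowsp := \sum_l hmean i l *: crow 0 l.

(* The error E of predicting h from its past satisfies E E^* = V constant with
   V = c c^* + N, where c is the mean of h and N is positive semidefinite.  Jensen's
   inequality for h E^*, whose mean is V, gives det V <= |det c|^2, hence N = 0. *)
Theorem szego_past i : clsp ipr hrow (upto (-1)) (hrow (0, i) - hconst i).
Proof.
have ipP := hilbert_ipr; set A := clsp ipr hrow (upto (-1)).
have cA : closed_subspace ipr A by exact: clsp_csub.
have /choice [p hp] l : exists p, A p /\ forall s, A s -> ipr (hrow (0, l) - p) s = 0.
  by have [p ? ?] := projection_theorem ipP (hrow (0, l)) cA; exists p.
pose eps l := hrow (0, l) - p l.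
have epsA l v : A v -> ipr (eps l) v = 0 by have [_] := hp l; exact.
pose V : 'M[R[i]]_q := \matrix_(k, l) ipr (eps k) (eps l).
pose E x : 'M[R[i]]_q := \matrix_(k, l) eps k l x.
have EE x k l : (E x *m (E x)^t*) k l = \sum_j eps k j x * (eps l j x)^*.
  by rewrite mxE; apply: eq_bigr => j _; rewrite adjE !mxE.
have shA l m : A (shift m.+1 (hrow (0, l))).
  by rewrite shift_hrow; apply: (clsp_gen ipP); rewrite /upto /= sub0r lerN2.
have sheps l m : A (shift m.+1 (eps l)).
  have -> : shift m.+1 (eps l) = shift m.+1 (hrow (0, l)) - shift m.+1 (p l).
    by rewrite /eps -[in LHS](scaleN1r (p l)) shiftD shiftZ scaleN1r.
  apply: (csubB cA) => //; have [Ap _] := hp l.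
  apply: (clspS ipP _ (shift_clsp m.+1 Ap)) => a; rewrite /upto /= => /le_trans; apply.
  by rewrite lerBlDr lerDl.
(* For m >= 1, z^m eps_k lies in the past and is orthogonal to eps_l; negative m follow by
   conjugation. Only the constant Fourier coefficient is left, so uniqueness applies. *)
have epsV k l : {ae leb, forall x, circ x -> (E x *m (E x)^t*) k l = V k l}.
  have hc : cint leb circ (fun x => \sum_j eps k j x * (eps l j x)^* - V k l).
    by apply: (cintD (@mcirc R)); [exact: cint_rows|exact: cint_cst].
  have : {ae leb, forall x, circ x -> \sum_j eps k j x * (eps l j x)^* - V k l = 0}.
    apply: fourier_uniqueness => // m.
    have -> : (fun x : R => expi x ^ m * (\sum_j eps k j x * (eps l j x)^* - V k l)) =
      fun x => expi x ^ m * \sum_j eps k j x * (eps l j x)^* + (- V k l) * (expi x ^ m * 1).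
      by apply/funext => x; rewrite mulrBr mulr1 mulNr (mulrC (V k l)).
    rewrite cmeanD; first last.
    - by apply: (cintZ (@mcirc R)); apply: cint_expiX; exact: cint_cst.
    - by apply: cint_expiX; exact: cint_rows.
    rewrite cmeanZ; last by apply: cint_expiX; exact: cint_cst.
    under [X in _ + _ * cmean X]eq_fun do rewrite mulr1.
    rewrite cmean_expiX -ipr_shift; case: m => [[|m]|m].
    - by rewrite shift0 mulr1 mxE subrr.
    - by rewrite mulr0 addr0 (ip_eq0C ipP) // epsA.
    - rewrite mulr0 addr0 (ipC ipP) [ipr _ _](_ : _ = ipr (shift m.+1 (eps l)) (eps k)).
        by rewrite (ip_eq0C ipP) ?rmorph0 // epsA.
      rewrite (ipC ipP) ipr_shift ipr_shift -cmeanJ; last by apply: cint_expiX; exact: cint_rows.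
      congr cmean; apply/funext => x; rewrite rmorphM /= expiXJ NegzE opprK; congr (_ * _).
      by rewrite rmorph_sum; apply: eq_bigr => j _; rewrite rmorphM /= conjCK mulrC.
  by apply: aeS1 => x hx Dx; rewrite EE; apply/eqP; rewrite -subr_eq0 hx.
have aeV : {ae leb, forall x, circ x -> E x *m (E x)^t* = V}.
  have := ae_fin (fun k => ae_fin (epsV k)); apply: aeS1 => x hx Dx.
  by apply/matrixP => k l; exact: hx.
have Acrow v j : A v -> ipr v (crow 0 j) = 0.
  apply: (clsp_orthl ipP) => -[k l]; rewrite /upto /= => hk.
  by rewrite ipr_hrow_crow_lt // (le_lt_trans hk).
have eps_crow l j : ipr (eps l) (crow 0 j) = hmean l j.
  have [Ap _] := hp l.
  by rewrite /eps (ipBl ipP) (Acrow _ _ Ap) subr0 ipr_hrow_crow_eq.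
have ipconst l k : ipr (hconst l) (hconst k) = (hmean *m hmean^t*) l k.
  rewrite /hconst (ip_suml ipP) mxE; apply: eq_bigr => r _; rewrite (ipZl ipP); congr (_ * _).
  rewrite (ip_sumr ipP) (bigD1 r) //= big1 => [|s sr].
    by rewrite (ipZr ipP) crow_on !eqxx mulr1 addr0 adjE.
  by rewrite (ipZr ipP) crow_on eq_sym (negbTE sr) andbF mulr0.
have ipeps l k : ipr (eps l) (hconst k) = (hmean *m hmean^t*) l k.
  rewrite /hconst (ip_sumr ipP) mxE; apply: eq_bigr => r _.
  by rewrite (ipZr ipP) eps_crow adjE mulrC.
pose N : 'M[R[i]]_q := \matrix_(k, l) ipr (eps k - hconst k) (eps l - hconst l).
(* [hconst] is the orthogonal projection of [eps] onto the span of the [crow 0], so the Gram matrix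
   V splits into that of the projections and that of the remainders. *)
have VE : V = hmean *m hmean^t* + N.
  have ipeps' k l : ipr (hconst k) (eps l) = (hmean *m hmean^t*) k l.
    by rewrite (ipC ipP) ipeps -adjE adjM trmxCK.
  apply/matrixP => k l; rewrite [RHS]mxE [X in _ + X]mxE [LHS]mxE.
  rewrite (ipBl ipP (eps k)) (ipBr ipP (eps l)) (ipBr ipP (eps l)) ipconst ipeps ipeps'.
  by rewrite subrr subr0 addrC subrK.
have hN : N^t* = N by apply/matrixP => k l; rewrite adjE !mxE -(ipC ipP).
have N0 (v : 'rV[R[i]]_q) : 0 <= (v *m N *m v^t*) 0 0.
  have -> : (v *m N *m v^t*) 0 0 =
      ipr (\sum_k v 0 k *: (eps k - hconst k)) (\sum_k v 0 k *: (eps k - hconst k)).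
    rewrite (ip_sumr ipP) mxE; apply: eq_bigr => l _; rewrite adjE (ipZr ipP) mulrC.
    congr (_ * _); rewrite (ip_suml ipP) mxE; apply: eq_bigr => k _.
    by rewrite (ipZl ipP) mxE.
  exact: (hf_ge0 ipP).
have cu : hmean \in unitmx by rewrite unitmxE unitfE.
have [s s0 [detV sN]] := psd_det cu hN N0; rewrite -VE in detV.
pose d0 := cn (\det hmean).
have d00 : 0 < d0 by rewrite lt_def cn_ge0 andbT; apply: contra hmean_neq0 => /eqP/cn_eq0 ->.
pose dV : R := d0 * (1 + s).
have dV0 : 0 < dV by rewrite mulr_gt0 // ltr_wpDr.
have aedE : {ae leb, forall x, circ x -> cn (\det (E x)) = dV}.
  apply: aeS1 aeV => x hx Dx; apply: (@complexI R); rewrite cnM_adj hx //.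
pose G x : 'M[R[i]]_q := h x *m (E x)^t*.
have Gentry k l x : G x k l = \sum_j (eps l j x)^* * h x k j.
  by rewrite mxE; apply: eq_bigr => j _; rewrite adjE mxE mulrC.
(* The diagonal entries of V bound the rows of E almost everywhere, so the product with h is still
   square integrable. *)
have G2 k l : sq_circ (fun x => G x k l).
  under [X in sq_circ X]eq_fun do rewrite Gentry.
  apply: sq_sum => j; apply: (sq_bounded_ae (B := complex.Re (V l l)) (h2 k j)).
    by apply: cmeasJ; exact: L2_meas.
  apply: aeS1 (epsV l l) => x hx Dx; rewrite cnJ -(hx Dx) EE.
  rewrite (raddf_sum (@complex.Re R : Rcomplex R -> R)) (bigD1 j) //= cnE /= lerDl.
  by apply: sumr_ge0 => r _; rewrite cnE /= cn_ge0.
have Gm m k l : cmean (fun x => expi x ^ m * G x k l) = ipr (shift m (hrow (0, k))) (eps l).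
  rewrite ipr_shift; congr cmean; apply/funext => x; rewrite Gentry; congr (_ * _).
  by apply: eq_bigr => j _; rewrite hrowE /= oppr0 expr0z mul1r mulrC.
have Ga k l (m : nat) : cmean (fun x => expi x ^ (m.+1 : int) * G x k l) = 0.
  by rewrite Gm (ip_eq0C ipP) // epsA.
(* Only the component of h outside its past contributes to the inner products with [eps]. *)
have GV : \matrix_(k, l) cmean (fun x => G x k l) = V.
  apply/matrixP => k l; rewrite !mxE; have := Gm 0 k l.
  under [X in cmean X]eq_fun do rewrite expr0z mul1r.
  move=> ->; rewrite shift0; have [Ap _] := hp k.
  by rewrite /eps (ipBl ipP) (ip_eq0C ipP (epsA l _ Ap)) subr0.
have detG x : \det (G x) = \det (h x) * (\det (E x))^* by rewrite det_mulmx det_adj.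
have dGn : {ae leb, forall x, circ x -> \det (G x) != 0}.
  apply: aeS2 deth_neq0 aedE => x hx1 hx2 Dx; rewrite detG mulf_neq0 ?hx1 // conjC_eq0.
  by apply/eqP => h0; have := hx2 Dx; rewrite h0 cn0 => /eqP; rewrite lt_eqF.
have lnG : {ae leb, forall x, circ x -> lncn (\det (h x)) + ln dV = lncn (\det (G x))}.
  apply: aeS2 dGn aedE => x hx1 hx2 Dx; have := hx1 Dx.
  rewrite detG mulf_eq0 negb_or => /andP[n1 n2].
  by rewrite lncnM // /lncn cnJ hx2.
have mG : measurable_fun (circ : set (measurableTypeR R)) (fun x => lncn (\det (G x))).
  apply: meas_lncn; rewrite /determinant; apply: cmeas_sum => t.
  apply: cmeasM; first exact: cmeas_cst.
  by apply: cmeas_prod => r; have /cLfun2P[] := G2 r (t r).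
have rs := crintD deth_int (rint_cst (ln dV)).
have rG := rint_ae (@mcirc R) rs mG lnG.
have := matrix_jensen G2 Ga dGn rG; rewrite GV detV -/d0 -/dV => J.
have VN : (dV%:C%C : R[i]) != 0 by rewrite (inj_eq (@complexI R) _ 0) gt_eqF.
(* On the left [lncn] of the real number dV is 2 ln dV; on the right |det E|^2 contributes ln dV
   once, and outerness evaluates the integral for h. What is left is ln dV <= ln |det c|^2, that is
   s <= 0. *)
have := J VN; rewrite -(Rintegral_ae (@mcirc R) (rint_meas rs) mG lnG).
rewrite (RintegralD (@mcirc R) deth_int (rint_cst _)) h_outer Rintegral_circ_cst.
rewrite /lncn cn_real lnXn // mulr2n mulrDr (mulrC (ln dV)) lerD2r ler_pM2l ?twopi_gt0 //.
rewrite ler_ln ?posrE // -/d0 /dV ger_pMr // gerDl => sle.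
have sz : s = 0 by apply/le_anti; rewrite sle.
have NZ := sN sz.
have nz : sqnorm ipr (eps i - hconst i) = 0.
  by have := congr1 (fun M : 'M[R[i]]_q => complex.Re (M i i)) NZ; rewrite !mxE.
have [Ap _] := hp i; apply: (csub_congr ipP cA _ Ap).
by rewrite (nsqBC ipP) addrAC.
Qed.

End szego.

(** * Innovations and prediction errors *)

Section alternating_series.
Context (R : realType) (q : nat).
Variables (V : lmodType R[i]) (ip : V -> V -> R[i]) (ipP : hilbert_form ip).
Variables (xi eta : nat -> 'I_q -> V).
Hypotheses (xi_on : orthonormal_family ip xi) (eta_on : orthonormal_family ip eta).
Variables (M : set V) (cM : closed_subspace ip M).
Hypotheses (Mxi : forall l a, M (xi l a)) (Meta : forall l a, M (eta l a)).
Variables (eps epst : 'I_q -> V).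
Hypotheses (Meps : forall a, M (eps a))
  (eps_core : forall a v, core ip xi eta M v -> ip (eps a) v = 0).
Hypothesis eps_eta : forall a l b, ip (eps a) (eta l b) = 0.
Hypothesis eps_xi : forall a l b, ip (eps a) (xi l b) = ip (xi 0%N a) (xi l b).
Hypothesis epst_xi : forall a l b, ip (epst a) (xi l b) = 0.
Hypothesis epst_eta : forall a l b, ip (epst a) (eta l b) = ip (eta 0%N a) (eta l b).
Variables (alpha alpha' : int -> 'M[R[i]]_q) (n : nat).
Hypothesis alphaE : forall l j a b,
  alpha (n + j + l + 1)%N%:Z a b = - ip (xi l a) (eta j b).
Hypothesis alphaE' : forall l j a b,
  alpha' (n + j + l + 1)%N%:Z a b = - ip (eta l a) (xi j b).

(** The limit in [alt_sum_lim] for [eps a] is tested against [eps b]. Only even terms survive, and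
    there [eps b] may be replaced by [xi_0], which yields the coordinates with j = 0. *)
Lemma even_series : mxsummable (fun k => altseq alpha alpha' n (2 * k)%N 0%N) /\
  mxseries (fun k => altseq alpha alpha' n (2 * k)%N 0%N) = \matrix_(a, b) ip (eps a) (eps b).
Proof.
have key a b : clim (fun N => \sum_(k < N) altseq alpha alpha' n (2 * k)%N 0%N a b)
    (ip (eps a) (eps b)).
  have := hlim_ipl ipP (eps b) (alt_sum_lim ipP xi_on cM Mxi Meta (Meps a)
    (eps_core a) (eps_eta a) (eps_xi a)).
  apply: clim_eq => N; rewrite (ip_alt_sum ipP); last first.
    by move=> w hw; apply: (ip_eq0C ipP); exact: (eps_span_eta ipP (eps_eta b)).
  apply: eq_bigr => k _.
  rewrite (altseqE ipP xi_on eta_on alphaE alphaE') /pick mul2n odd_double -mul2n.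
  rewrite (ipC ipP) (eps_span ipP (eps_xi b)) -?(ipC ipP) //.
  exact: alt_vec_even.
split; first by move=> a b; exact: (@clim_series _ (fun k => altseq alpha alpha' n (2 * k)%N 0%N a b) _ (key a b)).1.
apply/matrixP => a b; rewrite !mxE.
exact: (@clim_series _ (fun k => altseq alpha alpha' n (2 * k)%N 0%N a b) _ (key a b)).2.
Qed.

(** Testing against [epst b], which is orthogonal to the [xi], selects the odd terms instead; there
    [epst b] acts like [eta_0]. *)
Lemma odd_series : mxsummable (fun k => altseq alpha alpha' n (2 * k + 1)%N 0%N) /\
  mxseries (fun k => altseq alpha alpha' n (2 * k + 1)%N 0%N) = \matrix_(a, b) ip (eps a) (epst b).
Proof.
have key a b : clim (fun N => \sum_(k < N) altseq alpha alpha' n (2 * k + 1)%N 0%N a b)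
    (ip (eps a) (epst b)).
  have := hlim_ipl ipP (epst b) (alt_sum_lim ipP xi_on cM Mxi Meta (Meps a)
    (eps_core a) (eps_eta a) (eps_xi a)).
  apply: clim_eq => N; rewrite (ip_alt_sum_odd ipP); last first.
    by move=> w hw; apply: (ip_eq0C ipP); exact: (eps_span_eta ipP (epst_xi b)).
  apply: eq_bigr => k _.
  rewrite (altseqE ipP xi_on eta_on alphaE alphaE') addn1 /pick /= mul2n odd_double -mul2n.
  rewrite (ipC ipP) (eps_span ipP (epst_eta b)) -?(ipC ipP) //.
  exact: alt_vec_odd.
split; first by move=> a b; exact: (@clim_series _ (fun k => altseq alpha alpha' n (2 * k + 1)%N 0%N a b) _ (key a b)).1.
apply/matrixP => a b; rewrite !mxE.
exact: (@clim_series _ (fun k => altseq alpha alpha' n (2 * k + 1)%N 0%N a b) _ (key a b)).2.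
Qed.

End alternating_series.

Section innovations.
Context (R : realType) (q : nat).
Local Notation leb := (@lebesgue_measure R).
Variables (V : lmodType R[i]) (ip : V -> V -> R[i]) (ipP : hilbert_form ip).
Variables (x : int * 'I_q -> V) (h : R -> 'M[R[i]]_q).
Hypothesis h2 : forall i j, sq_circ (fun t => h t i j).
Hypothesis h_analytic : forall i j (k : nat), cmean (fun t => expi t ^ (k.+1 : int) * h t i j) = 0.
Hypothesis deth_neq0 : {ae leb, forall t, circ t -> \det (h t) != 0}.
Hypothesis deth_int : rint leb circ (fun t => lncn (\det (h t))).
Hypothesis hmean_neq0 : \det (hmean h) != 0.
Hypothesis h_outer : Rintegral leb circ (fun t => lncn (\det (h t))) = 2 * pi * lncn (\det (hmean h)).
Hypothesis xh : forall a b, ip (x a) (x b) = ipr (hrow h a) (hrow h b).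

Local Notation iprP := (@hilbert_ipr R q).
Local Notation rel := (iso_rel ip (@ipr R q) x (hrow h)).

Let hx a b : ipr (hrow h a) (hrow h b) = ip (x a) (x b). Proof. by rewrite xh. Qed.

(** Szego's theorem puts the rows [hconst] of the mean in the span of h up to time 0; applying the
    inverse of the mean and shifting reaches each [crow]. *)
Lemma crow_clsp k i : clsp (@ipr R q) (hrow h) (upto k) (crow R k i).
Proof.
have c0 l : clsp (@ipr R q) (hrow h) (upto 0) (hconst h l).
  have -> : hconst h l = hrow h (0, l) - (hrow h (0, l) - hconst h l).
    by rewrite opprB addrCA subrr addr0.
  apply: (csubB (clsp_csub iprP _ _)); first exact: (clsp_gen iprP).
  apply: (clspS iprP _ (szego_past h2 h_analytic deth_neq0 deth_int hmean_neq0 h_outer l)).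
  by move=> a; rewrite /upto /= => /le_trans; apply.
have hu : hmean h \in unitmx by rewrite unitmxE unitfE.
have -> : crow R k i = shift (- k) (\sum_l invmx (hmean h) i l *: hconst h l).
  have -> : \sum_l invmx (hmean h) i l *: hconst h l = crow R 0 i.
    under eq_bigr do rewrite /hconst scaler_sumr.
    rewrite exchange_big /= (eq_bigr (fun j => (i == j)%:R *: crow R 0 j)) => [|j _].
      rewrite (bigD1 i) //= eqxx scale1r big1 ?addr0 // => j.
      by rewrite eq_sym => /negbTE ->; rewrite scale0r.
    under eq_bigr => l _ do rewrite scalerA.
    rewrite -scaler_suml; have := mulVmx hu => /matrixP/(_ i j).
    by rewrite !mxE => ->.
  by rewrite shift_crow sub0r opprK.
rewrite -{1}(opprK k) -(sub0r (- k)); apply: (shift_clsp h2).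
apply: (csub_sum _ (clsp_csub iprP _ _)) => l _.
exact: (csubZ (clsp_csub iprP _ _)).
Qed.

Lemma innovations_exist : exists xi : int -> 'I_q -> V,
  forall k i, clsp ip x (upto k) (xi k i) /\ rel (xi k i) (crow R k i).
Proof.
suff h' k : exists xi : 'I_q -> V, forall i, clsp ip x (upto k) (xi i) /\ rel (xi i) (crow R k i).
  by have /choice [xi hxi] := h'; exists xi.
have /choice [xi hxi] : forall i, exists v, clsp ip x (upto k) v /\ rel v (crow R k i).
  move=> i; have [v hv r] := iso_rel_exists iprP ipP hx (crow_clsp k i).
  by exists v; split => //; exact: iso_rel_sym.
by exists xi.
Qed.

Variable xi : int -> 'I_q -> V.
Hypothesis xiP : forall k i, clsp ip x (upto k) (xi k i) /\ rel (xi k i) (crow R k i).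

Lemma innov_on k i l j : ip (xi k i) (xi l j) = ((k == l) && (i == j))%:R.
Proof. by rewrite (iso_rel_ip ipP iprP xh (xiP k i).2 (xiP l j).2) crow_on. Qed.

Lemma innov_gram k i l j : ip (x (k, i)) (xi l j) = ipr (hrow h (k, i)) (crow R l j).
Proof.
exact: (iso_rel_ip ipP iprP xh (iso_rel_gen ipP iprP x (hrow h) (k, i)) (xiP l j).2).
Qed.

Lemma innov_lt k i l j : k < l -> ip (x (k, i)) (xi l j) = 0.
Proof. by move=> kl; rewrite innov_gram (ipr_hrow_crow_lt h2 h_analytic). Qed.

Lemma innov_eq k i j : ip (x (k, i)) (xi k j) = hmean h i j.
Proof. by rewrite innov_gram (ipr_hrow_crow_eq h2). Qed.

Lemma innov_past k v l j : k < l -> clsp ip x (upto k) v -> ip v (xi l j) = 0.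
Proof.
move=> kl; apply: (clsp_orthl ipP) => -[m i]; rewrite /upto /= => mk.
by apply: innov_lt; exact: le_lt_trans kl.
Qed.

(** This is [szego_past], shifted by k and carried back to V by [iso_rel]; agreement up to a null
    vector is enough, since the span is closed. *)
Lemma innov_remainder k i :
  clsp ip x (upto (k - 1)) (x (k, i) - \sum_l hmean h i l *: xi k l).
Proof.
have hk : clsp (@ipr R q) (hrow h) (upto (k - 1)) (hrow h (k, i) - \sum_l hmean h i l *: crow R k l).
  have := shift_clsp h2 (- k) (szego_past h2 h_analytic deth_neq0 deth_int hmean_neq0 h_outer i).
  rewrite opprK addrC -[hrow h (0, i) - _]/(hrow h (0, i) - _) .
  rewrite -(scaleN1r (hconst h i)) shiftD shiftZ scaleN1r (shift_hrow h2) sub0r opprK.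
  congr (clsp _ _ _ (_ - _)); rewrite /hconst.
  have sh0 : shift (- k) (0 : rowsp R q) = 0 by rewrite -(scale0r (0 : rowsp R q)) shiftZ !scale0r.
  rewrite (big_morph _ (@shiftD R q (- k)) sh0); apply: eq_bigr => l _.
  by rewrite shiftZ shift_crow sub0r opprK.
have [u hu r] := iso_rel_exists iprP ipP hx hk.
have r' : rel (x (k, i) - \sum_l hmean h i l *: xi k l)
    (hrow h (k, i) - \sum_l hmean h i l *: crow R k l).
  apply: (iso_relB ipP iprP); first exact: (iso_rel_gen ipP iprP).
  apply: (iso_rel_sum ipP iprP) => l; apply: (iso_relZ ipP iprP); exact: (xiP k l).2.
apply: (csub_congr ipP (clsp_csub ipP _ _) _ hu).
have := iso_rel_nsq ipP iprP xh (iso_relB ipP iprP (iso_rel_sym r) r').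
by rewrite subrr (nsq0 iprP).
Qed.

(** Subtract from v its projection onto the past of m. The remainder is orthogonal to the
    innovations from m on, hence, by induction on time, to every x_k, because [innov_remainder]
    writes x_k as a vector of its strict past plus innovations at time k. So the remainder is
    null. *)
Lemma innov_complete m v : clsp ip x setT v -> (forall k i, m <= k -> ip v (xi k i) = 0) ->
  clsp ip x (upto (m - 1)) v.
Proof.
move=> Mv hv; set A := clsp ip x (upto (m - 1)); have cA : closed_subspace ip A by exact: clsp_csub.
have [p Ap hp] := projection_theorem ipP v cA.
have yxi k i : m <= k -> ip (v - p) (xi k i) = 0.
  move=> mk; rewrite (ipBl ipP) hv // (innov_past (k := m - 1)) ?subrr //.
  by rewrite (lt_le_trans _ mk) // gtrDl.
have yx (d : nat) : forall a, upto (m - 1 + d%:Z) a -> ip (v - p) (x a) = 0.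
  elim: d => [|d IH] [k i] ; rewrite /upto /= => hk.
    by apply: hp; apply: (clsp_gen ipP); rewrite /upto /=; rewrite addr0 in hk.
  have [kd|kd] := leP k (m - 1 + d%:Z); first exact: IH.
  have ke : k = m + d%:Z.
    apply/le_anti; apply/andP; split; first by move: hk; have -> // : m - 1 + d.+1%:Z = m + d%:Z by lia.
    by move: kd; lia.
  have := @innov_remainder k i; rewrite [in upto _]ke addrAC => hr.
  rewrite -[x (k, i)](subrK (\sum_l hmean h i l *: xi k l)).
  rewrite (ipDr ipP) (clsp_orthr ipP IH hr) add0r (ip_sumr ipP) big1 // => l _.
  by rewrite (ipZr ipP) yxi ?mulr0 // ke lerDl.
have y0 : ip (v - p) (v - p) = 0.
  have Mp : clsp ip x setT p by apply: (clspS ipP _ Ap).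
  apply: (clsp_orthr ipP (x := x) (K := setT)); last exact: (csubB (clsp_csub ipP _ _)).
  (* This many steps after m - 1 are enough to reach the time of a. *)
  move=> a _; apply: (yx (absz (a.1 - m + 1)) a); rewrite /upto /=.
  by lia.
apply: (csub_congr ipP cA _ Ap); rewrite (nsqBC ipP) /sqnorm y0 //.
Qed.

End innovations.

Section measurable_matrices.
Context d (T : measurableType d) (R : realType) (D : set T) (q : nat).
Implicit Types (f : T -> R[i]) (F G : T -> 'M[R[i]]_q).

(** Writing the inverse as g exp (- 2 ln g) reduces it to measurable functions and stays correct at
    g = 0, where both sides are 0. *)
Lemma measurable_inv_ge0 (g : T -> R) : measurable_fun D g -> (forall x, 0 <= g x) ->
  measurable_fun D (fun x => (g x)^-1).
Proof.
move=> mg g0; rewrite (_ : (fun x => (g x)^-1) = fun x => g x * expR (- (ln (g x) + ln (g x)))).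
  apply: measurable_funM => //; apply: (measurableT_comp (@measurable_expR R)).
  apply: measurableT_comp => //; apply: measurable_funD.
    by apply: (measurableT_comp (@measurable_ln R)).
  by apply: (measurableT_comp (@measurable_ln R)).
apply/funext => x; have := g0 x; rewrite le_eqVlt => /predU1P[<-|gx]; first by rewrite invr0 mul0r.
rewrite expRN expRD lnK ?posrE // invfM mulrA divff ?mul1r //.
by rewrite gt_eqF.
Qed.

Lemma cmeasV f : cmeas D f -> cmeas D (fun x => (f x)^-1).
Proof.
move=> mf; have mi : measurable_fun D (fun x => (cn (f x))^-1).
  by apply: measurable_inv_ge0 => [|x]; [exact: cmeas_cn|exact: cn_ge0].
rewrite (_ : (fun x => (f x)^-1) = fun x => (f x)^* * ((cn (f x))^-1)%:C%C).
  apply: cmeasM; first exact: cmeasJ.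
  by split => //=; exact: measurable_cst.
apply/funext => x; have [->|fx] := eqVneq (f x) 0; first by rewrite invr0 rmorph0 mul0r.
apply: (mulfI fx); rewrite divff // mulrA cnE -rmorphM /= divff ?rmorph1 //.
by apply/eqP => /cn_eq0/eqP; rewrite (negbTE fx).
Qed.

Lemma cmeas_det n (F : T -> 'M[R[i]]_n) : (forall i j, cmeas D (fun x => F x i j)) ->
  cmeas D (fun x => \det (F x)).
Proof.
move=> mF; rewrite /determinant; apply: cmeas_sum => s; apply: cmeasM; first exact: cmeas_cst.
by apply: cmeas_prod.
Qed.

(* Valid for singular A as well, where invmx A = A and (\det A)^-1 = 0. *)
Lemma invmxE (K : fieldType) n (A : 'M[K]_n) i j :
  invmx A i j = (\det A)^-1 * \adj A i j + (1 - \det A * (\det A)^-1) * A i j.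
Proof.
rewrite /invmx unitmxE unitfE; case: eqVneq => [->|dA] /=.
  by rewrite invr0 mul0r add0r mulr0 subr0 mul1r.
by rewrite mxE divff // subrr mul0r addr0.
Qed.

Lemma cmeas_invmx F : (forall i j, cmeas D (fun x => F x i j)) ->
  forall i j, cmeas D (fun x => invmx (F x) i j).
Proof.
move=> mF i j; under eq_fun do rewrite invmxE; have mdet := cmeas_det mF.
apply: cmeasD; apply: cmeasM => //.
- exact: cmeasV.
- under eq_fun do rewrite mxE /cofactor; apply: cmeasM; first exact: cmeas_cst.
  by apply: cmeas_det => k l; under eq_fun do rewrite !mxE.
apply: cmeasB; first exact: cmeas_cst.
by apply: cmeasM => //; exact: cmeasV.
Qed.

Lemma cmeas_mulmx F G : (forall i j, cmeas D (fun x => F x i j)) ->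
  (forall i j, cmeas D (fun x => G x i j)) -> forall i j, cmeas D (fun x => (F x *m G x) i j).
Proof.
move=> mF mG i j; under eq_fun do rewrite mxE.
by apply: cmeas_sum => k; exact: cmeasM.
Qed.

End measurable_matrices.

Section reflection.
Context (R : realType).
Local Notation leb := (@lebesgue_measure R).

Lemma integrable_refl (F : R -> \bar R) :
  leb.-integrable (circ : set (measurableTypeR R)) F -> leb.-integrable circ (fun x => F (- x)).
Proof.
move=> /integrableP[mF Fi]; apply/integrableP; split; first exact: (meas_refl mF).
have m1 : measurable_fun (circ : set (measurableTypeR R)) (fun x => `|F x|%E).
  by apply: measurableT_comp.
by rewrite (integral_refl_ge0 (F := fun x => `|F x|%E)).
Qed.

Lemma rint_refl (g : R -> R) : rint leb circ g -> rint leb circ (fun x => g (- x)).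
Proof. exact: integrable_refl. Qed.

Lemma sq_refl (f : R -> R[i]) : sq_circ f -> sq_circ (fun x => f (- x)).
Proof.
move=> /cLfun2P[mf fi]; apply/cLfun2P; split; first exact: (cmeas_refl mf).
exact: (rint_refl fi).
Qed.

Lemma sq_cint (f : R -> R[i]) : sq_circ f -> cint leb circ f.
Proof.
move=> /cint_sq/(_ (sq_cst 1)); congr cint; apply/funext => x.
by rewrite rmorph1 mulr1.
Qed.

Lemma cintB (f g : R -> R[i]) : cint leb circ f -> cint leb circ g ->
  cint leb circ (fun x => f x - g x).
Proof.
move=> hf hg; under eq_fun do rewrite -mulN1r.
by apply: (cintD (@mcirc R)) => //; apply: (cintZ (@mcirc R)).
Qed.

Lemma cmeanB (f g : R -> R[i]) : cint leb circ f -> cint leb circ g ->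
  cmean (fun x => f x - g x) = cmean f - cmean g.
Proof.
move=> hf hg; under [X in cmean X]eq_fun do rewrite -mulN1r.
rewrite cmeanD ?cmeanZ ?mulN1r //; exact: (cintZ (@mcirc R)).
Qed.

End reflection.

(** * Inner products of forward and backward innovations *)

Section cross_gram.
Context (R : realType) (q : nat).
Local Notation leb := (@lebesgue_measure R).
Variables (V : lmodType R[i]) (ip : V -> V -> R[i]) (ipP : hilbert_form ip).
Variables (x : int * 'I_q -> V) (h ht : R -> 'M[R[i]]_q).
Hypothesis h2 : forall i j, sq_circ (fun t => h t i j).
Hypothesis ht2 : forall i j, sq_circ (fun t => ht t i j).
Hypothesis deth_neq0 : {ae leb, forall t, circ t -> \det (h t) != 0}.
Hypothesis xh : forall a b, ip (x a) (x b) = ipr (hrow h a) (hrow h b).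

Let xr (a : int * 'I_q) := x (- a.1, a.2).

Hypothesis xrh : forall a b, ip (xr a) (xr b) = ipr (hrow ht a) (hrow ht b).
Hypothesis hht : {ae leb, forall t, circ t ->
  h t *m (h t)^t* = ht (- t) *m (ht (- t))^t*}.

Local Notation iprP := (@hilbert_ipr R q).
Variables (xi eta : int -> 'I_q -> V).
Hypothesis xiP : forall k i, clsp ip x (upto k) (xi k i) /\
  iso_rel ip (@ipr R q) x (hrow h) (xi k i) (crow R k i).
Hypothesis etaP : forall k i, clsp ip xr (upto k) (eta k i) /\
  iso_rel ip (@ipr R q) xr (hrow ht) (eta k i) (crow R k i).

Let s t := (ht (- t))^t*.

(* The image g of eta_k in the picture of h satisfies h g^* = z^{-k} s^* e_a, both
   sides having the same Fourier coefficients; as h h^* = s^* s, this means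
   g^* = z^{-k} h^* s^{-1} e_a. *)
Lemma innov_cross j i k a : ip (xi j i) (eta k a) =
  cmean (fun t => expi t ^ (- (j + k)) * ((h t)^t* *m invmx (s t)) i a).
Proof.
have hx u v : ipr (hrow h u) (hrow h v) = ip (x u) (x v) by rewrite xh.
have Meta : clsp ip x setT (eta k a).
  apply: (clsp_min (x := xr) (K := upto k) (clsp_csub ipP _ _)) (etaP k a).1.
  by move=> u _; exact: (clsp_gen ipP).
have [g Mg rg] := iso_rel_exists ipP iprP xh Meta.
have mh i' j' : cmeas (circ : set (measurableTypeR R)) (fun t => h t i' j').
  by have /cLfun2P[] := h2 i' j'.
have mht i' j' : cmeas (circ : set (measurableTypeR R)) (fun t => ht (- t) i' j').
  by apply: (cmeas_refl (f := fun t => ht t i' j')); have /cLfun2P[] := ht2 i' j'.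
have sqht i' j' : sq_circ (fun t => ht (- t) i' j') by exact: (sq_refl (ht2 i' j')).
have key b : {ae leb, forall t, circ t ->
    \sum_l h t b l * (g l t)^* - expi t ^ (- k) * ht (- t) b a = 0}.
  have c1 : cint leb circ (fun t => \sum_l h t b l * (g l t)^*).
    by apply: (cint_sum (@mcirc R)) => l; apply: cint_sq => //; exact: L2_sq_circ.
  have c2 : cint leb circ (fun t => expi t ^ (- k) * ht (- t) b a).
    by apply: cint_expiX; exact: sq_cint.
  apply: fourier_uniqueness; first exact: cintB.
  move=> m; under [X in cmean X]eq_fun do rewrite mulrBr.
  rewrite cmeanB; [|exact: cint_expiX..].
  apply/eqP; rewrite subr_eq0; apply/eqP.
  (* The same inner product is computed in the picture of h and in that of the time-reversed factor;
     a change of sign of the angle joins the two. *)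
  transitivity (ip (x (- m, b)) (eta k a)).
    have r1 := iso_rel_gen ipP iprP x (hrow h) (- m, b).
    rewrite (iso_rel_ip ipP iprP xh r1 rg) iprE; congr cmean; apply/funext => t.
    by rewrite mulr_sumr; apply: eq_bigr => l _; rewrite hrowE //= opprK mulrA.
  have r2 := iso_rel_gen ipP iprP xr (hrow ht) (m, b).
  rewrite -[x _]/(xr (m, b)) (iso_rel_ip ipP iprP xrh r2 (etaP k a).2) ipr_hrow_crow //.
  have m1 : cmeas (circ : set (measurableTypeR R)) (fun t => expi t ^ (k - m) * ht t b a).
    by apply: cmeasM; [exact: cmeas_expiX|have /cLfun2P[] := ht2 b a].
  rewrite -(cmean_refl m1); congr cmean; apply/funext => t.
  rewrite mulrA -expiXD !expiX; congr (expi _ * _).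
  by rewrite mulrN -mulNr -rmorphN /= opprB.
have r3 := iso_rel_ip ipP iprP xh (xiP j i).2 rg.
rewrite r3 (ipC iprP) ipr_crow -cmeanJ; last first.
  by apply: cint_expiX; apply: sq_cint; exact: L2_sq_circ.
have mg l : cmeas (circ : set (measurableTypeR R)) (g l) by have /cLfun2P[] := L2_sq_circ (g l).
apply: cmean_ae.
- by apply: cmeasJ; apply: cmeasM; [exact: cmeas_expiX|exact: mg].
- apply: cmeasM; first exact: cmeas_expiX.
  apply: cmeas_mulmx => [k' l'|].
    by under eq_fun do rewrite adjE; exact: (cmeasJ (mh l' k')).
  by apply: cmeas_invmx => k' l'; under eq_fun do rewrite adjE; exact: (cmeasJ (mht l' k')).
have key' := ae_fin key.
move: (aeS2 (fun t u v => conj u v) key' (aeS2 (fun t u v => conj u v) deth_neq0 hht)).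
apply: aeS1 => t [k1 [k2 k3]] ct; have {}k1 b := k1 b ct; have {}k2 := k2 ct; have {}k3 := k3 ct.
(* Determinants of the two factorizations of the density transfer invertibility from h to s. *)
have dst : \det (s t) != 0.
  have := congr1 determinant k3; rewrite !det_mulmx !det_adj.
  move=> e; apply: contra_neq k2 => s0; apply/eqP.
  by move: e; rewrite s0 mulr0 => /eqP; rewrite mulf_eq0 conjC_eq0 orbb.
rewrite rmorphM /= expiXJ opprD expiXD -mulrA; congr (_ * _).
pose G : 'cV[R[i]]_q := \col_l (g l t)^*.
have hG : h t *m G = expi t ^ (- k) *: col a (ht (- t)).
  apply/matrixP => b c; rewrite !mxE; have /eqP := k1 b; rewrite subr_eq0 => /eqP <-.
  by apply: eq_bigr => l _; rewrite mxE.
have hu : h t \in unitmx by rewrite unitmxE unitfE.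
have su : s t \in unitmx by rewrite unitmxE unitfE.
have GE : G = expi t ^ (- k) *: col a ((h t)^t* *m invmx (s t)).
  rewrite -[LHS](mulKmx hu) -[RHS](mulKmx hu) hG; congr (_ *m _).
  rewrite -scalemxAr !colE !mulmxA k3.
  by rewrite -/(s t) (mulmxK su).
have -> : (g i t)^* = G i 0 by rewrite mxE.
by rewrite GE !mxE.
Qed.

End cross_gram.

(** * Analytic content of outerness *)

Section outer_functions.
Context (R : realType) (q : nat).
Local Notation leb := (@lebesgue_measure R).
Implicit Types (u f : R[i] -> 'M[R[i]]_q).

Lemma lne_norm (z : R[i]) : z != 0 -> lne (complex.Re `|z|)%:E = (2^-1 * lncn z)%:E.
Proof.
move=> z0; have zp : 0 < cn z.
  by rewrite lt_neqAle cn_ge0 andbT eq_sym; apply/eqP => /cn_eq0/eqP; rewrite (negbTE z0).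
have np : 0 < complex.Re `|z|.
  have := Re_normr_cn z; rewrite normc_def /= => _; by rewrite sqrtr_gt0.
rewrite lne_EFin // /lncn -Re_normr_cn lnXn //; congr (_%:E).
by rewrite -[X in _ = _ * X]mulr_natl mulrA mulVf ?mul1r ?pnatr_eq0.
Qed.

Lemma lne_norm0 : lne (complex.Re `|0 : R[i]|)%:E = -oo%E.
Proof. by rewrite normr0 /= lexx. Qed.

Lemma measurable_lne_norm (F : R -> R[i]) : cmeas (circ : set (measurableTypeR R)) F ->
  measurable_fun (circ : set (measurableTypeR R)) (fun t => lne (complex.Re `|F t|)%:E).
Proof.
move=> mF; have -> : (fun t => lne (complex.Re `|F t|)%:E) =
    (fun t => if cn (F t) <= 0 then -oo%E else (2^-1 * lncn (F t))%:E).
  apply/funext => t; have [->|Ft] := eqVneq (F t) 0; first by rewrite lne_norm0 cn0 lexx.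
  rewrite lne_norm //; case: ifP => // h; exfalso; move/eqP: Ft; apply; apply: cn_eq0.
  by apply/le_anti; rewrite h cn_ge0.
apply: measurable_fun_if => //.
- exact: mcirc.
- by apply: measurable_fun_ler => //; exact: cmeas_cn.
- apply/measurable_EFinP; apply: measurable_funM; first exact: measurable_cst.
  exact: (measurable_funS (@mcirc R) (@subIsetl _ _ _) (meas_lncn mF)).
Qed.

(** Extracts what Szego's theorem uses. An integrable [lne] of det u is finite almost everywhere,
    which makes det f nonzero there; finiteness of the integral in the definition of [outer] then
    makes the determinant nonzero at the origin. *)
Lemma outer_conditions u f : circle_ae (fun z => u z = f z *m (f z)^t*) ->
  logdet_integrable u -> outer f ->
  let H := fun t => f (expi t) in
  [/\ hardy_ext f 0 = hmean H,
      (forall i j, sq_circ (fun t => H t i j)) /\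
      (forall i j (k : nat), cmean (fun t => expi t ^ (k.+1 : int) * H t i j) = 0),
      {ae leb, forall t, circ t -> \det (H t) != 0},
      rint leb circ (fun t => lncn (\det (H t))) &
      \det (hmean H) != 0 /\
      Rintegral leb circ (fun t => lncn (\det (H t))) = 2 * pi * lncn (\det (hmean H))].
Proof.
move=> uf ulog [[f2 fan] fout] H.
have f0 : hardy_ext f 0 = hmean H.
  apply/matrixP => i j; rewrite /hardy_ext circle_meanE mxE; congr cmean.
  by apply/funext => t; rewrite mul0r subr0 invr1 scale1r.
have mdet : cmeas (circ : set (measurableTypeR R)) (fun t => \det (H t)).
  by apply: cmeas_det => i j; have /cLfun2P[] := f2 i j.
have ulnc : {ae leb, forall t, circ t -> complex.Re (\det (u (expi t))) = cn (\det (H t))}.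
  by apply: aeS1 uf => t h ct; rewrite h // -cnM_adj.
have ufin := integrable_ae (@mcirc R) ulog.
have d0 : {ae leb, forall t, circ t -> \det (H t) != 0}.
  apply: (aeS2 _ ulnc ufin) => t h1 h2 ct; have := h2 ct; rewrite h1 //.
  by apply: contraTneq => ->; rewrite cn0 /= lexx.
have mln := meas_lncn mdet.
have dint : rint leb circ (fun t => lncn (\det (H t))).
  have /integrableP[mu1 lt1] := ulog; apply/integrableP; split; first exact/measurable_EFinP.
  apply: le_lt_trans lt1; rewrite le_eqVlt; apply/orP; left; apply/eqP.
  apply: ae_eq_integral => //; [exact: mcirc| | |].
  - by apply: measurableT_comp => //; exact/measurable_EFinP.
  - by apply: measurableT_comp.
  - apply: (aeS2 _ ulnc d0) => t h1 h2 ct; rewrite h1 // lne_EFin //.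
    rewrite lt_neqAle cn_ge0 andbT eq_sym; apply/eqP => /cn_eq0/eqP.
    by rewrite (negbTE (h2 ct)).
have dint' : leb.-integrable circ (fun t => (2^-1 * lncn (\det (H t)))%:E).
  by apply: crintZ.
have IE : (\int[leb]_(t in circ) lne (complex.Re `|\det (H t)|)%:E =
    (2^-1 * Rintegral leb circ (fun t => lncn (\det (H t))))%:E)%E.
  transitivity (\int[leb]_(t in circ) (2^-1 * lncn (\det (H t)))%:E)%E.
    apply: ae_eq_integral => //; [exact: mcirc|exact: measurable_lne_norm| |].
      by have /integrableP[] := dint'.
    by apply: aeS1 d0 => t h ct; rewrite lne_norm // h.
  rewrite -RintegralZl //; [|exact: mcirc].
  by rewrite /Rintegral fineK //; apply: integrable_fin_num => //; exact: mcirc.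
move: fout; rewrite f0 IE -EFinM => fout.
(* A vanishing determinant would make the left side -oo, since [lne 0] is -oo, while the right side
   is a real number. *)
have h0 : \det (hmean H) != 0.
  by apply: contra_eq_neq fout => ->; rewrite lne_norm0.
split=> //.
- split; first exact: f2.
  move=> i j k; have /matrixP/(_ i j) := fan k.+1 isT; rewrite circle_meanE mxE => <-.
  by congr cmean; apply/funext => t; rewrite mxE exprnP.
split=> //; move: fout; rewrite lne_norm // => -[].
set A := lncn _; set B := Rintegral _ _ _ => e.
have : (2 * pi) * (2^-1 * A) = (2 * pi) * ((2 * pi)^-1 * (2^-1 * B)) by rewrite e.
by rewrite [in RHS]mulrA divff ?gt_eqF ?twopi_gt0 // mul1r; lra.
Qed.

Lemma logdet_reversal u : logdet_integrable u -> logdet_integrable (time_reversal u).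
Proof.
move=> hu; have := integrable_refl hu; rewrite /logdet_integrable; congr integrable.
by apply/funext => t; rewrite /time_reversal expiN.
Qed.

Lemma hfact_reversal (w h ht : R[i] -> 'M[R[i]]_q) : circle_ae (fun z => w z = h z *m (h z)^t*) ->
  circle_ae (fun z => time_reversal w z = ht z *m (ht z)^t*) ->
  {ae leb, forall t, circ t ->
    h (expi t) *m (h (expi t))^t* = ht (expi (- t)) *m (ht (expi (- t)))^t*}.
Proof.
move=> hw /ae_refl htw; apply: (aeS2 _ hw htw) => t h1 h2 ct.
by rewrite -h1 // -h2 // /time_reversal -expiN opprK.
Qed.

End outer_functions.

(** * From the process to the Hilbert space L^2 *)

Section process_space.
Context d (Omega : measurableType d) (R : realType) (P : probability Omega R) (q : nat).
Variable X : int -> Omega -> 'cV[R[i]]_q.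
Hypothesis X2 : forall k j, cLfun P setT 2 (fun t => X k t j 0).

Local Notation V := (L2 P (@measurableT _ Omega)).
Local Notation ip := (@ipL2 _ Omega R P setT (@measurableT _ Omega)).
Let ipP : hilbert_form ip := hilbert_L2 P (@measurableT _ Omega).

Definition entry (a : int * 'I_q) : V := insubd (0 : V) (fun t => X a.1 t a.2 0).

Lemma entryE a : entry a = (fun t => X a.1 t a.2 0) :> (Omega -> R[i]).
Proof. by rewrite /entry -[LHS]/(val _) insubdK //; apply/asboolP. Qed.

Lemma L2_cLfun (v : V) : cLfun P setT 2 v. Proof. by have /asboolP := valP v. Qed.

Lemma cLfun_L2 f : cLfun P setT 2 f -> exists v : V, f = v :> (Omega -> R[i]).
Proof.
move=> hf; exists (insubd (0 : V) f).
by rewrite -[RHS]/(val _) insubdK //; apply/asboolP.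
Qed.

Lemma combE s t : comb entry s t = \sum_(p <- s) p.1 * X p.2.1 t p.2.2 0.
Proof.
elim: s => [|p s IH]; first by rewrite /comb !big_nil.
by rewrite /comb !big_cons L2D L2Z entryE -IH.
Qed.

Lemma L2norm_sq (v w : V) : L2norm P (fun t => v t - w t) = Num.sqrt (sqnorm ip (v - w)).
Proof. by []. Qed.

(** [MX] measures with the norm and [clsp] with its square, hence the tolerances [Num.sqrt e] in one
    direction and [e ^+ 2] in the other. *)
Lemma MXE K (v : V) : MX P X K v <-> clsp ip entry [set a | K a.1] v.
Proof.
split.
- move=> [_ h] e e0; have se : 0 < Num.sqrt e by rewrite sqrtr_gt0.
  have [y [m [c [g [hg yE]]]] vy] := h _ se.
  have /choice [a ha] : forall i, exists a : int * 'I_q, K a.1 /\ g i = entry a :> (Omega -> R[i]).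
    by move=> i; have [k [j [Kk ->]]] := hg i; exists (k, j); split => //; rewrite entryE.
  exists [seq (c i, a i) | i <- enum 'I_m].
    by move=> p /mapP[i _ ->] /=; exact: (ha i).1.
  rewrite -(ltr_sqrt _ e0) -L2norm_sq; congr (L2norm P _ < _): vy.
  apply/funext => t; congr (_ - _); rewrite yE combE big_map big_enum /=; apply: eq_bigr => i _.
  by rewrite (ha i).2 entryE.
move=> h; split; first exact: L2_cLfun.
move=> e e0; have [s Ks hs] := h (e ^+ 2) (exprn_gt0 _ e0).
exists (comb entry s).
  exists (size s), (fun i => (tnth (in_tuple s) i).1), (fun i => entry (tnth (in_tuple s) i).2).
  split.
    move=> i; exists (tnth (in_tuple s) i).2.1, (tnth (in_tuple s) i).2.2; rewrite entryE; split => //.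
    by apply: Ks; exact: mem_tnth.
  apply/funext => t; rewrite combE big_tnth; apply: eq_bigr => i _.
  by rewrite entryE.
rewrite L2norm_sq -(ger0_norm (ltW e0)) -sqrtr_sqr ltr_sqrt // exprn_gt0 //.
Qed.

(** [oproj] is a choice with default value 0. The projection theorem shows that a candidate exists,
    so the chosen function is a projection; it may differ from p on a null set, and only its
    characteristic properties are passed on. *)
Lemma oproj_exists K (v : V) : exists e : V,
  [/\ oproj P (MXperp P X K) v = e :> (Omega -> R[i]), clsp ip entry setT e,
      (forall y, clsp ip entry [set a | K a.1] y -> ip e y = 0) &
      (forall u, clsp ip entry setT u -> (forall y, clsp ip entry [set a | K a.1] y -> ip u y = 0) ->
        ip (v - e) u = 0)].
Proof.
have MXT (u : V) : MX P X setT u <-> clsp ip entry setT u.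
  by rewrite MXE (_ : [set a | _] = setT) //; apply/seteqP.
have perpE (u : V) : MXperp P X K u <->
    clsp ip entry setT u /\ (forall y, clsp ip entry [set a | K a.1] y -> ip u y = 0).
  split=> [[/MXT Mu h]|[/MXT Mu h]]; split => //.
    by move=> y /MXE; exact: h.
  move=> y My; have [y' yE] := cLfun_L2 My.1; move: My; rewrite yE => /MXE; exact: h.
pose A := clsp ip entry setT `&` [set u | forall y, clsp ip entry [set a | K a.1] y -> ip u y = 0].
have cA : closed_subspace ip A.
  by apply: csubI; [exact: clsp_csub|exact: (csub_orthl ipP)].
have [p [Mp1 Mp2] hp] := projection_theorem ipP v cA.
have [] : [set p | MXperp P X K p /\ forall s, MXperp P X K s ->
    inner P (fun t => v t - p t) s = 0] (oproj P (MXperp P X K) v).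
  apply: xgetPex; exists (p : Omega -> R[i]); split; first exact/perpE.
  move=> s hs; have [s' sE] := cLfun_L2 hs.1.1; move: hs; rewrite sE => /perpE hs.
  exact: hp.
move=> h1 h2; have [e eE] := cLfun_L2 h1.1.1; move: h1 h2; rewrite eE => /perpE[e1 e2] e3.
exists e; split => // u u1 u2; apply: (e3 (u : Omega -> R[i])); exact/perpE.
Qed.

Lemma gram_entry m n i j : gram P (X m) (X n) i j = ip (entry (m, i)) (entry (n, j)).
Proof.
rewrite /gram mxE /ipL2; congr cintegral; apply/funext => t.
by rewrite !entryE mxE big_ord1 adjE.
Qed.

Variables (w h ht : R[i] -> 'M[R[i]]_q).
Hypothesis hw : spectral_density P X w.

Lemma ip_entry k i l j : ip (entry (k, i)) (entry (l, j)) =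
  cmean (fun t => expi t ^ (l - k) * w (expi t) i j).
Proof.
have [_ _ E] := hw; rewrite -gram_entry E circle_meanE; congr cmean; apply/funext => t.
by rewrite mxE opprB.
Qed.

Lemma cmeas_density i j : cmeas (circ : set (measurableTypeR R)) (fun t => w (expi t) i j).
Proof. by have [+ _ _] := hw => /(_ i j)[m1 m2 _]; split. Qed.

Lemma gram_factor (H : R -> 'M[R[i]]_q) : (forall i j, sq_circ (fun t => H t i j)) ->
  {ae @lebesgue_measure R, forall t, circ t -> w (expi t) = H t *m (H t)^t*} ->
  forall a b, ip (entry a) (entry b) = ipr (hrow H a) (hrow H b).
Proof.
move=> H2 wH [k i] [l j]; rewrite ip_entry (ipr_hrow H2).
have mH i' j' : cmeas (circ : set (measurableTypeR R)) (fun t => H t i' j').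
  by have /cLfun2P[] := H2 i' j'.
apply: cmean_ae.
- by apply: cmeasM; [exact: cmeas_expiX|exact: cmeas_density].
- apply: cmeasM; first exact: cmeas_expiX.
  by apply: cmeas_mulmx => // i' j'; under eq_fun do rewrite adjE; exact: (cmeasJ (mH j' i')).
- by apply: aeS1 wH => t e ct; rewrite e.
Qed.

Lemma gram_factor_reversed (H : R -> 'M[R[i]]_q) : (forall i j, sq_circ (fun t => H t i j)) ->
  {ae @lebesgue_measure R, forall t, circ t -> w (expi (- t)) = H t *m (H t)^t*} ->
  forall a b, ip (entry (- a.1, a.2)) (entry (- b.1, b.2)) = ipr (hrow H a) (hrow H b).
Proof.
move=> H2 wH [k i] [l j]; rewrite ip_entry (ipr_hrow H2) /=.
have mH i' j' : cmeas (circ : set (measurableTypeR R)) (fun t => H t i' j').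
  by have /cLfun2P[] := H2 i' j'.
have m1 : cmeas (circ : set (measurableTypeR R)) (fun t => expi t ^ (- l - - k) * w (expi t) i j).
  by apply: cmeasM; [exact: cmeas_expiX|exact: cmeas_density].
rewrite -(cmean_refl m1); apply: cmean_ae.
- exact: (cmeas_refl m1).
- apply: cmeasM; first exact: cmeas_expiX.
  by apply: cmeas_mulmx => // i' j'; under eq_fun do rewrite adjE; exact: (cmeasJ (mH j' i')).
- apply: aeS1 wH => t e ct; rewrite e //; congr (_ * _); rewrite !expiX; congr expi.
  by rewrite -opprB opprK mulrN -mulNr -rmorphN /=; congr (_%:~R * _); ring.
Qed.

End process_space.

Section normalization.
Context (R : realType) (q : nat).
Variables (V : lmodType R[i]) (ip : V -> V -> R[i]) (ipP : hilbert_form ip).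

(** When the inner products of e with [xi_0] form the matrix c, the inverse of c turns e into
    vectors that act on the family like [xi_0] itself; [gram_normalized] restores c and its
    adjoint. *)
Definition normalized (c : 'M[R[i]]_q) (e : 'I_q -> V) (a : 'I_q) : V :=
  \sum_b invmx c a b *: e b.

Lemma ip_sub0 u v w : ip (v - u) w = 0 -> ip u w = ip v w.
Proof. by rewrite (ipBl ipP) => /eqP; rewrite subr_eq0 => /eqP. Qed.

Lemma ip_normalized0 c e v a : (forall b, ip (e b) v = 0) -> ip (normalized c e a) v = 0.
Proof. by move=> h; rewrite (ip_suml ipP) big1 // => b _; rewrite (ipZl ipP) h mulr0. Qed.

Lemma ip_normalized c (e : 'I_q -> V) (xi : nat -> 'I_q -> V) a l b : \det c != 0 ->
  orthonormal_family ip xi -> (forall i k j, ip (e i) (xi k j) = (0%N == k)%:R * c i j) ->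
  ip (normalized c e a) (xi l b) = ip (xi 0%N a) (xi l b).
Proof.
move=> c0 xi_on h; rewrite xi_on (ip_suml ipP).
under eq_bigr do rewrite (ipZl ipP) h mulrCA.
rewrite -mulr_sumr -mulnb natrM; have cu : c \in unitmx by rewrite unitmxE unitfE.
by have := mulVmx cu => /matrixP/(_ a b); rewrite !mxE => ->.
Qed.

Lemma gram_normalized c c' (e e' : 'I_q -> V) : \det c != 0 -> \det c' != 0 ->
  \matrix_(i, j) ip (e i) (e' j) =
  c *m (\matrix_(i, j) ip (normalized c e i) (normalized c' e' j)) *m c'^t*.
Proof.
move=> dc dc'; have cu : c \in unitmx by rewrite unitmxE unitfE.
have cu' : c' \in unitmx by rewrite unitmxE unitfE.
have -> : \matrix_(i, j) ip (normalized c e i) (normalized c' e' j) =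
    invmx c *m (\matrix_(i, j) ip (e i) (e' j)) *m (invmx c')^t*.
  apply/matrixP => i j; rewrite !mxE (ip_sumr ipP); apply: eq_bigr => b _.
  rewrite (ipZr ipP) !mxE mulrC; congr (_ * _).
  rewrite (ip_suml ipP); apply: eq_bigr => k _; by rewrite (ipZl ipP) mxE.
rewrite !mulmxA mulmxV // mul1mx -mulmxA -adjM mulmxV //.
by rewrite trmx1 map_mx1 mulmx1.
Qed.

End normalization.

(** * Gram matrices of the two residuals *)

Section prediction_errors.
Context (R : realType) (q : nat).
Local Notation leb := (@lebesgue_measure R).
Variables (V : lmodType R[i]) (ip : V -> V -> R[i]) (ipP : hilbert_form ip).

(** e is a projection of v onto the orthogonal complement of the span of K, described by properties
    so that any representative modulo null vectors qualifies. *)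
Definition residual (I : choiceType) (x : I -> V) (K : set I) (v e : V) : Prop :=
  [/\ clsp ip x setT e, forall y, clsp ip x K y -> ip e y = 0 &
      forall u, clsp ip x setT u -> (forall y, clsp ip x K y -> ip u y = 0) -> ip (v - e) u = 0].

Variables (x : int * 'I_q -> V) (H Ht : R -> 'M[R[i]]_q).
Hypothesis H2 : forall i j, sq_circ (fun t => H t i j).
Hypothesis Han : forall i j (k : nat), cmean (fun t => expi t ^ (k.+1 : int) * H t i j) = 0.
Hypothesis Hd : {ae leb, forall t, circ t -> \det (H t) != 0}.
Hypothesis Hi : rint leb circ (fun t => lncn (\det (H t))).
Hypothesis c0n : \det (hmean H) != 0.
Hypothesis Ho : Rintegral leb circ (fun t => lncn (\det (H t))) = 2 * pi * lncn (\det (hmean H)).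
Hypothesis xH : forall a b, ip (x a) (x b) = ipr (hrow H a) (hrow H b).
Hypothesis Ht2 : forall i j, sq_circ (fun t => Ht t i j).
Hypothesis Htan : forall i j (k : nat), cmean (fun t => expi t ^ (k.+1 : int) * Ht t i j) = 0.
Hypothesis Htd : {ae leb, forall t, circ t -> \det (Ht t) != 0}.
Hypothesis Hti : rint leb circ (fun t => lncn (\det (Ht t))).
Hypothesis ct0n : \det (hmean Ht) != 0.
Hypothesis Hto : Rintegral leb circ (fun t => lncn (\det (Ht t))) = 2 * pi * lncn (\det (hmean Ht)).
Let xr (a : int * 'I_q) := x (- a.1, a.2).
Hypothesis xrH : forall a b, ip (xr a) (xr b) = ipr (hrow Ht a) (hrow Ht b).
Hypothesis HHt : {ae leb, forall t, circ t ->
  H t *m (H t)^t* = Ht (- t) *m (Ht (- t))^t*}.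
Variable n : nat.
Let K : set (int * 'I_q) := [set a | - n%:Z <= a.1 <= -1].
Hypothesis inter : forall v, clsp ip x (upto (-1)) v ->
  clsp ip x [set a | - n%:Z <= a.1] v -> clsp ip x K v.
Variables (e et : 'I_q -> V).
Hypothesis he : forall a, residual x K (x (0, a)) (e a).
Hypothesis het : forall a, residual x K (x (- n.+1%:Z, a)) (et a).

(** The coefficients [beta] written in the angle t: the conjugation of the argument in [sharp]
    becomes a change of sign of t. *)
Definition phase_coef (k : int) : 'M[R[i]]_q := \matrix_(i, j)
  - cmean (fun t => expi t ^ (- k) * ((H t)^t* *m invmx ((Ht (- t))^t*)) i j).
Local Notation b := phase_coef.
Local Notation b' := (fun k => (phase_coef k)^t*).
Let c0 := hmean H.
Let ct0 := hmean Ht.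

Theorem residual_gram :
  [/\ mxsummable (fun k => altseq b b' n (2 * k)%N 0%N) /\
      \matrix_(i, j) ip (e i) (e j) =
        c0 *m mxseries (fun k => altseq b b' n (2 * k)%N 0%N) *m c0^t*,
      mxsummable (fun k => altseq b' b n (2 * k)%N 0%N) /\
      \matrix_(i, j) ip (et i) (et j) =
        ct0 *m mxseries (fun k => altseq b' b n (2 * k)%N 0%N) *m ct0^t* &
      mxsummable (fun k => altseq b b' n (2 * k + 1)%N 0%N) /\
      \matrix_(i, j) ip (e i) (et j) =
        c0 *m mxseries (fun k => altseq b b' n (2 * k + 1)%N 0%N) *m ct0^t*].
Proof.
have [xi xiP] := innovations_exist ipP H2 Han Hd Hi c0n Ho xH.
have [eta etaP] := innovations_exist ipP Ht2 Htan Htd Hti ct0n Hto xrH.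
have cross j i k a := innov_cross ipP H2 Ht2 Hd xH xrH HHt xiP etaP j i k a.
(* Backward time n + 1 is time -(n + 1), the instant just before the observed block; hence the
   offset in [eta']. *)
pose xi' (l : nat) a := xi l%:Z a; pose eta' (l : nat) a := eta (n + 1 + l)%N%:Z a.
have xi_on : orthonormal_family ip xi' by move=> l a m b; rewrite /xi' (innov_on ipP xH xiP).
have eta_on : orthonormal_family ip eta'.
  move=> l a m b; rewrite /eta' (innov_on ipP xrH etaP).
  by rewrite eqz_nat eqn_add2l.
have bE l j a c : b (n + j + l + 1)%N%:Z a c = - ip (xi' l a) (eta' j c).
  rewrite /xi' /eta' cross mxE; congr (- cmean _).
  by have -> : (n + j + l + 1)%N%:Z = l%:Z + (n + 1 + j)%N%:Z by lia.
have bE' l j a c : (b (n + j + l + 1)%N%:Z)^t* a c = - ip (eta' l a) (xi' j c).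
  by rewrite adjE (addnAC n j l) bE (ipC ipP (xi' j c) (eta' l a)); exact: rmorphN.
pose M := clsp ip x setT; have cM : closed_subspace ip M by exact: clsp_csub.
have Mx k a : M (x (k, a)) by exact: (clsp_gen ipP).
have xrM J : clsp ip xr J `<=` M.
  by apply: (clsp_min cM) => u _; exact: Mx.
have Mxi l a : M (xi' l a) by apply: (clspS ipP _ (xiP l a).1).
have Meta l a : M (eta' l a) by exact: xrM (etaP _ a).1.
have xi_K l b y : clsp ip x K y -> ip y (xi' l b) = 0.
  apply: (clsp_orthl ipP) => -[k a]; rewrite /K /= => /andP[_ k1].
  by apply: (innov_lt ipP H2 Han xH xiP); lia.
have eta_K l b y : clsp ip x K y -> ip y (eta' l b) = 0.
  apply: (clsp_orthl ipP) => -[k a]; rewrite /K /= => /andP[k1 _].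
  have -> : x (k, a) = xr (- k, a) by rewrite /xr /= opprK.
  by apply: (innov_lt ipP Ht2 Htan xrH etaP); lia.
(* Orthogonality to the [xi'] puts v in the span up to time -1, orthogonality to the [eta'] in the
   span from time -n on; the hypothesis on intersections brings v into the observed block. *)
have core_K v : core ip xi' eta' M v -> clsp ip x K v.
  move=> [Mv v1 v2].
  have p1 : clsp ip x (upto (-1)) v.
    have := innov_complete ipP H2 Han Hd Hi c0n Ho xH xiP (m := 0) Mv.
    by apply => -[k|k] i // _; exact: v1.
  have Mrv : clsp ip xr setT v.
    apply: (clsp_min (clsp_csub ipP _ _)) Mv => -[k a] _.
    rewrite (_ : x (k, a) = xr (- k, a)); first exact: (clsp_gen ipP).
    by rewrite /xr /= opprK.
  have p2 : clsp ip x [set a | - n%:Z <= a.1] v.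
    have v2' k i : n.+1%:Z <= k -> ip v (eta k i) = 0.
      move=> nk; have -> : k = (n + 1 + absz (k - n.+1%:Z))%N%:Z by lia.
      exact: v2.
    move: (innov_complete ipP Ht2 Htan Htd Hti ct0n Hto xrH etaP Mrv v2').
    apply: (clsp_min (clsp_csub ipP _ _)) => -[k a]; rewrite /upto /= => ka.
    by apply: (clsp_gen ipP) => /=; lia.
  exact: inter.
(* Both families lie in the complement of the span of K, where a vector and its residual have the
   same inner products. *)
have residual_innov v f : residual x K v f ->
    forall l c, ip f (xi' l c) = ip v (xi' l c) /\ ip f (eta' l c) = ip v (eta' l c).
  move=> [_ _ hf] l c; split; apply: (ip_sub0 ipP); apply: hf.
  - exact: Mxi.
  - by move=> y Ky; apply: (ip_eq0C ipP); exact: xi_K.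
  - exact: Meta.
  - by move=> y Ky; apply: (ip_eq0C ipP); exact: eta_K.
have e_xi i k j : ip (e i) (xi' k j) = (0%N == k)%:R * c0 i j.
  have [-> _] := residual_innov _ _ (he i) k j; case: k => [|k].
    by rewrite mul1r; exact: (innov_eq ipP H2 xH xiP).
  by rewrite mul0r; apply: (innov_lt ipP H2 Han xH xiP).
have e_eta i k j : ip (e i) (eta' k j) = 0.
  have [_ ->] := residual_innov _ _ (he i) k j; rewrite (_ : x (0, i) = xr (0, i)).
    by apply: (innov_lt ipP Ht2 Htan xrH etaP); lia.
  by rewrite /xr oppr0.
have xE i : x (- n.+1%:Z, i) = xr (n.+1%:Z, i) by [].
have et_xi i k j : ip (et i) (xi' k j) = 0.
  have [-> _] := residual_innov _ _ (het i) k j.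
  by apply: (innov_lt ipP H2 Han xH xiP); lia.
have et_eta i k j : ip (et i) (eta' k j) = (0%N == k)%:R * ct0 i j.
  have [_ ->] := residual_innov _ _ (het i) k j; rewrite xE; case: k => [|k].
    by rewrite mul1r /eta' addn0 addn1; exact: (innov_eq ipP Ht2 xrH etaP).
  by rewrite mul0r; apply: (innov_lt ipP Ht2 Htan xrH etaP); lia.
pose E := normalized c0 e; pose Et := normalized ct0 et.
have M_normalized c (f : 'I_q -> V) : (forall a, M (f a)) -> forall a, M (normalized c f a).
  by move=> Mf a; apply: (csub_sum _ cM) => b _; exact: (csubZ cM).
have ME := M_normalized c0 e (fun a => let: And3 m _ _ := he a in m).
have MEt := M_normalized ct0 et (fun a => let: And3 m _ _ := het a in m).
have E_core a v : core ip xi' eta' M v -> ip (E a) v = 0.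
  by move=> /core_K Kv; apply: (ip_normalized0 ipP) => b; have [_ + _] := he b; apply.
have Et_core a v : core ip eta' xi' M v -> ip (Et a) v = 0.
  move=> [v1 v2 v3]; have Kv : clsp ip x K v by exact: core_K.
  by apply: (ip_normalized0 ipP) => b; have [_ + _] := het b; apply.
have E_eta a l b : ip (E a) (eta' l b) = 0 by exact: (ip_normalized0 ipP).
have Et_xi a l b : ip (Et a) (xi' l b) = 0 by exact: (ip_normalized0 ipP).
have E_xi a l b : ip (E a) (xi' l b) = ip (xi' 0%N a) (xi' l b) by exact: (ip_normalized ipP).
have Et_eta a l b : ip (Et a) (eta' l b) = ip (eta' 0%N a) (eta' l b).
  exact: (ip_normalized ipP).
have [s1 s1E] := even_series (alpha' := fun k => (b k)^t*) ipP xi_on eta_on cM Mxi Meta ME E_core E_eta E_xi bE bE'.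
(* Time reversal exchanges the two families and with them the matrices b and their adjoints, since
   <eta, xi> is conjugate to <xi, eta>. *)
have [s2 s2E] := even_series (alpha := fun k => (b k)^t*) ipP eta_on xi_on cM Meta Mxi MEt Et_core Et_xi Et_eta bE' bE.
have [s3 s3E] := odd_series (alpha' := fun k => (b k)^t*) ipP xi_on eta_on cM Mxi Meta ME E_core E_eta E_xi Et_xi Et_eta bE bE'.
split; split => //.
- by rewrite (gram_normalized ipP e e c0n c0n) -s1E.
- by rewrite (gram_normalized ipP et et ct0n ct0n) -s2E.
- by rewrite (gram_normalized ipP e et c0n ct0n) -s3E.
Qed.

End prediction_errors.

Theorem theorem5p3 (R : realType) (d : measure_display)
    (Omega : measurableType d) (P : probability Omega R)
    (q : nat) (hq : (0 < q)%N)
    (X : int -> Omega -> 'cV[R[i]]_q) (w h ht : R[i] -> 'M[R[i]]_q)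
    (hX : stationary_process P X)
    (hw : spectral_density P X w)
    (hlog : logdet_integrable w)
    (h_outer : outer h)
    (ht_outer : outer ht)
    (hfact : circle_ae (fun z => w z = h z *m (h z)^t*))
    (htfact : circle_ae (fun z => time_reversal w z = ht z *m (ht z)^t*))
    (hinter : forall n : nat, (0 < n)%N ->
      MX P X `]-oo, -1] `&` MX P X `[- n%:Z, +oo[ = MX P X `[- n%:Z, -1])
    (n : nat) (hn : (0 < n)%N) :
  let c0 := hardy_ext h 0 in
  let ct0 := hardy_ext ht 0 in
  let eps := Pperp P X `[- n%:Z, -1] (X 0) in
  let epst := Pperp P X `[- n%:Z, -1] (X (- (n.+1)%:Z)) in
  [/\ mxsummable (fun k => b_seq h ht n (2 * k)%N 0%N) /\
      gram P eps eps =
        c0 *m mxseries (fun k => b_seq h ht n (2 * k)%N 0%N) *m c0^t*,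
      mxsummable (fun k => bt_seq h ht n (2 * k)%N 0%N) /\
      gram P epst epst =
        ct0 *m mxseries (fun k => bt_seq h ht n (2 * k)%N 0%N) *m ct0^t* &
      mxsummable (fun k => b_seq h ht n (2 * k + 1)%N 0%N) /\
      gram P eps epst =
        c0 *m mxseries (fun k => b_seq h ht n (2 * k + 1)%N 0%N) *m ct0^t*].
Proof.
move=> c0 ct0 eps epst; have [X2 _ _] := hX.
have [c0E [H2 Han] Hd Hi [c0d Ho]] := outer_conditions hfact hlog h_outer.
have [ct0E [Ht2 Htan] Htd Hti [ct0d Hto]] := outer_conditions htfact (logdet_reversal hlog) ht_outer.
have xH := gram_factor X2 hw H2 hfact.
have htfact' : {ae @lebesgue_measure R, forall t, circ t ->
    w (expi (- t)) = ht (expi t) *m (ht (expi t))^t*}.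
  by apply: aeS1 htfact => t e ct; rewrite -e // /time_reversal expiN.
have xrH := gram_factor_reversed X2 hw Ht2 htfact'.
have HHt := hfact_reversal hfact htfact.
pose K : set (int * 'I_q) := [set a | - n%:Z <= a.1 <= -1].
have KE : [set a | `[- n%:Z, -1]%classic a.1] = K.
  by apply/seteqP; split=> -[k a]; rewrite /= in_itv.
have inter v : clsp (@ipL2 _ _ _ P _ measurableT) (entry P X) (upto (-1)) v ->
    clsp (@ipL2 _ _ _ P _ measurableT) (entry P X) [set a | - n%:Z <= a.1] v ->
    clsp (@ipL2 _ _ _ P _ measurableT) (entry P X) K v.
  move=> v1 v2; rewrite -KE; apply/(MXE X2); rewrite -hinter //; split; apply/(MXE X2).
    by apply: (clspS (hilbert_L2 P measurableT) _ v1) => -[k a]; rewrite /upto /= in_itv /=.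
  by apply: (clspS (hilbert_L2 P measurableT) _ v2) => -[k a]; rewrite /= in_itv /= andbT.
have res (v : L2 P (@measurableT _ Omega)) : exists e : L2 P (@measurableT _ Omega),
    oproj P (MXperp P X `[- n%:Z, -1]) v = e :> (Omega -> R[i]) /\
    residual (@ipL2 _ _ _ P _ measurableT) (entry P X) K v e.
  have [e [e1 e2 e3 e4]] := oproj_exists X2 `[- n%:Z, -1] v.
  by exists e; split => //; split; rewrite -?KE.
have /choice [e he] := fun a => res (entry P X (0, a)).
have /choice [et het] := fun a => res (entry P X (- n.+1%:Z, a)).
have epsE s a : eps s a 0 = e a s.
  have [<- _] := he a; rewrite mxE; congr (oproj _ _ _ s); by rewrite entryE.
have epstE s a : epst s a 0 = et a s.
  have [<- _] := het a; rewrite mxE; congr (oproj _ _ _ s); by rewrite entryE.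
have gramE (U W : Omega -> 'cV[R[i]]_q) (f g : 'I_q -> L2 P (@measurableT _ Omega)) :
    (forall t a, U t a 0 = f a t) -> (forall t a, W t a 0 = g a t) ->
    gram P U W = \matrix_(i, j) ipL2 (f i) (g j).
  move=> hU hW; apply/matrixP => i j; rewrite !mxE; congr cintegral; apply/funext => t.
  by rewrite mxE big_ord1 adjE hU hW.
have betaE : beta h ht = phase_coef (fun t => h (expi t)) (fun t => ht (expi t)).
  apply/funext => k; apply/matrixP => i j; rewrite /beta mxE circle_meanE mxE; congr (- cmean _).
  by apply/funext => t; rewrite mxE /sharp -expiN.
rewrite (gramE _ _ _ _ epsE epsE) (gramE _ _ _ _ epstE epstE) (gramE _ _ _ _ epsE epstE).
rewrite /b_seq /bt_seq betaE /c0 /ct0 c0E ct0E.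
exact: (residual_gram (hilbert_L2 P measurableT) H2 Han Hd Hi c0d Ho xH Ht2 Htan Htd Hti
  ct0d Hto xrH HHt inter (fun a => (he a).2) (fun a => (het a).2)).
Qed.
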